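(* For the defeasible logic ${DL}(\partial_{||})$, the set of all consequences (with tags $\Delta$, $\lambda$, $\partial_{||}$) of a propositional defeasible theory $D$ can be computed in time linear in the size of $D$. Consequently, the inference problem for propositional ${DL}(\partial_{||})$ (given $D$, a tag $d\in\{\Delta,\lambda,\partial_{||}\}$ and a literal $q$, decide whether $+d\,q$ is a consequence of $D$) can be solved in linear time.
   Context: Literals are propositions $p$ or their negations $\neg p$; ${\sim}q$ is the complement of $q$. A propositional defeasible theory is $D=(F,R,>)$: $F$ a finite set of literals (facts), $R$ a finite set of rules, $>$ an acyclic binary relation on $R$. Each rule $r$ has a finite antecedent set $A(r)$ of literals, a consequent literal, and is strict ($\rightarrow$), defeasible ($\Rightarrow$) or a defeater ($\leadsto$). $R_s$: strict rules; $R_{sd}$: strict and defeasible rules; $R[q]$: rules with consequent $q$. A proof $P$ is a finite sequence of tagged literals, $P(1..i)$ its first $i$ elements. $+\Delta$: append $+\Delta q$ if $q\in F$ or some $r\in R_s[q]$ has $+\Delta a\in P(1..i)$ for all $a\in A(r)$. $-\Delta$: append $-\Delta q$ if $q\notin F$ and every $r\in R_s[q]$ has some $a\in A(r)$ with $-\Delta a\in P(1..i)$. $P_\Delta$: all $\pm\Delta$ conclusions derivable. $+\lambda$: append $+\lambda q$ if $+\Delta q\in P_\Delta$, or some $r\in R_{sd}[q]$ has $+\lambda a\in P(1..i)$ for all $a\in A(r)$ and $+\Delta{\sim}q\notin P_\Delta$. $P_\lambda$: all $+\lambda$ conclusions derivable. $+\partial_{||}$: append $+\partial_{||}q$ if (1)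 $+\Delta q\in P_\Delta$, or (2): (2.1) some $r\in R_{sd}[q]$ has $+\partial_{||}a\in P(1..i)$ for all $a\in A(r)$; (2.2) $+\Delta{\sim}q\notin P_\Delta$; (2.3) every $s\in R[{\sim}q]$ satisfies (2.3.1) some $a\in A(s)$ has $+\lambda a\notin P_\lambda$, or (2.3.2) some $t\in R_{sd}[q]$ with $t>s$ has $+\partial_{||}a\in P(1..i)$ for all $a\in A(t)$. A conclusion is a consequence of $D$ if it occurs in some proof. The size of $D$ is the total number of symbols in its facts, rules and superiority relation. *)

(* Defs.v *)
From HB Require Import structures.
From mathcomp Require Import all_boot.

Set Implicit Arguments.
Unset Strict Implicit.
Unset Printing Implicit Defensive.

(** * Propositional defeasible theories *)

(* [(true, p)] is the proposition p and [(false, p)] is its negation; the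
   propositions are drawn from the countable supply [nat]. *)
Definition literal := (bool * nat)%type.

Definition compl (q : literal) : literal := (~~ q.1, q.2).

Inductive rule_kind := Strict | Defeasible | Defeater.

Record rule := Rule {
  kind : rule_kind;
  body : seq literal;
  conseq : literal
}.

(* The finite sets F, R, > and A(r) are given by listings, repetitions being
   allowed.  A rule is identified by its position in [rules], so [superior]
   relates positions: [(t, s)] in it means t > s. *)
Record theory := Theory {
  facts : seq literal;
  rules : seq rule;
  superior : seq (nat * nat)
}.

Definition rule_at (D : theory) (r : nat) : rule :=
  nth (Rule Strict [::] (true, 0)) (rules D) r.

Definition sup (D : theory) : rel nat := fun t s => (t, s) \in superior D.

Definition acyclic (e : rel nat) : Prop :=
  forall x p, path e x p -> p <> [::] -> last x p <> x.

Definition well_formed (D : theory) : Prop :=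
  (forall t s, sup D t s -> t < size (rules D) /\ s < size (rules D)) /\
  acyclic (sup D).

Definition antecedent (D : theory) (r : nat) : seq literal := body (rule_at D r).

Definition R_ (D : theory) (q : literal) (r : nat) : Prop :=
  r < size (rules D) /\ conseq (rule_at D r) = q.

Definition Rs (D : theory) (q : literal) (r : nat) : Prop :=
  R_ D q r /\ kind (rule_at D r) = Strict.

Definition Rsd (D : theory) (q : literal) (r : nat) : Prop :=
  R_ D q r /\
  (kind (rule_at D r) = Strict \/ kind (rule_at D r) = Defeasible).

(** * The proof theory of DL(∂||) *)

Inductive dtag := Delta | Lambda | Partial.

Inductive signed_tag := PlusDelta | MinusDelta | PlusLambda | PlusPartial.

Definition plus_tag (d : dtag) : signed_tag :=
  match d with
  | Delta => PlusDelta | Lambda => PlusLambda | Partial => PlusPartial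
  end.

Lemma signed_tag_comparable : comparable signed_tag.
Proof. by rewrite /comparable /decidable; decide equality. Qed.

HB.instance Definition _ :=
  hasDecEq.Build signed_tag (compareP signed_tag_comparable).

Definition conclusion := (signed_tag * literal)%type.

(* [cond P c] says that [c] may be appended to the proof [P]. *)
Inductive proof (cond : seq conclusion -> conclusion -> Prop) :
    seq conclusion -> Prop :=
| proof_nil : proof cond [::]
| proof_rcons P c : proof cond P -> cond P c -> proof cond (rcons P c).

Definition derivable (cond : seq conclusion -> conclusion -> Prop)
    (c : conclusion) : Prop :=
  exists P, proof cond P /\ c \in P.

Definition all_proved (d : signed_tag) (P : seq conclusion)
    (A : seq literal) : Prop :=
  forall a, a \in A -> (d, a) \in P.

Definition plus_Delta_cond (D : theory) (P : seq conclusion) (q : literal) :=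
  q \in facts D \/
  exists r, Rs D q r /\ all_proved PlusDelta P (antecedent D r).

Definition minus_Delta_cond (D : theory) (P : seq conclusion) (q : literal) :=
  q \notin facts D /\
  forall r, Rs D q r ->
    exists a, a \in antecedent D r /\ (MinusDelta, a) \in P.

Definition Delta_cond (D : theory) (P : seq conclusion) (c : conclusion) :
    Prop :=
  match c with
  | (PlusDelta, q) => plus_Delta_cond D P q
  | (MinusDelta, q) => minus_Delta_cond D P q
  | _ => False
  end.

Definition P_Delta (D : theory) (c : conclusion) : Prop :=
  derivable (Delta_cond D) c.

Definition plus_lambda_cond (D : theory) (P : seq conclusion) (q : literal) :=
  P_Delta D (PlusDelta, q) \/
  (exists r, Rsd D q r /\ all_proved PlusLambda P (antecedent D r)) /\
  ~ P_Delta D (PlusDelta, compl q).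

Definition lambda_cond (D : theory) (P : seq conclusion) (c : conclusion) :
    Prop :=
  match c with
  | (PlusLambda, q) => plus_lambda_cond D P q
  | _ => False
  end.

Definition P_lambda (D : theory) (c : conclusion) : Prop :=
  derivable (lambda_cond D) c.

Definition plus_partial_cond (D : theory) (P : seq conclusion) (q : literal) :=
  P_Delta D (PlusDelta, q) \/
  [/\ exists r, Rsd D q r /\ all_proved PlusPartial P (antecedent D r),
      ~ P_Delta D (PlusDelta, compl q)
    & forall s, R_ D (compl q) s ->
        (exists a, a \in antecedent D s /\ ~ P_lambda D (PlusLambda, a)) \/
        (exists t, [/\ Rsd D q t, sup D t s
                     & all_proved PlusPartial P (antecedent D t)])].

Definition proof_cond (D : theory) (P : seq conclusion) (c : conclusion) :
    Prop :=
  match c with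
  | (PlusDelta, q) => plus_Delta_cond D P q
  | (MinusDelta, q) => minus_Delta_cond D P q
  | (PlusLambda, q) => plus_lambda_cond D P q
  | (PlusPartial, q) => plus_partial_cond D P q
  end.

Definition consequence (D : theory) (c : conclusion) : Prop :=
  derivable (proof_cond D) c.

(* The propositions occurring in D.  CIf p does not occur in D, then -Δ p and
   -Δ ¬p are consequences of D for trivial reasons and p has no others, so the
   finite object to be computed is the set of consequences over [props D]. *)
Definition props (D : theory) : seq nat :=
  [seq q.2 | q <- facts D] ++
  flatten [seq [seq q.2 | q <- conseq r :: body r] | r <- rules D].

(** * Size *)

Definition lit_size (q : literal) : nat := if q.1 then 1 else 2.

(* Antecedent, arrow and consequent. *)
Definition rule_size (r : rule) : nat :=
  sumn [seq lit_size a | a <- body r] + 1 + lit_size (conseq r).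

(* A superiority statement t > s has three symbols.  The size of the empty theory
   is 0, hence the linear bounds are stated with [(theory_size D).+1]. *)
Definition theory_size (D : theory) : nat :=
  sumn [seq lit_size q | q <- facts D] + sumn [seq rule_size r | r <- rules D]
  + 3 * size (superior D).

(** * Random access machines *)

(* Programs use finitely many of the registers and of the arrays (the first
   argument of [CStore] and the second of [CLoad] is an array name).  All cells
   hold natural numbers and are initially 0, and there is a one-way input tape
   and a one-way output tape.  Arithmetic is limited to successor and
   predecessor: after t steps every number in the machine is at most t plus the
   largest number in the input or in the program, so that charging one unit per
   instruction is also fair when words have logarithmic length. *)
Inductive test :=
| TEq of nat & nat
| TLt of nat & nat.

Inductive prog :=
| CSkip
| CConst of nat & nat
| CCopy of nat & nat
| CSucc of nat
| CPred of nat
| CLoad of nat & nat & nat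
| CStore of nat & nat & nat
| CRead of nat
| CWrite of nat
| CSeq of prog & prog
| CIf of test & prog & prog
| CWhile of test & prog.

Record state := State {
  reg : nat -> nat;
  arr : nat -> nat -> nat;
  input : seq nat;
  output : seq nat
}.

Definition upd (T : Type) (f : nat -> T) (x : nat) (v : T) : nat -> T :=
  fun y => if y == x then v else f y.

Definition set_reg (s : state) (x v : nat) : state :=
  State (upd (reg s) x v) (arr s) (input s) (output s).

Definition set_arr (s : state) (a i v : nat) : state :=
  State (reg s) (upd (arr s) a (upd (arr s a) i v)) (input s) (output s).

Definition eval_test (b : test) (s : state) : bool :=
  match b with
  | TEq x y => reg s x == reg s y
  | TLt x y => reg s x < reg s y
  end.

(* [exec p s n s']: started in [s], [p] halts in [s'] after n elementary
   instructions and tests.  Reading past the end of the input yields 0. *)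
Inductive exec : prog -> state -> nat -> state -> Prop :=
| exec_skip s : exec CSkip s 1 s
| exec_const x v s : exec (CConst x v) s 1 (set_reg s x v)
| exec_copy x y s : exec (CCopy x y) s 1 (set_reg s x (reg s y))
| exec_succ x s : exec (CSucc x) s 1 (set_reg s x (reg s x).+1)
| exec_pred x s : exec (CPred x) s 1 (set_reg s x (reg s x).-1)
| exec_load x a y s : exec (CLoad x a y) s 1 (set_reg s x (arr s a (reg s y)))
| exec_store a x y s :
    exec (CStore a x y) s 1 (set_arr s a (reg s x) (reg s y))
| exec_read x s :
    exec (CRead x) s 1
      (State (upd (reg s) x (head 0 (input s))) (arr s)
             (behead (input s)) (output s))
| exec_write x s :
    exec (CWrite x) s 1
      (State (reg s) (arr s) (input s) (rcons (output s) (reg s x)))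
| exec_seq p1 p2 s n1 s1 n2 s2 :
    exec p1 s n1 s1 -> exec p2 s1 n2 s2 -> exec (CSeq p1 p2) s (n1 + n2) s2
| exec_if b p1 p2 s n s' :
    exec (if eval_test b s then p1 else p2) s n s' ->
    exec (CIf b p1 p2) s n.+1 s'
| exec_while_false b p s :
    eval_test b s = false -> exec (CWhile b p) s 1 s
| exec_while_true b p s n1 s1 n2 s2 :
    eval_test b s = true -> exec p s n1 s1 -> exec (CWhile b p) s1 n2 s2 ->
    exec (CWhile b p) s (n1 + n2).+1 s2.

Definition initial (w : seq nat) : state :=
  State (fun _ => 0) (fun _ _ => 0) w [::].

Definition computes_within (p : prog) (w : seq nat) (t : nat) (o : seq nat) :
    Prop :=
  exists n s, [/\ exec p (initial w) n s, n <= t & output s = o].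

(** * Input and output formats *)

Definition encode_literal (q : literal) : seq nat :=
  [:: if q.1 then 1 else 2; q.2].

Definition encode_list (T : Type) (enc : T -> seq nat) (l : seq T) : seq nat :=
  flatten (map enc l) ++ [:: 0].

Definition kind_code (k : rule_kind) : nat :=
  match k with Strict => 1 | Defeasible => 2 | Defeater => 3 end.

Definition encode_rule (r : rule) : seq nat :=
  kind_code (kind r) :: encode_literal (conseq r)
  ++ encode_list encode_literal (body r).

Definition encode_theory (D : theory) : seq nat :=
  encode_list encode_literal (facts D) ++ encode_list encode_rule (rules D)
  ++ encode_list (fun ts => [:: 1; ts.1; ts.2]) (superior D).

Definition tag_code (d : dtag) : nat :=
  match d with Delta => 1 | Lambda => 2 | Partial => 3 end.

Definition encode_query (D : theory) (d : dtag) (q : literal) : seq nat :=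
  encode_theory D ++ tag_code d :: encode_literal q.

Definition signed_tag_code (d : signed_tag) : nat :=
  match d with
  | PlusDelta => 1 | PlusLambda => 2 | PlusPartial => 3 | MinusDelta => 4
  end.

Definition encode_conclusions (cs : seq conclusion) : seq nat :=
  encode_list (fun c => signed_tag_code c.1 :: encode_literal c.2) cs.

Definition lists_consequences (D : theory) (cs : seq conclusion) : Prop :=
  forall c : conclusion,
    c \in cs <-> consequence D c /\ c.2.2 \in props D.

(* Main.v *)
Require Import Defs.
From mathcomp Require Import all_boot zify.
From Stdlib Require Import Classical.

Set Implicit Arguments.
Unset Strict Implicit.
Unset Printing Implicit Defensive.

(** Two features of the logic shape the graph. $-\Delta$ is an inductive notion of its own and not
    the negation of $+\Delta$ (a cycle of strict rules can give neither), so -Δq and not +Δq need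
    different nodes. And clause (2.3) ranges over pairs of an attacker and a superior rule, of which
    there may be quadratically many; linearity is saved by one shared node per rule saying that its
    antecedents are +∂, and by letting only the listed superiority statements contribute edges, at
    most one each. The negations are stratified, so soundness of the guards fired in one round is
    exactly completeness of the round before. A conjunctive node without incoming edges is never
    reached, which is why rules with empty body need the artificial predecessor [start]. Numbers are
    assigned to nodes during reading, so the invariant has to speak of the graph of the part read so
    far; each reading step is matched by a lemma saying how the relation [edge] grows. *)

(* The four kinds of conclusions are the nodes reached in an AND/OR graph of size
   linear in D.  Besides a node for each tagged literal it has nodes saying that all
   antecedents of a rule are +∂, that clause (2.3) holds for an attacker, etc.; they
   turn the nested quantifiers of the inference conditions into alternating
   conjunctive and disjunctive nodes.  The three negative conditions (q is not a
   fact, not +Δq, not +λq) are guard nodes without incoming edges: they are fired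
   between three rounds of propagation, when the set they negate is final.  As in
   unit propagation for Horn clauses, each node has a counter of the incoming edges
   still missing (1 for a disjunctive node), so that every edge is followed once.
   The graph is written down while the input is read; propositions are renamed by a
   table, because a proposition costs one symbol however large its number is.
   Time is accounted for by static costs of loop-free program fragments, and for
   propagation by the out-degrees of the nodes not yet expanded. *)

(** * Running programs *)

(** Meant for loop-free programs, whose final state becomes a term that can be simplified; the value
    on [CWhile] is a dummy. *)
Fixpoint run (p : prog) (s : state) : state :=
  match p with
  | CSkip => s
  | CConst x v => set_reg s x v
  | CCopy x y => set_reg s x (reg s y)
  | CSucc x => set_reg s x (reg s x).+1
  | CPred x => set_reg s x (reg s x).-1
  | CLoad x a y => set_reg s x (arr s a (reg s y))
  | CStore a x y => set_arr s a (reg s x) (reg s y)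
  | CRead x => State (upd (reg s) x (head 0 (input s))) (arr s)
                     (behead (input s)) (output s)
  | CWrite x => State (reg s) (arr s) (input s) (rcons (output s) (reg s x))
  | CSeq p1 p2 => run p2 (run p1 s)
  | CIf b p1 p2 => if eval_test b s then run p1 s else run p2 s
  | CWhile _ _ => s
  end.

Lemma run_seq p1 p2 s : run (CSeq p1 p2) s = run p2 (run p1 s).
Proof. by []. Qed.

Lemma run_if b p1 p2 s :
  run (CIf b p1 p2) s = run (if eval_test b s then p1 else p2) s.
Proof. by rewrite /=; case: ifP. Qed.

Fixpoint loopfree (p : prog) : bool :=
  match p with
  | CSeq p1 p2 | CIf _ p1 p2 => loopfree p1 && loopfree p2
  | CWhile _ _ => false
  | _ => true
  end.

(** A bound that does not depend on the state, since each test is charged its longer branch. Like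
    [run], it is meaningful for loop-free programs only. *)
Fixpoint cost (p : prog) : nat :=
  match p with
  | CSeq p1 p2 => cost p1 + cost p2
  | CIf _ p1 p2 => (maxn (cost p1) (cost p2)).+1
  | _ => 1
  end.

Lemma exec_run p s :
  loopfree p -> exists n, exec p s n (run p s) /\ n <= cost p.
Proof.
elim: p s => //=; try by move=> *; exists 1; split => //; constructor.
- move=> p1 IH1 p2 IH2 s /andP[/IH1-/(_ s)[n1 [e1 l1]] /IH2-/(_ (run p1 s))[n2 [e2 l2]]].
  by exists (n1 + n2); split; [apply: exec_seq e1 e2 | exact: leq_add].
- move=> b p1 IH1 p2 IH2 s /andP[/IH1-/(_ s)[n1 [e1 l1]] /IH2-/(_ s)[n2 [e2 l2]]].
  exists (if eval_test b s then n1 else n2).+1; split; last by case: ifP; lia.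
  by apply: exec_if; case: ifP.
Qed.

(** Total correctness with a time bound. For a sequence, the claim about the second program is the
    postcondition of the first, so proofs follow the order of execution. *)
Definition ends_within (p : prog) (s : state) (t : nat) (Q : state -> Prop) :=
  exists n s', [/\ exec p s n s', n <= t & Q s'].

Lemma ends_run p s t (Q : state -> Prop) :
  loopfree p -> cost p <= t -> Q (run p s) -> ends_within p s t Q.
Proof.
move=> lf lt q; have [n [e l]] := exec_run s lf.
by exists n, (run p s); split=> //; apply: leq_trans l lt.
Qed.

Lemma ends_seq p1 p2 s t1 t2 (Q : state -> Prop) :
  ends_within p1 s t1 (fun s1 => ends_within p2 s1 t2 Q) ->
  ends_within (CSeq p1 p2) s (t1 + t2) Q.
Proof.
move=> [n1 [s1 [e1 l1 [n2 [s2 [e2 l2 q]]]]]].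
by exists (n1 + n2), s2; split=> //; [apply: exec_seq e1 e2 | apply: leq_add].
Qed.

Lemma ends_weaken p s t t' (Q Q' : state -> Prop) :
  ends_within p s t Q -> t <= t' -> (forall s', Q s' -> Q' s') ->
  ends_within p s t' Q'.
Proof.
move=> [n [s' [e l q]]] lt h; exists n, s'; split=> //; last exact: h.
exact: leq_trans l lt.
Qed.

Lemma ends_while_false b p s (Q : state -> Prop) :
  eval_test b s = false -> Q s -> ends_within (CWhile b p) s 1 Q.
Proof. by move=> e q; exists 1, s; split=> //; exact: exec_while_false. Qed.

Lemma ends_while_true b p s t1 t2 (Q : state -> Prop) :
  eval_test b s = true ->
  ends_within p s t1 (fun s1 => ends_within (CWhile b p) s1 t2 Q) ->
  ends_within (CWhile b p) s (t1 + t2).+1 Q.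
Proof.
move=> eb [n1 [s1 [e1 l1 [n2 [s2 [e2 l2 q]]]]]].
exists (n1 + n2).+1, s2; split=> //; first exact: exec_while_true eb e1 e2.
by rewrite ltnS leq_add.
Qed.

(** * Static footprints: what a program can change *)

Fixpoint written_regs (p : prog) : seq nat :=
  match p with
  | CConst x _ | CCopy x _ | CSucc x | CPred x | CLoad x _ _ | CRead x => [:: x]
  | CSeq p1 p2 | CIf _ p1 p2 => written_regs p1 ++ written_regs p2
  | CWhile _ p1 => written_regs p1
  | _ => [::]
  end.

Fixpoint written_arrs (p : prog) : seq nat :=
  match p with
  | CStore a _ _ => [:: a]
  | CSeq p1 p2 | CIf _ p1 p2 => written_arrs p1 ++ written_arrs p2
  | CWhile _ p1 => written_arrs p1
  | _ => [::]
  end.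

Fixpoint silent (p : prog) : bool :=
  match p with
  | CWrite _ => false
  | CSeq p1 p2 | CIf _ p1 p2 => silent p1 && silent p2
  | CWhile _ p1 => silent p1
  | _ => true
  end.

Fixpoint readless (p : prog) : bool :=
  match p with
  | CRead _ => false
  | CSeq p1 p2 | CIf _ p1 p2 => readless p1 && readless p2
  | CWhile _ p1 => readless p1
  | _ => true
  end.

(** Footprints are syntactic and cover loops as well, so a correctness statement need only mention
    the cells it is about; the others are recovered from the program text. *)
Record frame (p : prog) (s s' : state) : Prop := Frame {
  frame_reg : forall x, x \notin written_regs p -> reg s' x = reg s x;
  frame_arr : forall a, a \notin written_arrs p -> arr s' a = arr s a;
  frame_input : readless p -> input s' = input s;
  frame_output : silent p -> output s' = output s
}.

Lemma frame_sub p p1 s s' :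
  {subset written_regs p1 <= written_regs p} ->
  {subset written_arrs p1 <= written_arrs p} ->
  (readless p -> readless p1) -> (silent p -> silent p1) ->
  frame p1 s s' -> frame p s s'.
Proof.
move=> hr ha hi ho [fr fa fi fo]; split.
- by move=> x hx; apply: fr; apply: contra hx; apply: hr.
- by move=> x hx; apply: fa; apply: contra hx; apply: ha.
- by move=> /hi; apply: fi.
- by move=> /ho; apply: fo.
Qed.

Lemma frame_trans p s1 s2 s3 : frame p s1 s2 -> frame p s2 s3 -> frame p s1 s3.
Proof.
move=> [fr fa fi fo] [fr' fa' fi' fo']; split=> [x hx|a ha|h|h].
- by rewrite fr' ?fr.
- by rewrite fa' ?fa.
- by rewrite fi' ?fi.
- by rewrite fo' ?fo.
Qed.

Lemma frame_seq p1 p2 s1 s2 s3 :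
  frame p1 s1 s2 -> frame p2 s2 s3 -> frame (CSeq p1 p2) s1 s3.
Proof.
move=> f1 f2; apply: (@frame_trans _ _ s2).
- by apply: frame_sub f1 => [x hx|x hx|/andP[]//|/andP[]//]; rewrite mem_cat hx.
- by apply: frame_sub f2 => [x hx|x hx|/andP[]//|/andP[]//]; rewrite mem_cat hx orbT.
Qed.

Lemma run_frame p s : frame p s (run p s).
Proof.
elim: p s => /=; try by move=> *; split=> //= z; rewrite inE /upd => /negbTE->.
- by move=> p1 IH1 p2 IH2 s; apply: frame_seq (IH1 _) (IH2 _).
- move=> b p1 IH1 p2 IH2 s; case: ifP => _.
  + by apply: frame_sub (IH1 s) => [x hx|x hx|/andP[]//|/andP[]//]; rewrite mem_cat hx.
  + by apply: frame_sub (IH2 s) => [x hx|x hx|/andP[]//|/andP[]//]; rewrite mem_cat hx orbT.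
Qed.

Lemma exec_frame p s n s' : exec p s n s' -> frame p s s'.
Proof.
elim=> {p s n s'}; try by move=> *; split=> //= z; rewrite inE /upd => /negbTE->.
- by move=> p1 p2 s n1 s1 n2 s2 _ f1 _ f2; apply: frame_seq f1 f2.
- move=> b p1 p2 s n s' _; case: ifP => _ f.
  + by apply: frame_sub f => [x hx|x hx|/andP[]//|/andP[]//]; rewrite mem_cat hx.
  + by apply: frame_sub f => [x hx|x hx|/andP[]//|/andP[]//]; rewrite mem_cat hx orbT.
- move=> b p s n1 s1 n2 s2 _ _ f1 _ f2; apply: frame_trans f2.
  by apply: frame_sub f1.
Qed.

Lemma ends_frame p s t (Q : state -> Prop) :
  ends_within p s t Q -> ends_within p s t (fun s' => Q s' /\ frame p s s').
Proof.
move=> [n [s' [e l q]]]; exists n, s'; split=> //; split=> //.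
exact: exec_frame e.
Qed.

Definition seqs (l : seq prog) : prog := foldr CSeq CSkip l.

(** The machine has no addition. The offsets added in this way are constants of the program, so the
    cost is constant too. *)
Definition addk (x k : nat) : prog := seqs (nseq k (CSucc x)).

Definition set_sum (x y k : nat) : prog := CSeq (CCopy x y) (addk x k).

Lemma run_addk x k s :
  [/\ forall z, reg (run (addk x k) s) z = if z == x then reg s x + k else reg s z,
      arr (run (addk x k) s) = arr s, input (run (addk x k) s) = input s
    & output (run (addk x k) s) = output s].
Proof.
elim: k s => [|k IH] s /=; first by split=> // z; rewrite addn0; case: eqP => // ->.
have [h1 h2 h3 h4] := IH (set_reg s x (reg s x).+1); split=> // z.
by rewrite h1 /= /upd eqxx; case: eqP => // _; lia.
Qed.

Lemma run_set_sum x y k s :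
  [/\ forall z, reg (run (set_sum x y k) s) z =
                  if z == x then reg s y + k else reg s z,
      arr (run (set_sum x y k) s) = arr s,
      input (run (set_sum x y k) s) = input s
    & output (run (set_sum x y k) s) = output s].
Proof.
have [h1 h2 h3 h4] := run_addk x k (set_reg s x (reg s y)); split=> // z.
by rewrite /set_sum [run _ _]/= h1 /= /upd eqxx; case: eqP.
Qed.

Lemma written_regs_addk x k z : z \in written_regs (addk x k) -> z = x.
Proof. by elim: k => //= k IH; rewrite inE => /orP[/eqP|]. Qed.

(** * Propagation in AND/OR graphs *)

(* A conjunctive node without incoming edges is never reached, so that the base
   nodes need no third kind. *)
Inductive and_or_closure (T : Type) (edge : T -> T -> Prop) (isor : T -> bool)
    (G : T -> Prop) : T -> Prop :=
| closure_base x : G x -> and_or_closure edge isor G x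
| closure_or x y : isor x -> edge y x -> and_or_closure edge isor G y ->
    and_or_closure edge isor G x
| closure_and x y : ~~ isor x -> edge y x ->
    (forall z, edge z x -> and_or_closure edge isor G z) -> and_or_closure edge isor G x.

Definition graph := seq (nat * nat).

(* The largest 1-based position in [E] of an edge leaving [x], and 0 if there is
   none. *)
Definition last_out (E : graph) (x : nat) : nat :=
  size E - index x (rev (map fst E)).

Lemma last_out_rcons E e x :
  last_out (rcons E e) x = if e.1 == x then (size E).+1 else last_out E x.
Proof.
by rewrite /last_out map_rcons rev_rcons size_rcons /=; case: eqP; rewrite ?subn0.
Qed.

(* [x] is the node being expanded: its edges in [E2] have been followed, those in
   [E1] have not. *)
Definition counter (O : nat -> bool) (done : seq nat) (x : nat) (E1 E2 : graph)
    (y : nat) : nat :=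
  if O y then
    nat_of_bool
      (~~ (has (fun e => (e.2 == y) && (e.1 \in done)) E1
           || has (fun e => (e.2 == y) && (e.1 \in x :: done)) E2))
  else
    count (fun e => (e.2 == y) && (e.1 \notin done)) E1
    + count (fun e => (e.2 == y) && (e.1 \notin x :: done)) E2.

(** An edge that does not leave [x] counts alike with [done] and with [x :: done], so it may move to
    the followed side without an instruction being executed. *)
Lemma counter_skip O done x E1 E2 e y : e.1 != x ->
  counter O done x (rcons E1 e) E2 y = counter O done x E1 (e :: E2) y.
Proof.
move=> ne; rewrite /counter -!cats1 has_cat count_cat /= !inE (negbTE ne) /=.
by case: ifP => _; [rewrite orbF orbA | rewrite addn0 addnA].
Qed.

(** The truncated predecessor leaves a satisfied disjunctive node at 0, so the same decrement serves
    both kinds of nodes. *)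
Lemma counter_follow O done x y E1 E2 z : x \notin done ->
  counter O done x E1 ((x, y) :: E2) z =
  if z == y then (counter O done x (rcons E1 (x, y)) E2 y).-1
  else counter O done x (rcons E1 (x, y)) E2 z.
Proof.
move=> nx; rewrite /counter -!cats1 !has_cat !count_cat /= !inE eqxx /=.
rewrite (negbTE nx) !andbF !orbF !andbT /=.
have [->|ne] := eqVneq z y.
  by rewrite eqxx orTb orbT; case: ifP => _; [case: (_ || _) | rewrite /= addn1 addSn].
by rewrite /= !addn0 add0n.
Qed.

(** The value of [counter] between two expansions. It depends on the expanded nodes only, so pushing
    a node changes no counter. *)
Definition remaining (O : nat -> bool) (done : seq nat) (E : graph) (y : nat) :=
  if O y then nat_of_bool (~~ has (fun e => (e.2 == y) && (e.1 \in done)) E)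
  else count (fun e => (e.2 == y) && (e.1 \notin done)) E.

Lemma counter_start O done x E : counter O done x E [::] =1 remaining O done E.
Proof. by move=> y; rewrite /counter /remaining /= orbF addn0. Qed.

Lemma counter_end O done x E : counter O done x [::] E =1 remaining O (x :: done) E.
Proof. by move=> y; rewrite /counter /remaining. Qed.

(* Edge number e, counted from 1, has target [arr 2 e]; [arr 1 e] is the previous
   edge with the same source and [arr 0 x] the last edge leaving x.  The nodes
   reached but not expanded form the stack [arr 5], and [arr 4] is the
   characteristic function of the nodes reached. *)
Record represents (E : graph) (stk done : seq nat) (cnt : nat -> nat)
    (s : state) : Prop := Represents {
  rep_zero : reg s 10 = 0;
  rep_edges : reg s 0 = size E;
  rep_first : forall x, arr s 0 x = last_out E x;
  rep_next : forall e, e < size E ->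
    arr s 1 e.+1 = last_out (take e E) (nth (0, 0) E e).1;
  rep_target : forall e, e < size E -> arr s 2 e.+1 = (nth (0, 0) E e).2;
  rep_cnt : forall y, arr s 3 y = cnt y;
  rep_reached : forall y, arr s 4 y = (y \in stk ++ done);
  rep_top : reg s 1 = size stk;
  rep_stack : forall i, i < size stk -> arr s 5 i = nth 0 stk i;
  rep_uniq : uniq (stk ++ done)
}.

Lemma represents_cnt E stk done cnt cnt' s :
  cnt =1 cnt' -> represents E stk done cnt s -> represents E stk done cnt' s.
Proof. by move=> e [*]; split=> // y; rewrite -e. Qed.

Lemma represents_frame E stk done cnt s s' :
  [/\ reg s' 0 = reg s 0, reg s' 1 = reg s 1 & reg s' 10 = reg s 10] ->
  (forall a, a < 6 -> arr s' a = arr s a) ->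
  represents E stk done cnt s -> represents E stk done cnt s'.
Proof.
move=> [h0 h1 h10] ha [*]; split; rewrite ?h0 ?h1 ?h10 // => *; rewrite ha //; auto.
Qed.

Definition fire (x i : nat) : prog :=
  CSeq (set_sum 2 x i) (seqs [:: CLoad 4 4 2;
    CIf (TEq 4 10)
      (seqs [:: CConst 5 1; CStore 4 2 5; CStore 5 1 2; CSucc 1]) CSkip]).

Definition push (v : nat) (stk done : seq nat) : seq nat :=
  if v \in stk ++ done then stk else rcons stk v.

Lemma mem_push v stk done : push v stk done ++ done =i v :: (stk ++ done).
Proof.
rewrite /push => z; case: ifP => h; last by rewrite cat_rcons !inE !mem_cat !inE orbCA.
by rewrite inE; case: eqP => // ->; rewrite h.
Qed.

Lemma run_fire E stk done cnt s x i :
  represents E stk done cnt s ->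
  represents E (push (reg s x + i) stk done) done cnt (run (fire x i) s).
Proof.
move=> h; rewrite /fire run_seq; have [h1 h2 _ _] := run_set_sum 2 x i s.
move: (run _ s) h1 h2 => s1; move: (reg s x + i) => v h1 h2.
have ev : reg s1 2 = v by rewrite h1.
have {}h : represents E stk done cnt s1.
  by apply: represents_frame h => [|a _]; rewrite ?h1 ?h2.
case: h => r10 r0 a0 a1 a2 a3 a4 r1 a5 u.
rewrite /= /upd /= r10 ev a4 /push; case: ifP => vin /=; first by split.
split; rewrite //= /upd //= ?r1 ?size_rcons //.
- move=> y; case: eqP => [->|/eqP ne]; rewrite cat_rcons mem_cat ?inE.
    by rewrite eqxx orbT.
  by rewrite (negbTE ne) /= a4 mem_cat.
- by move=> k; rewrite ltnS nth_rcons; case: ltngtP => // lt _; apply: a5.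
- by rewrite cat_rcons -cat1s uniq_catCA /= vin u.
Qed.

Definition follow_edge : prog :=
  seqs [:: CLoad 7 2 6; CLoad 8 3 7; CConst 5 1; CIf (TEq 8 5) (fire 7 0) CSkip;
           CPred 8; CStore 3 7 8; CLoad 6 1 6].

Definition follow_edges : prog := CWhile (TLt 10 6) follow_edge.

Definition propagate : prog :=
  CWhile (TLt 10 1)
    (CSeq (seqs [:: CPred 1; CLoad 9 5 1; CLoad 6 0 9]) follow_edges).

(** The counter is compared with 1 before it is decremented, so the target is fired just when its
    counter drops to 0. The link stored with an edge is [last_out] of the prefix before that edge,
    which is [E1]. *)
Lemma run_follow_edge E E1 x y E2 stk done cnt s :
  E = rcons E1 (x, y) ++ E2 -> represents E stk done cnt s ->
  reg s 6 = (size E1).+1 ->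
  represents E (if cnt y == 1 then push y stk done else stk) done
    (fun z => if z == y then (cnt y).-1 else cnt z) (run follow_edge s) /\
  reg (run follow_edge s) 6 = last_out E1 x.
Proof.
move=> eE h r6.
have lt : size E1 < size E by rewrite eE size_cat size_rcons; lia.
have nE : nth (0, 0) E (size E1) = (x, y).
  by rewrite eE nth_cat size_rcons ltnSn nth_rcons ltnn eqxx.
have tE : take (size E1) E = E1.
  by rewrite eE -cats1 -catA take_size_cat.
rewrite /follow_edge [run _ _]/=.
set s1 := set_reg (set_reg (set_reg s 7 _) 8 _) 5 1.
have e7 : reg s1 7 = y by rewrite /s1 /upd /= r6 (rep_target h) // nE.
have e8 : reg s1 8 = cnt y.
  by rewrite /s1 /upd /= r6 (rep_target h) // nE (rep_cnt h).
have e6 : reg s1 6 = (size E1).+1 by [].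
have h1 : represents E stk done cnt s1 by apply: represents_frame h.
have ec : (reg s1 8 == reg s1 5) = (cnt y == 1) by rewrite e8.
rewrite /set_reg ec.
pose s2 := if cnt y == 1 then run (fire 7 0) s1 else s1.
have h2 : represents E (if cnt y == 1 then push y stk done else stk) done cnt s2.
  rewrite /s2; case: ifP => _ //; have := run_fire 7 0 h1.
  by rewrite e7 addn0.
have [f6 f7 f8] : [/\ reg s2 6 = (size E1).+1, reg s2 7 = y & reg s2 8 = cnt y].
  by rewrite /s2; case: ifP => _; rewrite ?(frame_reg (run_frame _ _)).
rewrite -/s2; move: s2 h2 f6 f7 f8 => s2 [r10 r0 a0 a1 a2 a3 a4 r1 a5 u] f6 f7 f8.
split; last by rewrite /upd /= f6 a1 // nE tE.
split=> //= z; rewrite /upd /= f7 f8; by case: eqP.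
Qed.

Section Propagation.
Variables (E : graph) (O : nat -> bool) (G : nat -> Prop).

Let edge (x y : nat) : Prop := (x, y) \in E.

Definition justified (reached : seq nat) :=
  forall n, n \in reached -> and_or_closure edge O G n.

(** Restricted to targets of edges: a conjunctive node without incoming edges has counter 0 and yet
    must not be reached. *)
Definition saturated (cnt : nat -> nat) (reached : seq nat) :=
  forall x y, edge x y -> cnt y = 0 -> y \in reached.

Definition follow_cost := (cost follow_edge).+1.

(** Induction on [E1] from the right, because the outgoing edges of a node are linked from the last
    to the first. Edges with another source are passed over in the proof alone, so the time counts
    only those leaving [x]. *)
Lemma follow_edges_correct x done E1 E2 stk s :
  E = E1 ++ E2 -> x \notin done ->
  represents E stk (x :: done) (counter O done x E1 E2) s ->
  reg s 6 = last_out E1 x ->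
  justified (stk ++ x :: done) ->
  saturated (counter O done x E1 E2) (stk ++ x :: done) ->
  ends_within follow_edges s
    (follow_cost * count (fun e => e.1 == x) E1 + 1)
    (fun s' => exists stk',
      [/\ represents E stk' (x :: done) (remaining O (x :: done) E) s',
          {subset stk <= stk'},
          justified (stk' ++ x :: done)
        & saturated (remaining O (x :: done) E) (stk' ++ x :: done)]).
Proof.
move=> eE nx; elim/last_ind: E1 E2 stk s eE => [|E1 [a b] IH] E2 stk s eE h r6 hj hs.
  rewrite /= muln0 add0n; rewrite /= in eE; rewrite -{}eE in h hs.
  apply: ends_while_false; first by rewrite /= r6 (rep_zero h).
  exists stk; split; [exact: represents_cnt (counter_end _ _ _ _) h | by [] | by [] |].
  by move=> u v huv hc; apply: (hs u v) => //; rewrite counter_end.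
have eE' : E = E1 ++ (a, b) :: E2 by rewrite eE cat_rcons.
move: r6; rewrite last_out_rcons -cats1 count_cat /= addn0.
have [eax|nax] := eqVneq a x => r6; last first.
  rewrite addn0; apply: (IH ((a, b) :: E2) stk) => //.
  - by apply: represents_cnt h => y; apply: counter_skip.
  - by move=> u v huv; rewrite -counter_skip //; apply: hs huv.
subst a.
have hab : edge x b by rewrite /edge eE' mem_cat inE eqxx orbT.
have [h' r6'] := run_follow_edge eE h r6.
apply: (@ends_weaken _ _ (cost follow_edge + (follow_cost * count (fun e => e.1 == x) E1 + 1)).+1
          _ _ _ _ _ (fun _ => id)); last first.
  rewrite -[nat_of_bool true]/1 [X in _ <= X + 1]mulnDr muln1 {3}/follow_cost.
  by move: (follow_cost * _) (cost _) => u v; lia.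
apply: ends_while_true; first by rewrite /= (rep_zero h) r6.
apply: ends_run => //.
set c := counter O done x (rcons E1 (x, b)) E2 in h h' hs *.
set stk1 := if _ then _ else _ in h'.
have ms : {subset stk ++ x :: done <= stk1 ++ x :: done}.
  move=> z hz; rewrite /stk1; case: ifP => _ //.
  by rewrite mem_push inE hz orbT.
apply: ends_weaken (IH ((x, b) :: E2) stk1 _ eE' _ r6' _ _) _ _ => //.
- by apply: represents_cnt h' => z; rewrite counter_follow.
- move=> n; rewrite /stk1; case: eqP => [c1|_]; last exact: hj.
  rewrite mem_push inE => /orP[/eqP->|]; last exact: hj.
  have clx : and_or_closure edge O G x by apply: hj; rewrite mem_cat inE eqxx orbT.
  case Ob: (O b); first exact: closure_or Ob hab clx.
  (* The counter of [b] was 1 and the edge just followed accounts for it, so all other edges into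
     [b] come from [x] or from expanded nodes. *)
  apply: (closure_and _ hab); first by rewrite Ob.
  move=> z hz; apply: hj; rewrite mem_cat.
  move: c1; rewrite /c /counter Ob -cats1 count_cat /= eqxx nx /= addn0.
  set k1 := count _ E1; set k2 := count _ E2 => c1.
  have c0 : k1 = 0 by lia.
  have c2 : k2 = 0 by lia.
  apply/orP; right; move: hz; rewrite /edge eE' mem_cat inE => /or3P[hz|/eqP[->]|hz].
  + move/eqP: c0; rewrite eqn0Ngt -has_count => /hasPn/(_ _ hz) /=.
    by rewrite eqxx /= negbK inE => ->; rewrite orbT.
  + by rewrite inE eqxx.
  + move/eqP: c2; rewrite eqn0Ngt -has_count => /hasPn/(_ _ hz) /=.
    by rewrite eqxx /= negbK.
(* If the counter of [b] is 0 after the decrement, it was 0 before, and [b] was already reached, or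
   1, and [b] has just been fired. *)
- move=> u v huv; rewrite counter_follow // -/c.
  case: eqP => [->|_] hc; last by apply: ms; apply: hs huv hc.
  have [c0|c0] := eqVneq (c b) 0; first by apply: ms; apply: hs hab c0.
  have c1 : c b = 1 by lia.
  by rewrite /stk1 c1 eqxx mem_push inE eqxx.
- move=> s' [stk' [h1 h2 h3 h4]]; exists stk'; split=> // z hz; apply: h2.
  rewrite /stk1 /push; case: ifP => _ //; case: ifP => _ //.
  by rewrite mem_rcons inE hz orbT.
Qed.

Variable N : nat.
Hypothesis edge_bound : forall x y, edge x y -> x < N /\ y < N.

(** The 6 pays for taking the node from the stack and loading its first link (4 instructions), for
    the test that enters the outer loop and for the one that leaves the inner loop. *)
Definition node_cost (n : nat) := 6 + follow_cost * count (fun e => e.1 == n) E.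

(** A potential: each node not yet expanded holds the full price of its expansion. *)
Definition work_left (done : seq nat) := \sum_(n < N | val n \notin done) node_cost n.

Lemma work_left_cons x done : x < N -> x \notin done ->
  work_left done = node_cost x + work_left (x :: done).
Proof.
move=> lx nx; rewrite /work_left (bigD1 (Ordinal lx)) //=; congr (_ + _).
by apply: eq_bigl => n; rewrite inE negb_or andbC.
Qed.

Lemma sum_out_degree : \sum_(n < N) count (fun e => e.1 == val n) E <= size E.
Proof.
elim: (E) => [|e l IH]; first by rewrite big1.
rewrite /= big_split /= -add1n; apply: leq_add IH.
rewrite -big_mkcond /= sum1_card.
have [le|lt] := leqP N e.1.
  by rewrite eq_card0 // => n; rewrite inE; apply/negbTE; have := ltn_ord n; lia.
rewrite -(card1 (Ordinal lt)); apply: subset_leq_card; apply/subsetP => n.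
by rewrite !inE => /eqP h; apply/eqP/val_inj.
Qed.

Lemma work_left_bound done : work_left done <= 6 * N + follow_cost * size E.
Proof.
apply: (@leq_trans (\sum_(n < N) node_cost n)).
  by rewrite /work_left [leqRHS](bigID (fun n : 'I_N => val n \notin done)) /= leq_addr.
rewrite big_split /= sum_nat_const card_ord mulnC leq_add2l -big_distrr /=.
by rewrite leq_mul2l sum_out_degree orbT.
Qed.

Lemma justified_bound reached :
  (forall n, G n -> n < N) -> justified reached -> forall n, n \in reached -> n < N.
Proof. by move=> hG hj n /hj [x /hG|x y _ /edge_bound[]|x y _ /edge_bound[]]. Qed.

(** Soundness is the invariant [justified]. Completeness is read off when the stack is empty:
    saturation then says that the expanded nodes are closed under the clauses of
    [and_or_closure]. *)
Lemma propagate_correct stk done s :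
  (forall n, G n -> n < N) ->
  (forall n, G n -> n \in stk ++ done) ->
  represents E stk done (remaining O done E) s ->
  justified (stk ++ done) ->
  saturated (remaining O done E) (stk ++ done) ->
  ends_within propagate s (6 * N + follow_cost * size E + 1)
    (fun s' => exists done',
      represents E [::] done' (remaining O done' E) s' /\
      forall n, n \in done' <-> and_or_closure edge O G n).
Proof.
move=> GN; pose k := work_left done.
(* The induction is on a bound for the potential, with the exact potential as running time; the
   estimate by the size of the graph is applied only once, outside. *)
suff H : forall k stk done s, work_left done <= k ->
  (forall n, G n -> n \in stk ++ done) ->
  represents E stk done (remaining O done E) s ->
  justified (stk ++ done) -> saturated (remaining O done E) (stk ++ done) ->
  ends_within propagate s (work_left done + 1)
    (fun s' => exists done',
      represents E [::] done' (remaining O done' E) s' /\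
      forall n, n \in done' <-> and_or_closure edge O G n).
  move=> hG h hj hs; apply: ends_weaken (H k _ _ _ (leqnn _) hG h hj hs) _ (fun _ => id).
  by rewrite leq_add2r work_left_bound.
elim=> {k stk done s} [|k IH] stk done s; case/lastP: stk => [|stk x] lk hG h hj hs.
(* Empty stack: the loop stops, and induction on the closure shows that no node is missing. *)
1,3: apply: (@ends_weaken _ _ 1 _ _ _ _ _ (fun _ => id)); last (by rewrite leq_addl);
  apply: ends_while_false; [by rewrite /= (rep_zero h) (rep_top h)|];
  exists done; split=> // n; split; [exact: hj|];
  elim=> {n} [n /hG //|n m On mn _ IHm|n m On mn _ IHm]; apply: (hs m) => //;
  rewrite /remaining ?On ?(negbTE On).
- by apply/eqP; rewrite eqb0 negbK; apply/hasP; exists (m, n) => //=; rewrite eqxx.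
- apply/eqP; rewrite eqn0Ngt -has_count; apply/hasPn => -[u v] huv /=.
  by apply/negP => /andP[/eqP ev]; subst v; rewrite IHm.
- by apply/eqP; rewrite eqb0 negbK; apply/hasP; exists (m, n) => //=; rewrite eqxx.
- apply/eqP; rewrite eqn0Ngt -has_count; apply/hasPn => -[u v] huv /=.
  by apply/negP => /andP[/eqP ev]; subst v; rewrite IHm.
(* With no work left the stack cannot contain [x], whose expansion has a positive price. *)
- have lx : x < N.
    by apply: justified_bound GN hj _ _; rewrite mem_cat mem_rcons inE eqxx.
  have nx : x \notin done.
    have := rep_uniq h; rewrite cat_rcons => /=; rewrite cat_uniq /=.
    by case/and3P=> _ _ /andP[].
  by move: lk; rewrite (work_left_cons lx nx) /node_cost; lia.
have lx : x < N.
  by apply: justified_bound GN hj _ _; rewrite mem_cat mem_rcons inE eqxx.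
have nx : x \notin done.
  have := rep_uniq h; rewrite cat_rcons => /=; rewrite cat_uniq /=.
  by case/and3P=> _ _ /andP[].
have ew := work_left_cons lx nx.
apply: (@ends_weaken _ _ (4 + (follow_cost * count (fun e => e.1 == x) E + 1)
   + (work_left (x :: done) + 1)).+1 _ _ _ _ _ (fun _ => id)); last by rewrite ew /node_cost; lia.
apply: ends_while_true; first by rewrite /= (rep_zero h) (rep_top h) size_rcons.
apply: ends_seq; apply: ends_run => //.
set s1 := run _ s.
have [h1 r6] : represents E stk (x :: done) (counter O done x E [::]) s1 /\
               reg s1 6 = last_out E x.
  case: h => r10 r0 a0 a1 a2 a3 a4 r1 a5 u.
  rewrite size_rcons in r1; have e : nth 0 (rcons stk x) (size stk) = x.
    by rewrite nth_rcons ltnn eqxx.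
  split; last by rewrite /s1 /= /upd /= r1 /= a5 ?size_rcons // e a0.
  split=> //=; rewrite /upd //= ?r1 //.
  - by move=> y; rewrite a3 counter_start.
  - by move=> y; rewrite a4 cat_rcons.
  - by move=> i li; rewrite a5 ?size_rcons ?nth_rcons ?li //; lia.
  - by move: u; rewrite cat_rcons.
rewrite cat_rcons in hj hs.
have hG' : forall n, G n -> n \in stk ++ x :: done by move=> n /hG; rewrite cat_rcons.
apply: ends_weaken (follow_edges_correct _ nx h1 r6 hj _) _ _; rewrite ?cats0 //.
  by move=> u v huv; rewrite counter_start; apply: hs huv.
move=> s2 [stk' [h2 ss hj' hs']]; apply: (IH _ _ _ _ _ h2 hj' hs').
  have : 0 < node_cost x by [].
  by move: lk; rewrite ew; move: (node_cost x) (work_left _) => a b; lia.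
move=> n /hG'; rewrite !mem_cat => /orP[/ss->//|->]; exact: orbT.
Qed.

End Propagation.

(** * Writing edges and initial counters *)

Definition add_edge (conj : bool) (x i y j : nat) : prog :=
  CSeq (set_sum 2 x i) (CSeq (set_sum 3 y j) (CSeq
    (seqs [:: CSucc 0; CStore 2 0 3; CLoad 4 0 2; CStore 1 0 4; CStore 0 2 0])
    (if conj then seqs [:: CLoad 4 3 3; CSucc 4; CStore 3 3 4] else CSkip))).

(** Nothing is expanded yet, so a new edge raises the counter of a conjunctive target by one, while
    that of a disjunctive target stays 1. The lower bound 10 keeps the address registers apart from
    the scratch registers. *)
Lemma run_add_edge E O stk s (conj : bool) x i y j :
  10 <= x -> 10 <= y -> O (reg s y + j) = ~~ conj ->
  represents E stk [::] (remaining O [::] E) s ->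
  let E' := rcons E (reg s x + i, reg s y + j) in
  represents E' stk [::] (remaining O [::] E') (run (add_edge conj x i y j) s).
Proof.
move=> lx ly; rewrite /add_edge 3!run_seq.
have [h1 h2 _ _] := run_set_sum 2 x i s; move: (run _ s) h1 h2 => s1 h1 h2.
have [h3 h4 _ _] := run_set_sum 3 y j s1; move: (run _ s1) h3 h4 => s2 h3 h4.
have e2 : reg s2 2 = reg s x + i by rewrite h3 /= h1.
have e3 : reg s2 3 = reg s y + j.
  by rewrite h3 /= h1; case: eqP => // ey; rewrite ey in ly.
move: (reg s x + i) (reg s y + j) e2 e3 => u v e2 e3 Ov h.
have {}h : represents E stk [::] (remaining O [::] E) s2.
  by apply: represents_frame h => [|a _]; rewrite ?h3 /= ?h1 ?h4 ?h2.
move: s2 h {h3 h4} e2 e3 => s2 [r10 r0 a0 a1 a2 a3 a4 r1 a5 un] e2 e3 /=.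
have H : represents (rcons E (u, v)) stk [::] (remaining O [::] E)
   (run (seqs [:: CSucc 0; CStore 2 0 3; CLoad 4 0 2; CStore 1 0 4; CStore 0 2 0]) s2).
  split=> //=; rewrite /upd /= ?r0 ?size_rcons ?e2 ?e3 //.
  - by move=> z; rewrite last_out_rcons /= a0 eq_sym.
  - move=> e le; rewrite eqSS nth_rcons -cats1 takel_cat; last by lia.
    have [->|ne] := eqVneq e (size E); first by rewrite ltnn /= a0 take_size.
    by rewrite ifT ?a1 //; lia.
  - move=> e le; rewrite eqSS nth_rcons.
    have [->|ne] := eqVneq e (size E); first by rewrite ltnn /=.
    by rewrite ifT ?a2 //; lia.
rewrite /= in H; set s3 := set_arr _ 0 _ _ in H *.
have e33 : reg s3 3 = v by rewrite /s3 /= /upd /= e3.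
have rem : forall z, remaining O [::] (rcons E (u, v)) z =
    if conj && (z == v) then (remaining O [::] E v).+1 else remaining O [::] E z.
  move=> z; rewrite /remaining -cats1 has_cat count_cat /= andbF !orbF andbT addn0.
  have [->|ne] := eqVneq z v; first by rewrite Ov; case: (conj); rewrite /= ?addn1.
  by rewrite andbF /= addn0.
move: s3 H e33 => s3 H e33; case: conj Ov rem => Ov rem /=;
  last by apply: represents_cnt H => z; rewrite rem.
case: H => q10 q0 b0 b1 b2 b3 b4 q1 b5 un'.
split=> //= z; rewrite /upd /= e33 rem /= b3; by case: eqP => // _; rewrite b3.
Qed.

(** Cells start at 0, which is the right counter for a conjunctive node without edges; disjunctive
    nodes have to be set to 1 on allocation. *)
Definition init_or (x : nat) (l : seq nat) : prog :=
  foldr (fun o p => CSeq (set_sum 2 x o) (CSeq (CConst 5 1) (CSeq (CStore 3 2 5) p)))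
    CSkip l.

Lemma run_init_or E O stk s x l :
  10 <= x -> (forall o e, o \in l -> e \in E -> e.2 != reg s x + o) ->
  represents E stk [::] (remaining O [::] E) s ->
  represents E stk [::]
    (remaining (fun n => O n || (n \in [seq reg s x + o | o <- l])) [::] E)
    (run (init_or x l) s).
Proof.
move=> lx; elim: l O s => [|o l IH] O s hl h.
  by apply: represents_cnt h => y; rewrite /remaining orbF.
have -> : run (init_or x (o :: l)) s = run (init_or x l)
    (run (seqs [:: CConst 5 1; CStore 3 2 5]) (run (set_sum 2 x o) s)) by [].
have [h1 h2 _ _] := run_set_sum 2 x o s.
move: (run _ s) h1 h2 => s1 h1 h2; set s2 := run _ s1.
have ex : reg s2 x = reg s x.
  by rewrite /s2 /= /upd h1; case: eqP lx => [->//|_ lx]; case: eqP lx => [->|].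
have H : represents E stk [::] (remaining (fun n => O n || (n == reg s x + o)) [::] E) s2.
  case: h => r10 r0 a0 a1 a2 a3 a4 r1 a5 un.
  split=> //=; rewrite /upd //= ?h1 ?h2 //.
  move=> y; rewrite eqxx /remaining; case: eqP => [->|_]; last by rewrite a3 orbF.
  rewrite orbT; apply/esym/eqP; rewrite eqb1; apply/hasPn => e he.
  by rewrite (negbTE (hl o e _ he)) // inE eqxx.
apply: represents_cnt (IH _ _ _ H) => [y|p e hp he]; rewrite ex.
  by rewrite /remaining inE orbA.
by apply: hl he; rewrite inE hp orbT.
Qed.

(** * Derivations *)

Lemma complK : involutive compl.
Proof. by case=> b p; rewrite /compl /= negbK. Qed.

Section Derivable.
Variable cond : seq conclusion -> conclusion -> Prop.
Hypothesis cond_mono : forall P P' c, {subset P <= P'} -> cond P c -> cond P' c.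

Lemma proof_cat P P' : proof cond P -> proof cond P' -> proof cond (P ++ P').
Proof.
move=> hP; elim=> [|P1 c _ IH hc]; first by rewrite cats0.
rewrite -rcons_cat; apply: proof_rcons IH _; apply: cond_mono hc.
by move=> x hx; rewrite mem_cat hx orbT.
Qed.

(** Proofs can be concatenated because conditions are monotone. Excluded middle decides, for each
    member of [U], whether there is a proof to append. *)
Lemma common_proof (U : seq conclusion) :
  exists P, proof cond P /\ forall c, c \in U -> derivable cond c -> c \in P.
Proof.
elim: U => [|c U [P [hP IH]]]; first by exists [::]; split=> //; exact: proof_nil.
case: (classic (derivable cond c)) => [[P' [hP' cP']]|nc]; last first.
  by exists P; split=> // c'; rewrite inE => /orP[/eqP->//|]; exact: IH.
exists (P ++ P'); split; first exact: proof_cat.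
move=> c'; rewrite inE mem_cat => /orP[/eqP-> _|/IH h /h->//].
by rewrite cP' orbT.
Qed.

(** Turns derivability into a set closed under the inference conditions: if a condition consults
    only the finite list [U], the proof to be extended may be assumed to contain all derivable
    members of [U]. *)
Lemma derivable_step (U : seq conclusion) c :
  (forall P, proof cond P ->
     (forall c', c' \in U -> derivable cond c' -> c' \in P) -> cond P c) ->
  derivable cond c.
Proof.
have [P [hP UP]] := common_proof U => h.
exists (rcons P c); split; last by rewrite mem_rcons inE eqxx.
exact: proof_rcons hP (h P hP UP).
Qed.

Lemma derivable_ind (K : conclusion -> Prop) :
  (forall P c, cond P c -> (forall c', c' \in P -> K c') -> K c) ->
  forall c, derivable cond c -> K c.
Proof.
move=> hK c [P [hP]]; elim: hP c => [|P1 c1 _ IH hc] c //.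
by rewrite mem_rcons inE => /orP[/eqP->|/IH//]; apply: hK hc _ => c' /IH.
Qed.

End Derivable.

Lemma all_proved_mono d P P' A :
  {subset P <= P'} -> all_proved d P A -> all_proved d P' A.
Proof. by move=> h hA a /hA /h. Qed.

Lemma plus_Delta_mono D P P' q :
  {subset P <= P'} -> plus_Delta_cond D P q -> plus_Delta_cond D P' q.
Proof.
move=> h [|[r [hr hA]]]; [by left|right].
by exists r; split=> //; apply: all_proved_mono hA.
Qed.

Lemma minus_Delta_mono D P P' q :
  {subset P <= P'} -> minus_Delta_cond D P q -> minus_Delta_cond D P' q.
Proof.
by move=> h [nF hr]; split=> // r /hr[a [ha /h aP]]; exists a.
Qed.

Lemma plus_lambda_mono D P P' q :
  {subset P <= P'} -> plus_lambda_cond D P q -> plus_lambda_cond D P' q.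
Proof.
move=> h [|[[r [hr hA]] hn]]; [by left|right]; split=> //.
by exists r; split=> //; apply: all_proved_mono hA.
Qed.

Lemma plus_partial_mono D P P' q :
  {subset P <= P'} -> plus_partial_cond D P q -> plus_partial_cond D P' q.
Proof.
move=> h [|[[r [hr hA]] hn hs]]; [by left|right]; split=> //.
  by exists r; split=> //; apply: all_proved_mono hA.
move=> s {hA} /hs[|[t [ht ts hA]]]; [by left|right].
by exists t; split=> //; apply: all_proved_mono hA.
Qed.

Lemma Delta_mono D P P' c :
  {subset P <= P'} -> Delta_cond D P c -> Delta_cond D P' c.
Proof.
by case: c => -[] q h //=; [apply: plus_Delta_mono | apply: minus_Delta_mono].
Qed.

Lemma lambda_mono D P P' c :
  {subset P <= P'} -> lambda_cond D P c -> lambda_cond D P' c.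
Proof. by case: c => -[] q h //=; apply: plus_lambda_mono. Qed.

Lemma proof_mono D P P' c :
  {subset P <= P'} -> proof_cond D P c -> proof_cond D P' c.
Proof.
case: c => -[] q h /=;
  [apply: plus_Delta_mono | apply: minus_Delta_mono
  |apply: plus_lambda_mono | apply: plus_partial_mono] => //.
Qed.

(** All the literals that an inference condition looks up in the current proof, as [derivable_step]
    requires. *)
Definition body_literals (D : theory) : seq literal :=
  flatten [seq body r | r <- rules D].

Lemma flatten_map_nthP (T : Type) (U : eqType) (f : T -> seq U) d l x :
  reflect (exists2 i, i < size l & x \in f (nth d l i)) (x \in flatten (map f l)).
Proof.
elim: l => [|a l IH] /=; first by constructor => -[].
rewrite mem_cat; apply: (iffP orP) => [[ha|/IH[i li hi]]|[[|i] li hi]].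
- by exists 0.
- by exists i.+1.
- by left.
- by right; apply/IH; exists i.
Qed.

Lemma mem_body_literals D r a :
  r < size (rules D) -> a \in antecedent D r -> a \in body_literals D.
Proof.
by move=> lr ha; apply/(flatten_map_nthP _ (Rule Strict [::] (true, 0))); exists r.
Qed.

(** Stated for any condition containing this clause, since [P_Delta] and [consequence] belong to
    different proof systems that share it. The next two lemmas are general for the same reason. *)
Lemma derivable_plus_Delta D cond q :
  (forall P P' c, {subset P <= P'} -> cond P c -> cond P' c) ->
  (forall P, plus_Delta_cond D P q -> cond P (PlusDelta, q)) ->
  q \in facts D \/
    (exists r, Rs D q r /\
       forall a, a \in antecedent D r -> derivable cond (PlusDelta, a)) ->
  derivable cond (PlusDelta, q).
Proof.
move=> mono hc h; apply: (@derivable_step _ mono [seq (PlusDelta, a) | a <- body_literals D]).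
move=> P _ hP; apply: hc; case: h => [|[r [hr hA]]]; [by left|right].
exists r; split=> // a ha; apply: hP (hA a ha).
by apply: map_f; apply: mem_body_literals ha; case: hr => -[].
Qed.

Lemma derivable_minus_Delta D cond q :
  (forall P P' c, {subset P <= P'} -> cond P c -> cond P' c) ->
  (forall P, minus_Delta_cond D P q -> cond P (MinusDelta, q)) ->
  q \notin facts D ->
  (forall r, Rs D q r ->
     exists a, a \in antecedent D r /\ derivable cond (MinusDelta, a)) ->
  derivable cond (MinusDelta, q).
Proof.
move=> mono hc nF h; apply: (@derivable_step _ mono [seq (MinusDelta, a) | a <- body_literals D]).
move=> P _ hP; apply: hc; split=> // r hr; have [a [ha da]] := h r hr.
exists a; split=> //; apply: hP da; apply: map_f.
by apply: mem_body_literals ha; case: hr => -[].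
Qed.

Lemma derivable_plus_lambda D cond q :
  (forall P P' c, {subset P <= P'} -> cond P c -> cond P' c) ->
  (forall P, plus_lambda_cond D P q -> cond P (PlusLambda, q)) ->
  P_Delta D (PlusDelta, q) \/
    (exists r, Rsd D q r /\
       forall a, a \in antecedent D r -> derivable cond (PlusLambda, a)) /\
    ~ P_Delta D (PlusDelta, compl q) ->
  derivable cond (PlusLambda, q).
Proof.
move=> mono hc h; apply: (@derivable_step _ mono [seq (PlusLambda, a) | a <- body_literals D]).
move=> P _ hP; apply: hc; case: h => [|[[r [hr hA]] nd]]; [by left|right; split=> //].
exists r; split=> // a ha; apply: hP (hA a ha).
by apply: map_f; apply: mem_body_literals ha; case: hr => -[].
Qed.

(** A proof in the full system mixes all tags, but the clause for +Δ looks up +Δ only; the predicate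
    [K] is vacuous at the other tags. *)
Lemma consequence_Delta D q :
  consequence D (PlusDelta, q) <-> P_Delta D (PlusDelta, q).
Proof.
split=> [h|h].
- pose K c := c.1 = PlusDelta -> P_Delta D c.
  apply: (@derivable_ind _ K _ _ h) => // P [d a] /= hc IH ed.
  rewrite /= in ed; subst d; apply: (derivable_plus_Delta (D := D) (@Delta_mono D)) => //.
  case: hc => [|[r [hr hA]]]; [by left|right]; exists r; split=> // b /hA hb.
  exact: IH hb _.
- pose K c := c.1 = PlusDelta -> consequence D c.
  apply: (@derivable_ind _ K _ _ h) => // P [d a] /= hc IH ed.
  rewrite /= in ed; subst d; apply: (derivable_plus_Delta (D := D) (@proof_mono D)) => //.
  case: hc => [|[r [hr hA]]]; [by left|right]; exists r; split=> // b /hA hb.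
  exact: IH hb _.
Qed.

Lemma consequence_minus_Delta D q :
  consequence D (MinusDelta, q) <-> P_Delta D (MinusDelta, q).
Proof.
split=> [h|h].
- pose K c := c.1 = MinusDelta -> P_Delta D c.
  apply: (@derivable_ind _ K _ _ h) => // P [d a] /= hc IH ed.
  rewrite /= in ed; subst d; case: hc => nF hA.
  apply: (derivable_minus_Delta (D := D) (@Delta_mono D)) nF _ => // r /hA[b [hb bP]].
  by exists b; split=> //; apply: IH bP _.
- pose K c := c.1 = MinusDelta -> consequence D c.
  apply: (@derivable_ind _ K _ _ h) => // P [d a] /= hc IH ed.
  rewrite /= in ed; subst d; case: hc => nF hA.
  apply: (derivable_minus_Delta (D := D) (@proof_mono D)) nF _ => // r /hA[b [hb bP]].
  by exists b; split=> //; apply: IH bP _.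
Qed.

Lemma consequence_lambda D q :
  consequence D (PlusLambda, q) <-> P_lambda D (PlusLambda, q).
Proof.
split=> [h|h].
- pose K c := c.1 = PlusLambda -> P_lambda D c.
  apply: (@derivable_ind _ K _ _ h) => // P [d a] /= hc IH ed.
  rewrite /= in ed; subst d; apply: (derivable_plus_lambda (D := D) (@lambda_mono D)) => //.
  case: hc => [|[[r [hr hA]] nd]]; [by left|right; split=> //].
  by exists r; split=> // b /hA hb; apply: IH hb _.
- pose K c := c.1 = PlusLambda -> consequence D c.
  apply: (@derivable_ind _ K _ _ h) => // P [d a] /= hc IH ed.
  rewrite /= in ed; subst d; apply: (derivable_plus_lambda (D := D) (@proof_mono D)) => //.
  case: hc => [|[[r [hr hA]] nd]]; [by left|right; split=> //].
  by exists r; split=> // b /hA hb; apply: IH hb _.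
Qed.

Lemma consequence_partial D q :
  P_Delta D (PlusDelta, q) \/
  [/\ exists r, Rsd D q r /\
        forall a, a \in antecedent D r -> consequence D (PlusPartial, a),
      ~ P_Delta D (PlusDelta, compl q)
    & forall s, R_ D (compl q) s ->
        (exists a, a \in antecedent D s /\ ~ P_lambda D (PlusLambda, a)) \/
        (exists t, [/\ Rsd D q t, sup D t s
           & forall a, a \in antecedent D t -> consequence D (PlusPartial, a)])] ->
  consequence D (PlusPartial, q).
Proof.
move=> h; apply: (@derivable_step _ (@proof_mono D) [seq (PlusPartial, a) | a <- body_literals D]).
move=> P _ hP /=.
have all_P r : r < size (rules D) ->
    (forall a, a \in antecedent D r -> consequence D (PlusPartial, a)) ->
    all_proved PlusPartial P (antecedent D r).
  move=> lr hA a ha; apply: hP (hA a ha); apply: map_f; exact: mem_body_literals ha.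
case: h => [|[[r [hr hA]] nd hs]]; [by left|right]; split=> //.
  by exists r; split=> //; apply: all_P => //; case: hr => -[].
move=> s {hA} /hs[|[t [ht ts hA]]]; [by left|right].
by exists t; split=> //; apply: all_P => //; case: ht => -[].
Qed.

(** * The graph of a theory *)

(* Nodes (tag, q) of a literal q: 0 q is a fact, 1 it is not, 2 +Δq, 3 -Δq,
   4 not +Δq, 5 +λq, 6 not +λq, 7 +∂q, 8 +∂q by clause (2), 9 clause (2.1).
   Nodes (tag, (true, r)) of a rule r: 10 all antecedents +Δ, 11 some antecedent
   -Δ, 12 all antecedents +λ and no +Δ for the complement of the consequent,
   13 all antecedents +∂, 14 clause (2.3) holds for r as an attacker. *)
Definition atom := (nat * literal)%type.

Definition start : atom := (15, (true, 0)).

Definition disjunctive (x : atom) : bool := x.1 \in [:: 2; 5; 7; 9; 11; 14].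

(** Edges are described relative to a current literal and a current rule, so that one schema yields
    both the edges of the graph and the program text that writes them. *)
Inductive place := Here | Opposite | OfRule | AtStart.

Definition schema := seq ((nat * place) * (nat * place)).

Definition locate (q : literal) (r : nat) (o : nat * place) : atom :=
  match o.2 with
  | Here => (o.1, q)
  | Opposite => (o.1, compl q)
  | OfRule => (o.1, (true, r))
  | AtStart => start
  end.

Definition instances (L : schema) (q : literal) (r : nat) : seq (atom * atom) :=
  [seq (locate q r e.1, locate q r e.2) | e <- L].

Definition literal_schema : schema :=
  [:: ((0, Here), (2, Here)); ((1, Here), (3, Here)); ((2, Here), (5, Here));
      ((2, Here), (7, Here)); ((9, Here), (8, Here)); ((4, Opposite), (8, Here));
      ((8, Here), (7, Here))].

(** The edges from [start] let nodes 10 and 13 of a rule with empty body be reached; node 12 already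
    has the guard on the complement as a predecessor. Every rule, defeaters included, attacks the
    complement of its consequent, hence the last edge. *)
Definition common_schema : schema :=
  [:: ((15, AtStart), (10, OfRule)); ((15, AtStart), (13, OfRule));
      ((4, Opposite), (12, OfRule)); ((14, OfRule), (8, Opposite))].

Definition strict_schema : schema :=
  [:: ((10, OfRule), (2, Here)); ((11, OfRule), (3, Here))].

Definition supportive_schema : schema :=
  [:: ((12, OfRule), (5, Here)); ((13, OfRule), (9, Here))].

Definition supportive (k : rule_kind) : bool := if k is Defeater then false else true.

Definition rule_schema (k : rule_kind) : schema :=
  common_schema ++ (if k is Strict then strict_schema else [::])
  ++ (if supportive k then supportive_schema else [::]).

Definition body_schema : schema :=
  [:: ((2, Here), (10, OfRule)); ((3, Here), (11, OfRule));
      ((5, Here), (12, OfRule)); ((7, Here), (13, OfRule));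
      ((6, Here), (14, OfRule))].

Lemma instances_cat L1 L2 q r :
  instances (L1 ++ L2) q r = instances L1 q r ++ instances L2 q r.
Proof. exact: map_cat. Qed.

(** [pl] is a parameter because propositions join the graph one by one, on their first occurrence.
    The rule index 0 given to [literal_schema] is a dummy. *)
Inductive edge (pl : seq nat) (D : theory) : atom -> atom -> Prop :=
| edge_literal q x y : q.2 \in pl -> (x, y) \in instances literal_schema q 0 ->
    edge pl D x y
| edge_rule r x y : r < size (rules D) ->
    (x, y) \in instances (rule_schema (kind (rule_at D r))) (conseq (rule_at D r)) r ->
    edge pl D x y
| edge_body r a x y : r < size (rules D) -> a \in antecedent D r ->
    (x, y) \in instances body_schema a r -> edge pl D x y
| edge_sup t s : sup D t s -> t < size (rules D) -> s < size (rules D) ->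
    supportive (kind (rule_at D t)) ->
    conseq (rule_at D t) = compl (conseq (rule_at D s)) ->
    edge pl D (13, (true, t)) (14, (true, s)).

(** The intended truth of a node, in terms of the proof theory and independent of the graph; the
    default case is [start]. *)
Definition meaning (D : theory) (x : atom) : Prop :=
  let: (t, q) := x in
  let A := antecedent D q.2 in
  let c := conseq (rule_at D q.2) in
  let countered s :=
    (exists a, a \in antecedent D s /\ ~ P_lambda D (PlusLambda, a)) \/
    (exists t, [/\ Rsd D (compl (conseq (rule_at D s))) t, sup D t s
       & forall a, a \in antecedent D t -> consequence D (PlusPartial, a)]) in
  let supported q := exists r, Rsd D q r /\
    forall a, a \in antecedent D r -> consequence D (PlusPartial, a) in
  match t with
  | 0 => q \in facts D
  | 1 => q \notin facts D
  | 2 => P_Delta D (PlusDelta, q)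
  | 3 => P_Delta D (MinusDelta, q)
  | 4 => ~ P_Delta D (PlusDelta, q)
  | 5 => P_lambda D (PlusLambda, q)
  | 6 => ~ P_lambda D (PlusLambda, q)
  | 7 => consequence D (PlusPartial, q)
  | 8 => [/\ supported q, ~ P_Delta D (PlusDelta, compl q)
           & forall s, R_ D (compl q) s -> countered s]
  | 9 => supported q
  | 10 => forall a, a \in A -> P_Delta D (PlusDelta, a)
  | 11 => exists a, a \in A /\ P_Delta D (MinusDelta, a)
  | 12 => ~ P_Delta D (PlusDelta, compl c) /\
          forall a, a \in A -> P_lambda D (PlusLambda, a)
  | 13 => forall a, a \in A -> consequence D (PlusPartial, a)
  | 14 => countered q.2
  | _ => True
  end.

Lemma Rsd_supportive D q r :
  r < size (rules D) -> conseq (rule_at D r) = q -> supportive (kind (rule_at D r)) ->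
  Rsd D q r.
Proof. by move=> lr cr sr; split=> //; case: kind sr; [left | right |]. Qed.

Section Graph.
Variables (D : theory) (pl : seq nat).
Hypothesis pl_props : {subset props D <= pl}.

Let reach := and_or_closure (edge pl D) disjunctive.

Lemma fact_prop q : q \in facts D -> q.2 \in pl.
Proof. by move=> h; apply: pl_props; rewrite mem_cat map_f. Qed.

Lemma rule_prop r a :
  r < size (rules D) -> a \in conseq (rule_at D r) :: antecedent D r -> a.2 \in pl.
Proof.
move=> lr ha; apply: pl_props; rewrite mem_cat; apply/orP; right.
apply/(flatten_map_nthP _ (Rule Strict [::] (true, 0))); exists r => //.
exact: (map_f snd ha).
Qed.

Lemma conseq_prop r : r < size (rules D) -> (conseq (rule_at D r)).2 \in pl.
Proof. by move=> lr; apply: (rule_prop lr); rewrite inE eqxx. Qed.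

Lemma body_prop r a : r < size (rules D) -> a \in antecedent D r -> a.2 \in pl.
Proof. by move=> lr ha; apply: (rule_prop lr); rewrite inE ha orbT. Qed.

Ltac in_instances := by rewrite /= ?mem_cat !inE ?eqxx ?orbT.

Lemma edge_common r e : r < size (rules D) ->
  e \in instances common_schema (conseq (rule_at D r)) r -> edge pl D e.1 e.2.
Proof.
case: e => x y lr h; apply: (edge_rule _ lr).
by rewrite instances_cat mem_cat h.
Qed.

Lemma edge_strict r e : r < size (rules D) -> kind (rule_at D r) = Strict ->
  e \in instances strict_schema (conseq (rule_at D r)) r -> edge pl D e.1 e.2.
Proof.
case: e => x y lr k h; apply: (edge_rule _ lr).
by rewrite /rule_schema k !instances_cat !mem_cat h orbT.
Qed.

Lemma edge_supportive r e : r < size (rules D) -> supportive (kind (rule_at D r)) ->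
  e \in instances supportive_schema (conseq (rule_at D r)) r -> edge pl D e.1 e.2.
Proof.
case: e => x y lr k h; apply: (edge_rule _ lr).
by rewrite /rule_schema k !instances_cat !mem_cat h !orbT.
Qed.

(** An edge into a disjunctive node carries [meaning] along; at a conjunctive node the incoming
    edges cover all conjuncts. [cM], [cPC], [cRD], [cRL] and [cAp] treat the conjunctive tags with
    incoming edges: 3, 8, 10, 12 and 13. *)
Lemma reach_sound (G : atom -> Prop) :
  (forall x, G x -> meaning D x) -> forall x, reach G x -> meaning D x.
Proof.
move=> hG x.
have cM q : q.2 \in pl -> (forall z, edge pl D z (3, q) -> meaning D z) ->
    meaning D (3, q).
  move=> hq h; apply: (derivable_minus_Delta (D := D) (@Delta_mono D)) => //.
    by apply: (h (1, q)); apply: (edge_literal _ hq); in_instances.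
  move=> r [[lr cr] kr]; apply: (h (11, (true, r))).
  by apply: (edge_strict (e := (_, _)) lr kr); rewrite cr; in_instances.
have cPC q : q.2 \in pl -> (forall z, edge pl D z (8, q) -> meaning D z) ->
    meaning D (8, q).
  move=> hq h; split.
  - by apply: (h (9, q)); apply: (edge_literal _ hq); in_instances.
  - by apply: (h (4, compl q)); apply: (edge_literal _ hq); in_instances.
  - move=> s [ls cs]; apply: (h (14, (true, s))).
    rewrite -(complK q) -cs.
    by apply: (edge_common (e := (_, _)) ls); in_instances.
have cRD r : r < size (rules D) -> (forall z, edge pl D z (10, (true, r)) -> meaning D z) ->
    meaning D (10, (true, r)).
  move=> lr h /= a ha; refine (h (2, a) _).
  by apply: (edge_body _ lr ha); in_instances.
have cRL r : r < size (rules D) -> (forall z, edge pl D z (12, (true, r)) -> meaning D z) ->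
    meaning D (12, (true, r)).
  move=> lr h; split.
    by refine (h (4, _) _); apply: (edge_common (e := (_, _)) lr); in_instances.
  by move=> a ha; refine (h (5, a) _); apply: (edge_body _ lr ha); in_instances.
have cAp r : r < size (rules D) -> (forall z, edge pl D z (13, (true, r)) -> meaning D z) ->
    meaning D (13, (true, r)).
  move=> lr h /= a ha; refine (h (7, a) _).
  by apply: (edge_body _ lr ha); in_instances.
elim=> {x} [x /hG //|x y dx exy _ IH|x y dx exy _ IH].
- case: exy dx IH => {x y} [q x y hq|r x y lr|r a x y lr ha|t s ts lt ls kt ct].
  + rewrite !inE => /or4P[||| /or4P[|||]] /eqP[-> ->] //= _.
    * by move=> h; apply: (derivable_plus_Delta (D := D) (@Delta_mono D)) => //; left.
    * by move=> h; apply: (derivable_plus_lambda (D := D) (@lambda_mono D)) => //; left.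
    * by move=> h; apply: consequence_partial; left.
    * case=> h1 h2 h3; apply: consequence_partial; right; split=> // s hs.
      by have := h3 s hs; case: hs => _ ->; rewrite complK.
  + have lam : ~ P_Delta D (PlusDelta, compl (conseq (rule_at D r))) /\
        (forall a, a \in antecedent D r -> P_lambda D (PlusLambda, a)) ->
        supportive (kind (rule_at D r)) -> P_lambda D (PlusLambda, conseq (rule_at D r)).
      move=> [nd hA] sr; apply: (derivable_plus_lambda (D := D) (@lambda_mono D)) => //.
      by right; split=> //; exists r; split=> //; apply: Rsd_supportive.
    have sup : (forall a, a \in antecedent D r -> consequence D (PlusPartial, a)) ->
        supportive (kind (rule_at D r)) -> meaning D (9, conseq (rule_at D r)).
      by move=> hA sr; exists r; split=> //; apply: Rsd_supportive.
    case k : (kind (rule_at D r)) lam sup => lam sup; rewrite !inE.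
    * move=> /or4P[||| /or4P[||| /orP[|]]] /eqP[-> ->] //= _ h; [|exact: lam|exact: sup].
      apply: (derivable_plus_Delta (D := D) (@Delta_mono D)) => //; right.
      by exists r.
    * by move=> /or4P[||| /or3P[||]] /eqP[-> ->] //= _ h; [exact: lam|exact: sup].
    * by move=> /or4P[|||] /eqP[-> ->].
  + rewrite !inE => /or4P[||| /orP[|]] /eqP[-> ->] //= _ h; first by exists a.
    by left; exists a.
  + move=> _ h; right; exists t; split=> //; exact: Rsd_supportive.
- case: exy dx IH => {x y} [q x y hq|r x y lr|r a x y lr ha|t s ts lt ls kt ct] //.
  + by rewrite !inE => /or4P[||| /or4P[|||]] /eqP[_ ->] //= _; [apply: cM|apply: cPC|apply: cPC].
  + have cC := conseq_prop lr.
    case k : (kind (rule_at D r)); rewrite !inE.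
    * by move=> /or4P[||| /or4P[||| /orP[|]]] /eqP[_ ->] //= _;
        [apply: cRD | apply: cAp | apply: cRL | apply: cPC | apply: cM].
    * by move=> /or4P[||| /or3P[||]] /eqP[_ ->] //= _;
        [apply: cRD | apply: cAp | apply: cRL | apply: cPC].
    * by move=> /or4P[|||] /eqP[_ ->] //= _;
        [apply: cRD | apply: cAp | apply: cRL | apply: cPC].
  + by rewrite !inE => /or4P[||| /orP[|]] /eqP[_ ->] //= _;
      [apply: cRD | apply: cRL | apply: cAp].
Qed.

(** A conjunctive node waits for all its predecessors, so completeness relies on there being none
    besides those listed. *)
Lemma edge_inv z t q : edge pl D z (t, q) ->
  match t with
  | 3 => z = (1, q) \/ exists r, Rs D q r /\ z = (11, (true, r))
  | 8 => [\/ z = (9, q), z = (4, compl q)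
          | exists s, R_ D (compl q) s /\ z = (14, (true, s))]
  | 10 => z = start \/ exists2 a, a \in antecedent D q.2 & z = (2, a)
  | 12 => z = (4, compl (conseq (rule_at D q.2))) \/
          exists2 a, a \in antecedent D q.2 & z = (5, a)
  | 13 => z = start \/ exists2 a, a \in antecedent D q.2 & z = (7, a)
  | _ => True
  end.
Proof.
move Ex: (t, q) => x h; case: h Ex => {x z} [q' x y hq|r x y lr|r a x y lr ha|t' s _ _ _ _ _].
- rewrite !inE => /or4P[||| /or4P[|||]] /eqP[-> ->] [et eq]; subst t q => //.
  + by left.
  + by constructor 1.
  + by constructor 2.
- case k : (kind (rule_at D r)); rewrite !inE.
  + move=> /or4P[||| /or4P[||| /orP[|]]] /eqP[-> ->] [et eq]; subst t q => //; try by left.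
    * by constructor 3; exists r; rewrite complK.
    * by right; exists r.
  + move=> /or4P[||| /or3P[||]] /eqP[-> ->] [et eq]; subst t q => //; try by left.
    by constructor 3; exists r; rewrite complK.
  + move=> /or4P[|||] /eqP[-> ->] [et eq]; subst t q => //; try by left.
    by constructor 3; exists r; rewrite complK.
- by rewrite !inE => /or4P[||| /orP[|]] /eqP[-> ->] [et eq]; subst t q => //; right; exists a.
- by case=> ->.
Qed.

(** * Completeness: what is derivable is reached *)

Section Completeness.
Variable G : atom -> Prop.
Hypothesis G_start : G start.
Hypothesis G_fact : forall q, q \in facts D -> G (0, q).
Hypothesis G_nonfact : forall q, q.2 \in pl -> q \notin facts D -> G (1, q).

Lemma reach_literal x y q : q.2 \in pl -> (x, y) \in instances literal_schema q 0 ->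
  disjunctive y -> reach G x -> reach G y.
Proof. by move=> hq hxy dy; apply: closure_or => //; apply: edge_literal hxy. Qed.

(** For +Δ, membership in [pl] comes out of the induction. For -Δ it is assumed, because a foreign
    literal is -Δ although no guard is fired for it. *)
Lemma reach_Delta c : P_Delta D c ->
  match c with
  | (PlusDelta, q) => q.2 \in pl /\ reach G (2, q)
  | (MinusDelta, q) => q.2 \in pl -> reach G (3, q)
  | _ => True
  end.
Proof.
move: c; refine (derivable_ind (K := fun c => _) _) => P [[] q] //= hc IH.
- case: hc => [hq|[r [[[lr cr] kr] hA]]].
    split; first exact: fact_prop.
    apply: (reach_literal (x := (0, q)) (fact_prop hq)) => //; first by in_instances.
    exact/closure_base/G_fact.
  split; first by rewrite -cr; apply: conseq_prop.
  have RD : reach G (10, (true, r)).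
    apply: (@closure_and _ _ _ _ _ start) => //.
      by apply: (edge_common (e := (_, _)) lr); in_instances.
    move=> z /edge_inv[->|[a /hA/IH[_ ?] ->//]]; exact: closure_base.
  apply: (closure_or _ _ RD) => //.
  by apply: (edge_strict (e := (_, _)) lr kr); rewrite cr; in_instances.
- case: hc => nF hr hq; apply: (@closure_and _ _ _ _ _ (1, q)) => //.
    by apply: (edge_literal _ hq); in_instances.
  move=> z /edge_inv[->|[r [Rr ->]]]; first exact/closure_base/G_nonfact.
  have [a [ha /IH aP]] := hr r Rr; have lr : r < size (rules D) by case: Rr => -[].
  apply: (closure_or _ _ (aP (body_prop lr ha))) => //.
  by apply: (edge_body _ lr ha); in_instances.
Qed.

Hypothesis G_Delta : forall q, q.2 \in pl -> ~ P_Delta D (PlusDelta, q) -> G (4, q).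

Lemma reach_lambda c : P_lambda D c ->
  match c with
  | (PlusLambda, q) => q.2 \in pl /\ reach G (5, q)
  | _ => True
  end.
Proof.
move: c; refine (derivable_ind (K := fun c => _) _) => P [[] q] //= hc IH.
case: hc => [/reach_Delta[hq Tq]|[[r [[[lr cr] kr] hA]] nd]].
  by split=> //; apply: (reach_literal hq _ _ Tq) => //; in_instances.
have hq : q.2 \in pl by rewrite -cr; apply: conseq_prop.
split=> //; have RL : reach G (12, (true, r)).
  apply: (@closure_and _ _ _ _ _ (4, compl (conseq (rule_at D r)))) => //.
    by apply: (edge_common (e := (_, _)) lr); in_instances.
  move=> z /edge_inv[->|[a /hA/IH[_ ?] ->//]].
  by apply: closure_base; apply: G_Delta => //=; rewrite cr.
apply: (closure_or _ _ RL) => //.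
apply: (edge_supportive (e := (_, _)) lr); last by rewrite cr; in_instances.
by case: kr => ->.
Qed.

Hypothesis G_lambda : forall q, q.2 \in pl -> ~ P_lambda D (PlusLambda, q) -> G (6, q).

Lemma reach_partial c : consequence D c ->
  match c with
  | (PlusPartial, q) => q.2 \in pl /\ reach G (7, q)
  | _ => True
  end.
Proof.
move: c; refine (derivable_ind (K := fun c => _) _) => P [[] q] //= hc IH.
case: hc => [/reach_Delta[hq Tq]|[[r [Rr hA]] nd hs]].
  by split=> //; apply: (reach_literal hq _ _ Tq) => //; in_instances.
have Ap t q' : Rsd D q' t -> all_proved PlusPartial P (antecedent D t) ->
    reach G (13, (true, t)).
  move=> [[lt ct] _] hAt; apply: (@closure_and _ _ _ _ _ start) => //.
    by apply: (edge_common (e := (_, _)) lt); in_instances.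
  move=> z /edge_inv[->|[a /hAt/IH[_ ?] ->//]]; exact: closure_base.
have sup_of t q' : Rsd D q' t -> supportive (kind (rule_at D t)) by case=> _ [] ->.
have [[lr cr] _] := Rr.
have hq : q.2 \in pl by rewrite -cr; apply: conseq_prop.
split=> //; have S : reach G (9, q).
  apply: (closure_or _ _ (Ap r q Rr hA)) => //.
  apply: (edge_supportive (e := (_, _)) lr); last by rewrite cr; in_instances.
  exact: sup_of Rr.
suff PC : reach G (8, q).
  by apply: (reach_literal hq _ _ PC) => //; in_instances.
apply: (@closure_and _ _ _ _ _ (9, q)) => //.
  by apply: (edge_literal _ hq); in_instances.
move=> z /edge_inv[->//|->|[s [Rs ->]]].
  by apply: closure_base; apply: G_Delta.
have [ls cs] := Rs; case: (hs s Rs) => [[a [ha na]]|[t [Rt ts hAt]]].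
  apply: (@closure_or _ _ _ _ _ (6, a)) => //.
    by apply: (edge_body _ ls ha); in_instances.
  by apply: closure_base; apply: G_lambda na; apply: body_prop ha.
apply: (closure_or _ _ (Ap t q Rt hAt)) => //.
have [[lt ct] _] := Rt; apply: edge_sup => //; first exact: sup_of Rt.
by rewrite cs complK.
Qed.

End Completeness.

(** * The three rounds of guards *)

Definition base (x : atom) : Prop := x = start \/ exists2 q, q \in facts D & x = (0, q).

(** One round of guards: [T] is what propagation has reached so far and [G] what has been fired from
    outside. *)
Definition extend (src dst : nat) (T G : atom -> Prop) (x : atom) : Prop :=
  G x \/ exists2 q, q.2 \in pl & ~ T (src, q) /\ x = (dst, q).

Definition base1 := extend 0 1 base base.
Definition base2 := extend 2 4 (reach base1) base1.
Definition base3 := extend 5 6 (reach base2) base2.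

Lemma base_fact q : base (0, q) <-> q \in facts D.
Proof. by split=> [[//|[q' h [->]]]|h] //; right; exists q. Qed.

Lemma base1_meaning x : base1 x -> meaning D x.
Proof.
case=> [[->//|[q h ->]]|[q hq [nb ->]]] //=.
by apply/negP => /base_fact.
Qed.

Lemma base1_start : base1 start.
Proof. by left; left. Qed.

Lemma base1_fact q : q \in facts D -> base1 (0, q).
Proof. by move/base_fact; left. Qed.

Lemma base1_nonfact q : q.2 \in pl -> q \notin facts D -> base1 (1, q).
Proof. by move=> hq nF; right; exists q => //; split=> // /base_fact; apply/negP. Qed.

(** After the first round the +Δ nodes are final, which justifies the negation taken in [base2]. *)
Lemma reach_base1 q : reach base1 (2, q) <-> P_Delta D (PlusDelta, q).
Proof.
split; first exact: (reach_sound base1_meaning).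
by move/(reach_Delta base1_start base1_fact base1_nonfact)=> [].
Qed.

(** An unreached node is a true negative exactly because the preceding round is complete. *)
Lemma base2_meaning x : base2 x -> meaning D x.
Proof.
case=> [/base1_meaning//|[q hq [nb ->]]] /= h; by apply/nb/reach_base1.
Qed.

Lemma base2_Delta q : q.2 \in pl -> ~ P_Delta D (PlusDelta, q) -> base2 (4, q).
Proof. by move=> hq nd; right; exists q => //; split=> // /reach_base1. Qed.

Lemma reach_base2 q : reach base2 (5, q) <-> P_lambda D (PlusLambda, q).
Proof.
split; first exact: (reach_sound base2_meaning).
have h x : base1 x -> base2 x by left.
move=> hl; apply: (reach_lambda _ _ _ base2_Delta hl).2.
- exact/h/base1_start.
- by move=> a /base1_fact; apply: h.
- by move=> a ha na; apply/h/base1_nonfact.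
Qed.

Lemma base3_meaning x : base3 x -> meaning D x.
Proof.
case=> [/base2_meaning//|[q hq [nb ->]]] /= h; by apply/nb/reach_base2.
Qed.

Definition tag_node (d : signed_tag) : nat :=
  match d with PlusDelta => 2 | MinusDelta => 3 | PlusLambda => 5 | PlusPartial => 7 end.

Lemma reach_base3 c :
  reach base3 (tag_node c.1, c.2) /\ c.2.2 \in pl <->
  consequence D c /\ c.2.2 \in pl.
Proof.
have h1 : forall x, base1 x -> base3 x by move=> x hx; left; left.
have hs : base3 start by apply/h1/base1_start.
have hf q : q \in facts D -> base3 (0, q) by move/base1_fact/h1.
have hn q : q.2 \in pl -> q \notin facts D -> base3 (1, q).
  by move=> hq nq; apply/h1/base1_nonfact.
have hD q : q.2 \in pl -> ~ P_Delta D (PlusDelta, q) -> base3 (4, q).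
  by move=> hq nd; left; apply: base2_Delta.
have hL q : q.2 \in pl -> ~ P_lambda D (PlusLambda, q) -> base3 (6, q).
  by move=> hq nl; right; exists q => //; split=> // /reach_base2.
case: c => d q /=; split=> -[h hq]; split=> //.
- have := reach_sound base3_meaning h; case: d {h} => /= h.
  + exact/consequence_Delta.
  + exact/consequence_minus_Delta.
  + exact/consequence_lambda.
  + exact: h.
- case: d h => h /=.
  + by move/consequence_Delta/(reach_Delta hs hf hn): h => [].
  + by move/consequence_minus_Delta/(reach_Delta hs hf hn): h; apply.
  + by move/consequence_lambda/(reach_lambda hs hf hn hD): h => [].
  + by move/(reach_partial hs hf hn hD hL): h => [].
Qed.

(** Allows a query about a foreign proposition to be answered negatively without a node. It fails
    for -Δ, which holds of foreign literals. *)
Lemma plus_consequence_prop d q : consequence D (plus_tag d, q) -> q.2 \in pl.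
Proof.
have c : forall c, consequence D c -> c.1 != MinusDelta -> c.2.2 \in pl.
  refine (derivable_ind (K := fun c => _) _) => P [e a] hc _ /= ne.
  have PD b : P_Delta D (PlusDelta, b) -> b.2 \in pl.
    by move/(reach_Delta base1_start base1_fact base1_nonfact)=> [].
  case: e hc ne => //=.
  - by case=> [/fact_prop//|[r [[[lr <-] _] _]] _]; apply: conseq_prop.
  - by move=> _ /eqP.
  - by case=> [/PD//|[[r [[[lr <-] _] _]] _] _]; apply: conseq_prop.
  - by case=> [/PD//|[[r [[[lr <-] _] _]] _ _] _]; apply: conseq_prop.
by move/c; apply; case: d; apply/eqP.
Qed.

End Graph.

(** * Building the graph *)

(* Registers: 10 is constantly 0, 11 counts the nodes, 12 the propositions and 13
   the rules; 14 is the current proposition, 15 its first node, 16 and 17 the first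
   nodes of the current literal and of its complement, 20 the first node of the
   current rule.  Arrays: 10 maps a proposition to its first node, or to 0 if it
   has not occurred, 11 lists the propositions; 12-15 map a rule to its first
   node, its kind, and the first nodes of its consequent and of the complement. *)
Definition node (s : state) (x : atom) : nat :=
  if x.1 < 10 then arr s 10 x.2.2 + (if x.2.1 then 0 else 10) + x.1
  else if x.1 < 15 then arr s 12 x.2.2 + (x.1 - 10) else 0.

(** The atoms that own a number; [node] is meaningful and injective on these only. *)
Definition valid (pl : seq nat) (nr : nat) (x : atom) : bool :=
  [|| (x.1 < 10) && (x.2.2 \in pl), (10 <= x.1 < 15) && x.2.1 && (x.2.2 < nr)
    | x == start].

(** The invariant of the reading phase: [hs] holds the kinds and consequents of the rules met, [B]
    the fired atoms, [R] the edges present, and [W] bounds nodes, edges and propositions together.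
    [bu_or_bound] keeps unassigned numbers conjunctive, in accordance with their counter 0. *)
Record built_with (pl : seq nat) (hs : seq (rule_kind * literal))
    (B : atom -> Prop) (R : atom -> atom -> Prop) (W : nat)
    (E : graph) (O : nat -> bool) (stk : seq nat) (s : state) : Prop := BuiltWith {
  bu_rep : represents E stk [::] (remaining O [::] E) s;
  bu_alloc : forall p, (0 < arr s 10 p) = (p \in pl);
  bu_bound : forall x, valid pl (size hs) x -> node s x < reg s 11;
  bu_inj : forall x y, valid pl (size hs) x -> valid pl (size hs) y ->
    node s x = node s y -> x = y;
  bu_np : reg s 12 = size pl;
  bu_list : forall k, k < size pl -> arr s 11 k = nth 0 pl k;
  bu_nr : reg s 13 = size hs;
  bu_rules : forall r, r < size hs -> let h := nth (Strict, (true, 0)) hs r in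
    [/\ arr s 13 r = kind_code h.1, arr s 14 r = node s (0, h.2),
        arr s 15 r = node s (0, compl h.2) & h.2.2 \in pl];
  bu_valid : forall x y, R x y -> valid pl (size hs) x /\ valid pl (size hs) y;
  bu_edges : forall e, e \in E <-> exists x y, R x y /\ e = (node s x, node s y);
  bu_or_bound : forall n, O n -> n < reg s 11;
  bu_or : forall x, valid pl (size hs) x -> O (node s x) = disjunctive x;
  bu_base : forall x, B x -> valid pl (size hs) x;
  bu_stk : forall n, n \in stk <-> exists2 x, B x & n = node s x;
  bu_size : reg s 11 + size E + size pl <= W
}.

Definition built pl hs B R W s := exists E O stk, @built_with pl hs B R W E O stk s.

Lemma built_weaken pl hs (B B' : atom -> Prop) (R R' : atom -> atom -> Prop) W W' s :
  (forall x, B x <-> B' x) -> (forall x y, R x y <-> R' x y) -> W <= W' ->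
  built pl hs B R W s -> built pl hs B' R' W' s.
Proof.
move=> hB hR hW [E [O [stk [h1 h2 h3 h4 h5 h6 h7 h8 h9 h10 h11 h12 h13 h14 h15]]]].
exists E, O, stk; split=> //.
- by move=> x y /hR; auto.
- move=> e; split=> [/h10[x [y [/hR ? ->]]]|[x [y [/hR ? ->]]]].
    by exists x, y.
  by apply/h10; exists x, y.
- by move=> x /hB; auto.
- move=> n; split=> [/h14[x /hB ? ->]|[x /hB ? ->]]; first by exists x.
  by apply/h14; exists x.
- exact: leq_trans hW.
Qed.

Lemma node_eq s s' : arr s' 10 = arr s 10 -> arr s' 12 = arr s 12 -> node s' =1 node s.
Proof. by move=> h1 h2 x; rewrite /node h1 h2. Qed.

Definition watched_regs := [:: 0; 1; 10; 11; 12; 13].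
Definition watched_arrs := [:: 0; 1; 2; 3; 4; 5; 10; 11; 12; 13; 14; 15].

Lemma built_same pl hs B R W s s' :
  (forall x, x \in watched_regs -> reg s' x = reg s x) ->
  (forall a, a \in watched_arrs -> arr s' a = arr s a) ->
  built pl hs B R W s -> built pl hs B R W s'.
Proof.
move=> hr ha [E [O [stk [h1 h2 h3 h4 h5 h6 h7 h8 h9 h10 h11 h12 h13 h14 h15]]]]; exists E, O, stk.
have hn : node s' =1 node s by apply: node_eq; apply: ha.
have [r11 r12 r13] : [/\ reg s' 11 = reg s 11, reg s' 12 = reg s 12 & reg s' 13 = reg s 13].
  by split; apply: hr.
split; rewrite ?r11 ?r12 ?r13 //.
- apply: represents_frame h1 => [|a la]; first by split; apply: hr.
  by apply: ha; do 6 case: a la => [//|a] la.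
- by move=> p; rewrite ha.
- by move=> x; rewrite hn; auto.
- by move=> x y; rewrite !hn; auto.
- by move=> k; rewrite ha; auto.
- by move=> r lr /=; rewrite !ha // !hn; apply: h8.
- by move=> e; rewrite h10; split=> -[x [y [? ->]]]; exists x, y; rewrite !hn.
- by move=> x; rewrite hn; auto.
- by move=> n; rewrite h14; split=> -[x ? ->]; exists x; rewrite ?hn.
Qed.

Lemma built_run p pl hs B R W s :
  ~~ has (mem watched_regs) (written_regs p) ->
  ~~ has (mem watched_arrs) (written_arrs p) ->
  built pl hs B R W s -> built pl hs B R W (run p s).
Proof.
move=> hr ha; have f := run_frame p s; apply: built_same => x hx.
  by apply: (frame_reg f); apply: contra hr => hp; apply/hasP; exists x.
by apply: (frame_arr f); apply: contra ha => hp; apply/hasP; exists x.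
Qed.

Lemma built_zero pl hs B R W s : built pl hs B R W s -> reg s 10 = 0.
Proof. by move=> [E [O [stk /bu_rep/rep_zero]]]. Qed.

Lemma built_fire pl hs (B : atom -> Prop) R W s x i y :
  built pl hs B R W s -> valid pl (size hs) y -> node s y = reg s x + i ->
  built pl hs (fun z => B z \/ z = y) R W (run (fire x i) s).
Proof.
move=> [E [O [stk h]]] vy ny.
have f := run_frame (fire x i) s.
have wr z : 10 <= z -> z \notin written_regs (fire x i).
  move=> hz; rewrite !mem_cat !inE !negb_or; do !(apply/andP; split) => //; try by lia.
  by apply/negP => /written_regs_addk; lia.
have wa a : 10 <= a -> a \notin written_arrs (fire x i).
  move=> hz; rewrite !mem_cat !inE !negb_or; do !(apply/andP; split) => //; try by lia.
  by elim: (i).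
have hn : node (run (fire x i) s) =1 node s by apply: node_eq; apply: (frame_arr f); apply: wa.
have r := run_fire x i (bu_rep h).
exists E, O, (push (reg s x + i) stk [::]).
case: h => h1 h2 h3 h4 h5 h6 h7 h8 h9 h10 h11 h12 h13 h14 h15.
split=> //; rewrite ?(frame_reg f) ?wr //.
- by move=> p; rewrite (frame_arr f) ?wa.
- by move=> z; rewrite hn; auto.
- by move=> z z'; rewrite !hn; auto.
- by move=> k; rewrite (frame_arr f) ?wa; auto.
- by move=> k lk /=; rewrite !(frame_arr f) ?wa // !hn; apply: h8.
- by move=> e; rewrite h10; split=> -[u [v [? ->]]]; exists u, v; rewrite !hn.
- by move=> z; rewrite hn; auto.
- by move=> z [/h13//|->].
- move=> n; have := mem_push (reg s x + i) stk [::] n; rewrite !cats0 inE => ->.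
  split=> [/orP[/eqP->|/h14[z ? ->]]|[z [Bz|->] ->]].
  + by exists y; [right | rewrite hn].
  + by exists z; [left | rewrite hn].
  + by apply/orP; right; apply/h14; exists z; rewrite ?hn.
  + by rewrite hn ny eqxx.
Qed.

Lemma built_add_edge pl hs (B : atom -> Prop) (R : atom -> atom -> Prop) W s x i y j u v :
  built pl hs B R W s -> valid pl (size hs) u -> valid pl (size hs) v ->
  10 <= x -> 10 <= y -> node s u = reg s x + i -> node s v = reg s y + j ->
  let p := add_edge (~~ disjunctive v) x i y j in
  built pl hs B (fun z z' => R z z' \/ (z, z') = (u, v)) W.+1 (run p s) /\
  [/\ forall z, 10 <= z -> reg (run p s) z = reg s z,
      forall a, 10 <= a -> arr (run p s) a = arr s a
    & input (run p s) = input s].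
Proof.
move=> [E [O [stk h]]] vu vv lx ly nu nv p.
have f := run_frame p s.
have wr z : 10 <= z -> z \notin written_regs p.
  move=> hz; have k c n : c < 10 -> (z \in written_regs (addk c n)) = false.
    by move=> lc; apply/negP => /written_regs_addk; lia.
  by rewrite /p /=; case: (disjunctive v); rewrite /= !(inE, mem_cat) !k //=; lia.
have wa a : 10 <= a -> a \notin written_arrs p.
  have wk z k : written_arrs (addk z k) = [::] by elim: k.
  by move=> hz; rewrite /p /=; case: (disjunctive v) => /=; rewrite !wk /= !inE; lia.
have si : readless p.
  have sk z k : readless (addk z k) by elim: k.
  by rewrite /p /=; case: (disjunctive v); rewrite /= !sk.
have hr z : 10 <= z -> reg (run p s) z = reg s z by move=> lz; rewrite (frame_reg f) ?wr.
have ha a : 10 <= a -> arr (run p s) a = arr s a by move=> lz; rewrite (frame_arr f) ?wa.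
split; last by split=> //; exact: frame_input f si.
have hn : node (run p s) =1 node s by apply: node_eq; apply: ha.
have Ov : O (reg s y + j) = ~~ ~~ disjunctive v by rewrite negbK -nv (bu_or h).
have r := run_add_edge i lx ly Ov (bu_rep h).
exists (rcons E (reg s x + i, reg s y + j)), O, stk.
case: h => h1 h2 h3 h4 h5 h6 h7 h8 h9 h10 h11 h12 h13 h14 h15.
split=> //; rewrite ?hr //.
- by move=> q; rewrite ha.
- by move=> z; rewrite hn; auto.
- by move=> z z'; rewrite !hn; auto.
- by move=> k; rewrite ha; auto.
- by move=> k lk /=; rewrite !ha // !hn; apply: h8.
- by move=> z z' [/h9//|[-> ->]].
- move=> e; rewrite mem_rcons inE; split=> [/orP[/eqP->|/h10[z [z' [? ->]]]]|[z [z' [[Rz|[-> ->]] ->]]]].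
  + by exists u, v; rewrite !hn nu nv; split=> //; right.
  + by exists z, z'; rewrite !hn; split=> //; left.
  + by apply/orP; right; apply/h10; exists z, z'; rewrite !hn.
  + by rewrite !hn nu nv eqxx.
- by move=> z; rewrite hn; auto.
- by move=> n; rewrite h14; split=> -[z ? ->]; exists z; rewrite ?hn.
- by rewrite size_rcons; lia.
Qed.

Definition place_reg (w : place) : nat :=
  match w with Here => 16 | Opposite => 17 | OfRule => 20 | AtStart => 10 end.

Definition offset (o : nat * place) : nat :=
  match o.2 with Here | Opposite => o.1 | OfRule => o.1 - 10 | AtStart => 0 end.

Definition well_placed (o : nat * place) : bool :=
  match o.2 with
  | Here | Opposite => o.1 < 10
  | OfRule => 10 <= o.1 < 15
  | AtStart => o.1 == 15
  end.

Definition disjunctive_tag (t : nat) : bool := disjunctive (t, (true, 0)).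

Definition add_schema (L : schema) : prog :=
  foldr (fun e p => CSeq (add_edge (~~ disjunctive_tag e.2.1)
      (place_reg e.1.2) (offset e.1) (place_reg e.2.2) (offset e.2)) p) CSkip L.

Definition located (pl : seq nat) (nr : nat) (s : state) (q : literal) (r : nat)
    (o : nat * place) : Prop :=
  valid pl nr (locate q r o) /\
  node s (locate q r o) = reg s (place_reg o.2) + offset o.

Lemma locate_disjunctive q r o :
  well_placed o -> disjunctive (locate q r o) = disjunctive_tag o.1.
Proof. by case: o => t [] // /eqP /= ->. Qed.

Lemma built_add_schema pl hs B (R : atom -> atom -> Prop) W s q r L :
  built pl hs B R W s -> all (fun e => well_placed e.1 && well_placed e.2) L ->
  (forall e, List.In e L ->
     located pl (size hs) s q r e.1 /\ located pl (size hs) s q r e.2) ->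
  let s' := run (add_schema L) s in
  built pl hs B (fun x y => R x y \/ (x, y) \in instances L q r) (W + size L) s' /\
  [/\ forall z, 10 <= z -> reg s' z = reg s z,
      forall a, 10 <= a -> arr s' a = arr s a
    & input s' = input s].
Proof.
elim: L R W s => [|e L IH] R W s hb /=.
  move=> _ _; split=> //; apply: built_weaken hb; rewrite ?addn0 // => x y.
  by split=> [|[]//]; left.
move=> /andP[/andP[w1 w2] wL] hL.
have [[v1 n1] [v2 n2]] := hL e (or_introl erefl).
have lp w : 10 <= place_reg w by case: w.
have [hb1 [hr ha hi]] := built_add_edge hb v1 v2 (lp _) (lp _) n1 n2.
rewrite -(locate_disjunctive q r w2).
set s1 := run _ s in hb1 hr ha hi *.
have [|hb2 [hr2 ha2 hi2]] := IH _ _ _ hb1 wL.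
  move=> e' /(fun h => hL e' (or_intror h)) [[v3 n3] [v4 n4]].
  have hn : node s1 =1 node s by apply: node_eq; apply: ha.
  by rewrite /located !hn !hr.
split; last by split; [move=> z lz; rewrite hr2 ?hr | move=> z lz; rewrite ha2 ?ha | rewrite hi2].
apply: built_weaken hb2; rewrite ?addSnnS // => x y.
rewrite inE; split=> [[[|->]|h]|[|/orP[/eqP->|h]]].
- by left.
- by right; rewrite eqxx.
- by right; rewrite h orbT.
- by left; left.
- by left; right.
- by right.
Qed.

Lemma init_or_frame x l s :
  [/\ forall z, 10 <= z -> reg (run (init_or x l) s) z = reg s z,
      forall a, 10 <= a -> arr (run (init_or x l) s) a = arr s a
    & input (run (init_or x l) s) = input s].
Proof.
have f := run_frame (init_or x l) s.
have si : readless (init_or x l).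
  by elim: l {f} => //= o l ->; rewrite andbT; elim: o.
split; [| |exact: frame_input f si].
- move=> z lz; apply: (frame_reg f); elim: l {f si} => //= o l IH.
  rewrite !(inE, mem_cat) (negbTE IH) !orbF.
  have -> : (z \in written_regs (addk 2 o)) = false.
    by apply/negP => /written_regs_addk; lia.
  by lia.
- move=> z lz; apply: (frame_arr f); elim: l {f si} => //= o l IH.
  rewrite !(inE, mem_cat) (negbTE IH) !orbF.
  have -> : written_arrs (addk 2 o) = [::] by elim: o.
  by rewrite in_nil; lia.
Qed.

(* [s'] is [s] after [w] fresh nodes have been assigned to new atoms, those with
   offset in [l] being disjunctive. *)
Lemma built_extend pl hs B (R : atom -> atom -> Prop) W s pl' hs' s' x w l :
  built pl hs B R W s ->
  [/\ reg s' 0 = reg s 0, reg s' 1 = reg s 1 & reg s' 10 = reg s 10] ->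
  (forall a, a < 6 -> arr s' a = arr s a) ->
  10 <= x -> reg s' x = reg s 11 -> reg s' 11 = reg s 11 + w ->
  (forall u, valid pl (size hs) u ->
     valid pl' (size hs') u /\ node s' u = node s u) ->
  (forall u, valid pl' (size hs') u -> valid pl (size hs) u \/
     exists2 k, k < w & node s' u = reg s 11 + k /\ disjunctive u = (k \in l)) ->
  (forall u v, valid pl' (size hs') u -> valid pl' (size hs') v ->
     reg s 11 <= node s' u -> node s' u = node s' v -> u = v) ->
  (forall p, (0 < arr s' 10 p) = (p \in pl')) ->
  reg s' 12 = size pl' -> (forall k, k < size pl' -> arr s' 11 k = nth 0 pl' k) ->
  reg s' 13 = size hs' ->
  (forall r, r < size hs' -> let h := nth (Strict, (true, 0)) hs' r in
    [/\ arr s' 13 r = kind_code h.1, arr s' 14 r = node s' (0, h.2),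
        arr s' 15 r = node s' (0, compl h.2) & h.2.2 \in pl']) ->
  all (fun o => o < w) l ->
  built pl' hs' B R (W + w + (size pl' - size pl)) (run (init_or x l) s').
Proof.
move=> [E [O [stk h]]] hr ha lx rx r11 old new inj' c2 c5 c6 c7 c8 lw.
have [fr fa _] := init_or_frame x l s'.
have hn : node (run (init_or x l) s') =1 node s' by apply: node_eq; apply: fa.
case: h => h1 h2 h3 h4 h5 h6 h7 h8 h9 h10 h11 h12 h13 h14 h15.
exists E, (fun n => O n || (n \in [seq reg s' x + o | o <- l])), stk.
have ge n : n \in [seq reg s' x + o | o <- l] -> reg s 11 <= n < reg s 11 + w.
  by case/mapP=> o /(allP lw) lo ->; rewrite rx; lia.
split; rewrite ?fr //.
- apply: run_init_or => //; last exact: represents_frame hr ha h1.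
  move=> o e ol /h10[u [v [/h9[_ /h3 lt] ->]]] /=; rewrite rx.
  by apply/eqP; lia.
- by move=> p; rewrite fa.
- move=> u; rewrite hn r11 => /new[v|[k lk [-> _]]]; last by lia.
  by rewrite (old _ v).2; have := h3 _ v; lia.
- move=> u v vu vv; rewrite !hn => e; case: (leqP (reg s 11) (node s' u)) => [le|lt].
    exact: inj'.
  have ou : valid pl (size hs) u by case: (new u vu) => // -[k lk [ek _]]; lia.
  have ov : valid pl (size hs) v by case: (new v vv) => // -[k lk [ek _]]; lia.
  by apply: h4 => //; rewrite -(old u ou).2 -(old v ov).2.
- by move=> k lk; rewrite fa // c6.
- by move=> r lr /=; rewrite !fa // !hn; apply: c8.
- by move=> u v /h9[/old[? _] /old[]].
- move=> e; rewrite h10; split=> -[u [v [Ruv ->]]]; exists u, v; split=> //;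
    by have [/old[_ e1] /old[_ e2]] := h9 _ _ Ruv; rewrite !hn e1 e2.
- by move=> n /orP[/h11|/ge]; lia.
- move=> u vu; rewrite hn; case: (new u vu) => [ov|[k lk [-> ->]]].
    rewrite (old _ ov).2 h12 //; case: (boolP (_ \in _)); last by rewrite orbF.
    by move/ge; have := h3 _ ov; lia.
  rewrite rx mem_map; last exact: addnI.
  by case Ok : (O _) => //=; have := h11 _ Ok; lia.
- by move=> u /h13/old[].
- move=> n; rewrite h14; split=> -[u Bu ->]; exists u => //;
    by rewrite hn (old u (h13 u Bu)).2.
- by rewrite r11; lia.
Qed.

(** Ten nodes for the positive literal, then ten for the negative one. The listed offsets are those
    of the disjunctive tags 2, 5, 7 and 9, as they are and shifted by 10. *)
Definition alloc_nodes : prog :=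
  CSeq (seqs [:: CCopy 15 11; CStore 10 14 15; CStore 11 12 14; CSucc 12])
    (CSeq (addk 11 20) (init_or 15 [:: 2; 5; 7; 9; 12; 15; 17; 19])).

(** [start] owns the number 0, so every first node is positive and the entry 0 in array 10 is free
    to mean that a proposition is new. *)
Lemma built_pos pl hs B (R : atom -> atom -> Prop) W s : built pl hs B R W s -> 0 < reg s 11.
Proof.
move=> [E [O [stk h]]]; have := bu_bound h (x := start); apply.
by rewrite /valid eqxx !orbT.
Qed.

(** 21 counts the 20 nodes and the new entry in the list of propositions. *)
Lemma built_alloc_nodes pl hs B (R : atom -> atom -> Prop) W s :
  built pl hs B R W s -> reg s 14 \notin pl ->
  let s' := run alloc_nodes s in
  built (rcons pl (reg s 14)) hs B R (W + 21) s' /\ reg s' 15 = arr s' 10 (reg s 14).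
Proof.
move=> hb np; cbv zeta; set p := reg s 14 in np *; have N0 := built_pos hb.
rewrite /alloc_nodes 2!run_seq; set s1 := run _ s.
have [e1 e2 _ _] := run_addk 11 20 s1; set s2 := run (addk 11 20) s1 in e1 e2 *.
have [f1 f2 _] := init_or_frame 15 [:: 2; 5; 7; 9; 12; 15; 17; 19] s2.
have r2 z : reg s2 z = if z == 11 then reg s 11 + 20 else
    if z == 12 then (reg s 12).+1 else if z == 15 then reg s 11 else reg s z.
  by rewrite e1 /s1 /=.
have a2 a z : arr s2 a z = if (a == 10) && (z == p) then reg s 11
    else if (a == 11) && (z == reg s 12) then p else arr s a z.
  rewrite e2 /s1 /= /upd /= -/p.
  case: (eqVneq a 11) => [->|na] /=; first by case: eqP.
  by case: (eqVneq a 10) => [->|nb] //=; case: eqP.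
have n2 u : node s2 u = if (u.1 < 10) && (u.2.2 == p) then
    reg s 11 + (if u.2.1 then 0 else 10) + u.1 else node s u.
  by rewrite /node !a2 /=; case: ifP => //= _; case: ifP.
clearbody s2; split; last by rewrite f1 // f2 // r2 a2 !eqxx.
have vE u : valid (rcons pl p) (size hs) u =
    valid pl (size hs) u || ((u.1 < 10) && (u.2.2 == p)).
  rewrite /valid mem_rcons inE andb_orr -!orbA orbC -!orbA.
  by congr (_ || _); rewrite orbC -!orbA.
have [E [O [stk [h1 h2 h3 h4 h5 h6 h7 h8 h9 h10 h11 h12 h13 h14 h15]]]] := hb.
have sz : size (rcons pl p) - size pl = 1 by rewrite size_rcons; lia.
rewrite (_ : W + 21 = W + 20 + (size (rcons pl p) - size pl)); last by rewrite sz; lia.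
have oldn u : valid pl (size hs) u -> node s2 u = node s u.
  rewrite n2; case: ifP => // /andP[lt /eqP ep]; rewrite /valid lt ep (negbTE np) /=.
  by case: u lt ep => t q /= lt _ /orP[|/eqP[et]]; lia.
apply: built_extend hb _ _ _ _ _ _ _ _ _ _ _ _ _ _.
- by rewrite !r2.
- by move=> a la; rewrite e2 /s1 /= /upd; do 6 (case: a la => [//|a] la).
- by [].
- by rewrite r2.
- by rewrite r2.
- by move=> u vu; split; [rewrite vE vu | exact: oldn].
- move=> u; rewrite vE => /orP[->|h]; [by left | right].
  rewrite n2 h; case: u h => t [b q] /= /andP[lt _].
  exists ((if b then 0 else 10) + t); first by case: b; lia.
  split; first by lia.
  by case: b; do 10 (case: t lt => [//|t] lt).
- move=> u v; rewrite !vE => /orP[vu|cu] /orP[vv|cv].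
  + by rewrite oldn //; have := h3 _ vu; lia.
  + by rewrite oldn //; have := h3 _ vu; lia.
  + by rewrite (oldn v) //; have := h3 _ vv; lia.
  + move=> _; rewrite !n2 cu cv; case: u v cu cv => [t [b q]] [t' [b' q']] /=.
    move=> /andP[lt /eqP->] /andP[lt' /eqP->].
    case: b; case: b' => e; try by lia.
      by congr (_, (_, _)); lia.
    by congr (_, (_, _)); lia.
- move=> q; rewrite a2 mem_rcons inE /=; case: eqP => //= _; exact: h2.
- by rewrite r2 /= size_rcons h5.
- move=> k; rewrite size_rcons ltnS a2 /= h5 nth_rcons.
  by case: ltngtP => // lk _; rewrite h6.
- by rewrite r2.
- move=> r lr /=; rewrite !a2 /=; have [g1 g2 g3 g4] := h8 r lr.
  by rewrite !oldn ?mem_rcons ?inE ?g4 ?orbT //; rewrite /valid /= g4.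
- by [].
Qed.

(** Five nodes for the tags 10 to 14, of which 11 and 14, at offsets 1 and 4, are disjunctive. The
    nodes of the consequent and of its complement are kept for comparing rules when superiority
    statements arrive. *)
Definition new_rule : prog :=
  CSeq (seqs [:: CCopy 20 11; CStore 12 13 20; CStore 13 13 19; CStore 14 13 16;
                 CStore 15 13 17; CSucc 13])
    (CSeq (addk 11 5) (init_or 20 [:: 1; 4])).

Lemma built_new_rule pl hs B (R : atom -> atom -> Prop) W s k c :
  built pl hs B R W s -> reg s 19 = kind_code k -> c.2 \in pl ->
  reg s 16 = node s (0, c) -> reg s 17 = node s (0, compl c) ->
  let s' := run new_rule s in
  [/\ built pl (rcons hs (k, c)) B R (W + 5) s',
      reg s' 20 = node s' (10, (true, size hs))
    & forall x, x.1 < 10 -> node s' x = node s x].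
Proof.
move=> hb rk cp r16 r17; cbv zeta.
rewrite /new_rule 2!run_seq; set s1 := run _ s.
have [e1 e2 _ _] := run_addk 11 5 s1; set s2 := run (addk 11 5) s1 in e1 e2 *.
have [f1 f2 _] := init_or_frame 20 [:: 1; 4] s2.
have [E [O [stk [h1 h2 h3 h4 h5 h6 h7 h8 h9 h10 h11 h12 h13 h14 h15]]]] := hb.
have r2 z : reg s2 z = if z == 11 then reg s 11 + 5 else
    if z == 13 then (reg s 13).+1 else if z == 20 then reg s 11 else reg s z.
  by rewrite e1 /s1 /=.
have a2 a z : arr s2 a z = if (12 <= a < 16) && (z == size hs) then
    nth 0 [:: reg s 11; kind_code k; node s (0, c); node s (0, compl c)] (a - 12)
    else arr s a z.
  rewrite e2 /s1 /= /upd /= h7 rk r16 r17.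
  case: (eqVneq a 15) => [->|n15] /=; first by case: eqP.
  case: (eqVneq a 14) => [->|n14] /=; first by case: eqP.
  case: (eqVneq a 13) => [->|n13] /=; first by case: eqP.
  case: (eqVneq a 12) => [->|n12] /=; first by case: eqP.
  by rewrite ifF //; lia.
have n2 u : node s2 u = if (10 <= u.1 < 15) && (u.2.2 == size hs) then
    reg s 11 + (u.1 - 10) else node s u.
  rewrite /node !a2 /=; case: ltnP => //= _; case: ltnP => //= _; by case: ifP.
clearbody s2; split.
- have vE u : valid pl (size (rcons hs (k, c))) u =
      valid pl (size hs) u || [&& 10 <= u.1 < 15, u.2.1 & u.2.2 == size hs].
    rewrite /valid size_rcons [u.2.2 < _.+1]ltnS [u.2.2 <= size hs]leq_eqVlt.
    case: (u.2.2 == size hs); case: (u.2.2 < size hs); case: (9 < u.1 < 15);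
      by case: (u.2.1); case: (u == start); rewrite /= ?(orbT, orbF).
  have oldn u : valid pl (size hs) u -> node s2 u = node s u.
    rewrite n2; case: ifP => // /andP[lt /eqP ep]; rewrite /valid lt ep ltnn andbF /=.
    by case: u lt ep => t q /= lt _ /orP[|/eqP[et]]; lia.
  rewrite (_ : W + 5 = W + 5 + (size pl - size pl)); last by lia.
  apply: built_extend hb _ _ _ _ _ _ _ _ _ _ _ _ _ _.
  + by rewrite !r2.
  + by move=> a la; rewrite e2 /s1 /= /upd; do 6 (case: a la => [//|a] la).
  + by [].
  + by rewrite r2.
  + by rewrite r2.
  + by move=> u vu; split; [rewrite vE vu | exact: oldn].
  + move=> u; rewrite vE => /orP[->|/and3P[lt b e]]; [by left | right].
    rewrite n2 lt e; exists (u.1 - 10); first by lia.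
    split=> //; case: u lt {b e} => t q /= lt.
    by do 15 (case: t lt => [//|t] lt).
  + move=> u v; rewrite !vE => /orP[vu|cu] /orP[vv|cv].
    * by rewrite oldn //; have := h3 _ vu; lia.
    * by rewrite oldn //; have := h3 _ vu; lia.
    * by rewrite (oldn v) //; have := h3 _ vv; lia.
    * move=> _; rewrite !n2; case: u v cu cv => [t [b q]] [t' [b' q']] /=.
      move=> /and3P[lt -> e] /and3P[lt' -> e']; rewrite lt lt' e e' /= => et.
      by move/eqP: e => ->; move/eqP: e' => ->; congr (_, _); lia.
  + by move=> q; rewrite a2 /=; exact: h2.
  + by rewrite r2.
  + by move=> i li; rewrite a2 /= h6.
  + by rewrite r2 /= h7 size_rcons.
  + move=> r; rewrite size_rcons ltnS nth_rcons !a2 /= => lr.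
    case: ltngtP lr => [lr|//|er] _ /=; last by rewrite !oldn // /valid /= cp.
    have [g1 g2 g3 g4] := h8 r lr.
    by rewrite !oldn //; rewrite /valid /= g4.
  + by [].
- by rewrite f1 // r2 /= (node_eq (s := s2)) ?f2 // n2 /= eqxx addn0.
- move=> u lu; rewrite (node_eq (s := s2)) ?f2 // n2 ifF //; lia.
Qed.

(** * Reading the theory *)

Definition point_at (b : bool) : prog :=
  if b then CSeq (CCopy 16 15) (set_sum 17 15 10)
  else CSeq (set_sum 16 15 10) (CCopy 17 15).

Lemma run_point_at b s :
  [/\ reg (run (point_at b) s) 16 = reg s 15 + (if b then 0 else 10),
      reg (run (point_at b) s) 17 = reg s 15 + (if b then 10 else 0),
      forall z, z != 16 -> z != 17 -> reg (run (point_at b) s) z = reg s z,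
      arr (run (point_at b) s) = arr s & input (run (point_at b) s) = input s].
Proof.
case: b; rewrite /point_at run_seq.
- have [h1 h2 h3 _] := run_set_sum 17 15 10 (run (CCopy 16 15) s).
  move: (run (set_sum 17 15 10) _) h1 h2 h3 => s1 h1 h2 h3.
  rewrite h2 h3 addn0; split; [by rewrite h1 | by rewrite h1 | | by [] | by []].
  by move=> z z1 z2; rewrite h1 (negbTE z2) /= /upd (negbTE z1).
- have [h1 h2 h3 _] := run_set_sum 16 15 10 s.
  move: (run _ s) h1 h2 h3 => s1 h1 h2 h3.
  rewrite /= /upd /= !h1 /= h2 h3 addn0; split=> // z z1 z2.
  by rewrite (negbTE z2) h1 (negbTE z1).
Qed.

Lemma node_literal s t q : t < 10 -> node s (t, q) = node s (0, q) + t.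
Proof. by rewrite /node /= => ->; rewrite addn0. Qed.

Lemma node_rule s t r : 10 <= t < 15 -> node s (t, (true, r)) = node s (10, (true, r)) + (t - 10).
Proof. by rewrite /node /= => /andP[l1 l2]; rewrite ltnNge l1 /= l2 addn0. Qed.

(** Schemas that can be written while no rule is current and register 20 has no meaning. *)
Definition ruleless (L : schema) : bool :=
  all (fun e => (if e.1.2 is OfRule then false else true)
                && (if e.2.2 is OfRule then false else true)) L.

Definition well_placed_schema (L : schema) : bool :=
  all (fun e => well_placed e.1 && well_placed e.2) L.

Lemma built_schema pl hs B (R : atom -> atom -> Prop) W s q r L :
  built pl hs B R W s -> well_placed_schema L -> q.2 \in pl ->
  reg s 16 = node s (0, q) -> reg s 17 = node s (0, compl q) ->
  ruleless L \/ r < size hs /\ reg s 20 = node s (10, (true, r)) ->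
  let s' := run (add_schema L) s in
  built pl hs B (fun x y => R x y \/ (x, y) \in instances L q r) (W + size L) s' /\
  [/\ forall z, 10 <= z -> reg s' z = reg s z,
      forall a, 10 <= a -> arr s' a = arr s a
    & input s' = input s].
Proof.
move=> hb wL qp r16 r17 rL; apply: (built_add_schema hb wL) => e eL.
have z10 := built_zero hb.
have loc o : well_placed o -> (o.2 = OfRule -> ~ ruleless L) ->
    located pl (size hs) s q r o.
  rewrite /well_placed; case: o => t [] /= lt nr; rewrite /located /locate /place_reg /offset /=.
  - by rewrite node_literal // r16 /valid /= qp lt.
  - by rewrite node_literal // r17 /valid /= qp lt.
  - case: rL => [/(nr erefl)//|[lr r20]].
    by rewrite node_rule // r20 /valid /= lt lr orbT.
  - by rewrite /valid eqxx !orbT z10.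
have wp : well_placed e.1 && well_placed e.2.
  by elim: (L) wL eL => //= e' L' IH /andP[w /IH h] [<-|/h].
have rl : ruleless L -> (if e.1.2 is OfRule then false else true)
                && (if e.2.2 is OfRule then false else true).
  by elim: (L) eL => //= e' L' IH [<-|/IH h] /andP[].
case/andP: wp => w1 w2; split; apply: loc => // eo /rl; rewrite eo ?andbF //.
Qed.

Lemma edge_new_prop pl p D x y :
  edge (rcons pl p) D x y <->
  (edge pl D x y \/ (x, y) \in instances literal_schema (true, p) 0) \/
  (x, y) \in instances literal_schema (false, p) 0.
Proof.
split.
- case=> {x y} [q x y|r x y lr h|r a x y lr ha h|t s ts lt ls kt ct].
  + case: q => b p'; rewrite mem_rcons inE => /orP[/eqP /= ->|hp] h.
      by case: b h => h; [left; right | right].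
    by left; left; apply: edge_literal h.
  + by left; left; apply: edge_rule h.
  + by left; left; apply: edge_body h.
  + by left; left; apply: edge_sup.
- have lit b : (x, y) \in instances literal_schema (b, p) 0 -> edge (rcons pl p) D x y.
    by apply: edge_literal; rewrite /= mem_rcons inE eqxx.
  case=> [[h|/lit//]|/lit//].
  case: h => {x y lit} [q x y hq h|r x y lr h|r a x y lr ha h|t s ts lt ls kt ct].
  + by apply: edge_literal h; rewrite mem_rcons inE hq orbT.
  + exact: edge_rule h.
  + exact: edge_body h.
  + exact: edge_sup.
Qed.

Definition alloc : prog :=
  CSeq alloc_nodes (CSeq (point_at true) (CSeq (add_schema literal_schema)
    (CSeq (point_at false) (add_schema literal_schema)))).

(** 35 is 21 for the allocation plus the 7 edges of [literal_schema] for each of the two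
    literals. *)
Lemma built_alloc pl hs B D W s :
  built pl hs B (edge pl D) W s -> reg s 14 \notin pl ->
  let s' := run alloc s in
  built (rcons pl (reg s 14)) hs B (edge (rcons pl (reg s 14)) D) (W + 35) s' /\
  reg s' 15 = arr s' 10 (reg s 14).
Proof.
move=> hb np; cbv zeta; have [hb1 e15] := built_alloc_nodes hb np.
move: (reg s 14) np hb1 e15 => p np.
rewrite /alloc 4!run_seq; move: (run alloc_nodes s) => s1 hb1 e15.
have pp : p \in rcons pl p by rewrite mem_rcons inE eqxx.
have [g16 g17 gr ga _] := run_point_at true s1.
have hb2 : built (rcons pl p) hs B (edge pl D) (W + 21) (run (point_at true) s1).
  by apply: built_same hb1 => z hz; rewrite ?ga ?gr //; apply/negP => /eqP e; subst z.
move: (run _ s1) hb2 g16 g17 gr ga => s2 hb2 g16 g17 gr ga.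
have [|||hb3 [fr fa _]] := built_schema (q := (true, p)) (r := 0) hb2 (L := literal_schema) isT pp.
- by rewrite g16 /node /= ga e15 !addn0.
- by rewrite g17 /node /= ga e15 !addn0.
- by left.
move: (run _ s2) hb3 fr fa => s3 hb3 fr fa.
have e15' : reg s3 15 = arr s3 10 p by rewrite fr // gr // fa // ga.
have [k16 k17 kr ka _] := run_point_at false s3.
have hb4 : built (rcons pl p) hs B (fun x y => edge pl D x y \/
    (x, y) \in instances literal_schema (true, p) 0) (W + 21 + 7) (run (point_at false) s3).
  by apply: built_same hb3 => z hz; rewrite ?ka ?kr //; apply/negP => /eqP e; subst z.
move: (run _ s3) hb4 k16 k17 kr ka => s4 hb4 k16 k17 kr ka.
have [|||hb5 [fr' fa' _]] := built_schema (q := (false, p)) (r := 0) hb4 (L := literal_schema) isT pp.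
- by rewrite k16 /node /= ka e15' !addn0.
- by rewrite k17 /node /= ka e15' !addn0.
- by left.
split; last by rewrite fr' // kr // fa' // ka.
by apply: built_weaken hb5 => //; [move=> x y; rewrite edge_new_prop | rewrite /=; lia].
Qed.

Definition sign_code (q : literal) : nat := if q.1 then 1 else 2.

(** The sign is expected in register 18 already: in the list loops it doubles as the marker, 0
    ending the list and 1 or 2 announcing a literal. *)
Definition read_literal : prog :=
  CSeq (seqs [:: CRead 14; CLoad 15 10 14]) (CSeq (CIf (TEq 15 10) alloc CSkip)
    (CSeq (CConst 21 1) (CIf (TEq 18 21) (point_at true) (point_at false)))).

Lemma built_read_literal pl hs B D W s q w :
  built pl hs B (edge pl D) W s -> input s = q.2 :: w -> reg s 18 = sign_code q ->
  let s' := run read_literal s in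
  exists pl', [/\ built pl' hs B (edge pl' D) (W + 35) s', pl' =i q.2 :: pl,
    reg s' 16 = node s' (0, q), reg s' 17 = node s' (0, compl q) & input s' = w].
Proof.
move=> hb hi r18; cbv zeta; rewrite /read_literal 3!run_seq.
set s1 := run _ s.
have hb1 : built pl hs B (edge pl D) W s1 by apply: built_run hb.
have i1 : input s1 = w by rewrite /s1 /= hi.
have r14 : reg s1 14 = q.2 by rewrite /s1 /= /upd /= hi.
have r15 : reg s1 15 = arr s1 10 q.2 by rewrite /s1 /= /upd /= hi.
have r18' : reg s1 18 = sign_code q by rewrite -r18.
have z10 := built_zero hb1.
clearbody s1; set s2 := run (CIf _ _ _) s1.
have [pl' [hb2 epl e15 e18 i2]] : exists pl',
    [/\ built pl' hs B (edge pl' D) (W + 35) s2, pl' =i q.2 :: pl,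
        reg s2 15 = arr s2 10 q.2, reg s2 18 = sign_code q & input s2 = w].
  rewrite /s2 run_if /eval_test r15 z10; have [E [O [stk h]]] := hb1.
  have := bu_alloc h q.2; case: posnP => [e0|lt] => [/esym/negbT np|/esym pp].
    rewrite -r14 in np; have [hb2 e15] := built_alloc hb1 np.
    exists (rcons pl q.2); split.
    + by rewrite -r14.
    + by move=> z; rewrite mem_rcons.
    + by rewrite -r14.
    + by rewrite (frame_reg (run_frame alloc s1)).
    + by rewrite (frame_input (run_frame alloc s1)).
  exists pl; split=> //; first by apply: built_weaken hb1 => //; lia.
  by move=> z; rewrite inE; case: eqP => // ->.
clearbody s2.
have -> : run (CIf (TEq 18 21) (point_at true) (point_at false)) (run (CConst 21 1) s2)
   = run (point_at q.1) (run (CConst 21 1) s2).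
  rewrite run_if (_ : eval_test _ _ = q.1); first by case: q.1.
  by rewrite /= /upd /= e18 /sign_code; case: q.1.
set s3 := run (CConst 21 1) s2.
have hb3 : built pl' hs B (edge pl' D) (W + 35) s3 by apply: built_run hb2.
have e15' : reg s3 15 = arr s3 10 q.2 by [].
have i3 : input s3 = w by [].
clearbody s3; have [k16 k17 kr ka ki] := run_point_at q.1 s3.
exists pl'; split=> //.
- by apply: built_same hb3 => z hz; rewrite ?ka ?kr //; apply/negP => /eqP e; subst z.
- by rewrite k16 /node /= ka e15' !addn0.
- by rewrite k17 /node /= ka e15' addn0; case: q.1.
- by rewrite ki.
Qed.

(** Facts enter through [base] alone, so reading one affects the edges only when its proposition is
    new. *)
Lemma edge_facts pl fs fs' rs sp x y :
  edge pl (Theory fs rs sp) x y -> edge pl (Theory fs' rs sp) x y.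
Proof.
case=> {x y} [q x y hq h|r x y lr h|r a x y lr ha h|t s ts lt ls kt ct].
- exact: edge_literal h.
- exact: (@edge_rule _ (Theory fs' rs sp) r).
- exact: (@edge_body _ (Theory fs' rs sp) r a).
- exact: (@edge_sup _ (Theory fs' rs sp)).
Qed.

Definition fact_step : prog := CSeq read_literal (CSeq (fire 16 0) (CRead 18)).

Definition facts_loop : prog := CWhile (TLt 10 18) fact_step.

Lemma facts_loop_correct c l fs pl W s w :
  cost fact_step <= c ->
  built pl [::] (base (Theory fs [::] [::])) (edge pl (Theory fs [::] [::])) W s ->
  pl =i props (Theory fs [::] [::]) ->
  reg s 18 :: input s = encode_list encode_literal l ++ w ->
  ends_within facts_loop s (c.+1 * size l + 1) (fun s' => exists pl',
    let D := Theory (fs ++ l) [::] [::] in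
    [/\ built pl' [::] (base D) (edge pl' D) (W + 35 * size l) s',
        pl' =i props D & input s' = w]).
Proof.
move=> lc; elim: l fs pl W s => [|q l IH] fs pl W s hb hp.
  case=> e18 ei; rewrite muln0 add0n; apply: ends_while_false.
    by rewrite /= e18 (built_zero hb).
  by exists pl; rewrite cats0 /= muln0 addn0.
move=> /= [e18 ei].
apply: (@ends_weaken _ _ (c + (c.+1 * size l + 1)).+1 _ _ _ _ _ (fun _ => id));
  last by rewrite mulnS; lia.
apply: ends_while_true; first by rewrite /= e18 (built_zero hb); case: q.1.
apply: (ends_run _ lc) => //; rewrite /fact_step 2!run_seq.
have [pl' [hb1 hp1 r16 _ i1]] := built_read_literal hb ei e18.
move: (run read_literal s) hb1 r16 i1 => s1 hb1 r16 i1.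
have qp : q.2 \in pl' by rewrite hp1 inE eqxx.
have vq : valid pl' (@size (rule_kind * literal) [::]) (0, q) by rewrite /valid /= qp.
have e16 : node s1 (0, q) = reg s1 16 + 0 by rewrite addn0.
have hb2 := built_fire hb1 vq e16.
have i2 : input (run (fire 16 0) s1) = flatten [seq encode_literal i | i <- l] ++ [:: 0] ++ w.
  by rewrite (frame_input (run_frame _ _)) // i1 catA.
move: (run (fire 16 0) s1) hb2 i2 => s2 hb2 i2.
have hb3 : built pl' [::] (base (Theory (rcons fs q) [::] [::]))
    (edge pl' (Theory (rcons fs q) [::] [::])) (W + 35) (run (CRead 18) s2).
  apply: built_run => //; apply: built_weaken hb2 => //.
  - move=> x; rewrite /base /=; split=> [[[|[a ha ->]]|->]|[|[a]]].
    + by left.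
    + by right; exists a; rewrite ?mem_rcons ?inE ?ha ?orbT.
    + by right; exists q; rewrite ?mem_rcons ?inE ?eqxx.
    + by left; left.
    + rewrite mem_rcons inE => /orP[/eqP->|ha] ->; first by right.
      by left; right; exists a.
  - by move=> x y; split; apply: edge_facts.
have hp3 : pl' =i props (Theory (rcons fs q) [::] [::]).
  move=> z; rewrite hp1 inE hp /props /= !cats0 map_rcons mem_rcons inE.
  by [].
apply: ends_weaken (IH _ _ _ _ hb3 hp3 _) _ _ => //.
  rewrite /= i2 /upd /= /encode_list -catA.
  by case: (flatten _) => //.
by move=> s' [pl'' [h1 h2 h3]]; exists pl''; rewrite -cat_rcons mulnS addnA.
Qed.

(** The consequent is encoded before the body, so a rule joins the theory with an empty body, which
    then grows by one antecedent at a time. Superiority is still empty at this point. *)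
Lemma edge_new_rule pl fs rs k q x y :
  edge pl (Theory fs (rcons rs (Rule k [::] q)) [::]) x y <->
  edge pl (Theory fs rs [::]) x y \/ (x, y) \in instances (rule_schema k) q (size rs).
Proof.
set rho := Rule k [::] q; set D := Theory fs rs [::].
have ra r : r < size (rules D) -> rule_at (Theory fs (rcons rs rho) [::]) r = rule_at D r.
  by move=> lr; rewrite /rule_at nth_rcons lr.
have rn : rule_at (Theory fs (rcons rs rho) [::]) (size rs) = rho.
  by rewrite /rule_at nth_rcons ltnn eqxx.
have sz : size (rules (Theory fs (rcons rs rho) [::])) = (size rs).+1 by exact: size_rcons.
split.
- case=> {x y} [q' x y hq h|r x y|r a x y|t s //].
  + by left; apply: edge_literal h.
  + rewrite sz ltnS leq_eqVlt => /orP[/eqP->|lr]; first by rewrite rn; right.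
    by rewrite ra // => h; left; apply: (@edge_rule _ D r).
  + rewrite sz ltnS leq_eqVlt => /orP[/eqP->|lr]; rewrite /antecedent ?rn // ra //.
    by move=> ha h; left; apply: (@edge_body _ D r a).
- case=> [h|h]; last by apply: (@edge_rule _ _ (size rs)); rewrite ?sz ?rn.
  case: h => {x y} [q' x y hq h|r x y lr h|r a x y lr ha h|t s //].
  + exact: edge_literal h.
  + by apply: (@edge_rule _ _ r); rewrite ?sz ?ra //; apply: leqW.
  + by apply: (@edge_body _ _ r a); rewrite /antecedent ?sz ?ra //; apply: leqW.
Qed.

Lemma edge_new_antecedent pl fs rs k bd a q x y :
  edge pl (Theory fs (rcons rs (Rule k (rcons bd a) q)) [::]) x y <->
  edge pl (Theory fs (rcons rs (Rule k bd q)) [::]) x y \/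
  (x, y) \in instances body_schema a (size rs).
Proof.
pose D b := Theory fs (rcons rs (Rule k b q)) [::].
rewrite -/(D bd) -/(D (rcons bd a)).
have ra b r : r < size rs -> rule_at (D b) r = rule_at (Theory fs rs [::]) r.
  by move=> lr; rewrite /rule_at nth_rcons lr.
have rn b : rule_at (D b) (size rs) = Rule k b q.
  by rewrite /rule_at nth_rcons ltnn eqxx.
have sz b : size (rules (D b)) = (size rs).+1 by exact: size_rcons.
split.
- case=> {x y} [q' x y hq h|r x y|r b x y|t s //].
  + by left; apply: edge_literal h.
  + rewrite sz ltnS leq_eqVlt => /orP[/eqP->|lr]; rewrite ?rn => h; left.
      by apply: (@edge_rule _ _ (size rs)); rewrite ?sz ?rn.
    by apply: (@edge_rule _ _ r); rewrite ?sz ?ra //; [apply: leqW | rewrite ra in h].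
  + rewrite sz ltnS leq_eqVlt => /orP[/eqP->|lr]; rewrite /antecedent ?rn ?ra //= => hb h.
      move: hb; rewrite mem_rcons inE => /orP[/eqP e|hb]; first by right; rewrite -e.
      by left; apply: (@edge_body _ _ (size rs) b); rewrite ?sz /antecedent ?rn.
    by left; apply: (@edge_body _ _ r b); rewrite ?sz /antecedent ?ra //; apply: leqW.
- case=> [h|h]; last first.
    by apply: (@edge_body _ _ (size rs) a); rewrite ?sz /antecedent ?rn //= mem_rcons inE eqxx.
  case: h => {x y} [q' x y hq h|r x y|r b x y|t s //].
  + exact: edge_literal h.
  + rewrite sz ltnS leq_eqVlt => /orP[/eqP->|lr]; rewrite ?rn => h.
      by apply: (@edge_rule _ _ (size rs)); rewrite ?sz ?rn.
    by apply: (@edge_rule _ _ r); rewrite ?sz ?ra //; [apply: leqW | rewrite ra in h].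
  + rewrite sz ltnS leq_eqVlt => /orP[/eqP->|lr]; rewrite /antecedent ?rn ?ra //= => hb h.
      apply: (@edge_body _ _ (size rs) b); rewrite ?sz /antecedent ?rn //=.
      by rewrite mem_rcons inE hb orbT.
    by apply: (@edge_body _ _ r b); rewrite ?sz /antecedent ?ra //; apply: leqW.
Qed.

Lemma edge_new_sup pl fs rs sp t s x y : t < size rs -> s < size rs ->
  let D := Theory fs rs sp in
  edge pl (Theory fs rs (rcons sp (t, s))) x y <->
  edge pl D x y \/
  [/\ supportive (kind (rule_at D t)),
      conseq (rule_at D t) = compl (conseq (rule_at D s))
    & (x, y) = ((13, (true, t)), (14, (true, s)))].
Proof.
move=> lt ls D; split.
- case=> {x y} [q x y hq h|r x y lr h|r a x y lr ha h|t' s' ts lt' ls' kt ct].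
  + by left; apply: edge_literal h.
  + by left; apply: (@edge_rule _ D r).
  + by left; apply: (@edge_body _ D r a).
  + move: ts; rewrite /sup /= mem_rcons inE => /orP[/eqP[et es]|ts].
      by subst t' s'; right.
    by left; apply: (@edge_sup _ D).
- case=> [h|[kt ct [-> ->]]].
  + case: h => {x y} [q x y hq h|r x y lr h|r a x y lr ha h|t' s' ts lt' ls' kt ct].
    * exact: edge_literal h.
    * exact: (@edge_rule _ (Theory fs rs (rcons sp (t, s))) r).
    * exact: (@edge_body _ (Theory fs rs (rcons sp (t, s))) r a).
    * apply: (@edge_sup _ (Theory fs rs (rcons sp (t, s)))) => //.
      by rewrite /sup /= mem_rcons inE -/(sup D t' s') ts orbT.
  + apply: (@edge_sup _ (Theory fs rs (rcons sp (t, s)))) => //.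
    by rewrite /sup /= mem_rcons inE eqxx.
Qed.

Lemma props_rcons fs rs rho sp :
  props (Theory fs (rcons rs rho) sp) =i
  [seq q.2 | q <- conseq rho :: body rho] ++ props (Theory fs rs sp).
Proof.
move=> z; rewrite /props map_rcons flatten_rcons /=.
by rewrite !(mem_cat, inE) orbC -!orbA; do !bool_congr.
Qed.

Definition body_step : prog :=
  CSeq read_literal (CSeq (add_schema body_schema) (CRead 18)).

Definition body_loop : prog := CWhile (TLt 10 18) body_step.

(** 40 is 35 for a possibly new proposition plus the 5 edges of [body_schema]. *)
Lemma body_loop_correct c l fs rs hs k bd q pl W s w :
  cost body_step <= c -> size hs = (size rs).+1 ->
  let D bd := Theory fs (rcons rs (Rule k bd q)) [::] in
  built pl hs (base (D bd)) (edge pl (D bd)) W s ->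
  pl =i props (D bd) ->
  reg s 20 = node s (10, (true, size rs)) ->
  reg s 18 :: input s = encode_list encode_literal l ++ w ->
  ends_within body_loop s (c.+1 * size l + 1) (fun s' => exists pl',
    [/\ built pl' hs (base (D (bd ++ l))) (edge pl' (D (bd ++ l))) (W + 40 * size l) s',
        pl' =i props (D (bd ++ l)) & input s' = w]).
Proof.
move=> lc sh D; elim: l bd pl W s => [|a l IH] bd pl W s hb hp r20.
  case=> e18 ei; rewrite muln0 add0n; apply: ends_while_false.
    by rewrite /= e18 (built_zero hb).
  by exists pl; rewrite cats0 /= muln0 addn0.
move=> [e18 ei].
apply: (@ends_weaken _ _ (c + (c.+1 * size l + 1)).+1 _ _ _ _ _ (fun _ => id));
  last by rewrite /= mulnS; lia.
apply: ends_while_true; first by rewrite /= e18 (built_zero hb); case: a.1.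
apply: (ends_run _ lc) => //; rewrite /body_step 2!run_seq.
have [pl' [hb1 hp1 r16 r17 i1]] := built_read_literal hb ei e18.
have f20 := frame_reg (run_frame read_literal s) (x := 20) isT.
have f12 := frame_arr (run_frame read_literal s) (a := 12) isT.
move: (run read_literal s) hb1 r16 r17 i1 f20 f12 => s1 hb1 r16 r17 i1 f20 f12.
have {f12} f20 : reg s1 20 = node s1 (10, (true, size rs)) by rewrite f20 r20 /node /= f12.
have ap : a.2 \in pl' by rewrite hp1 inE eqxx.
have lr : size rs < size hs by rewrite sh.
have [hb2 [fr fa i2]] := built_schema (L := body_schema) hb1 isT ap r16 r17
  (or_intror (conj lr f20)).
move: (run _ s1) hb2 fr fa i2 => s2 hb2 fr fa i2.
have e20 : reg (run (CRead 18) s2) 20 = node (run (CRead 18) s2) (10, (true, size rs)).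
  by rewrite [RHS]/node /= /upd /= fr // f20 /node /= fa.
have hb3 : built pl' hs (base (D (rcons bd a))) (edge pl' (D (rcons bd a)))
    (W + 40) (run (CRead 18) s2).
  apply: built_run => //; apply: built_weaken hb2 => //.
    by move=> x y; rewrite edge_new_antecedent.
  by rewrite /=; lia.
have hp3 : pl' =i props (D (rcons bd a)).
  move=> z; rewrite hp1 inE hp !props_rcons /= map_rcons !(inE, mem_cat, mem_rcons).
  by do !bool_congr.
apply: ends_weaken (IH _ _ _ _ hb3 hp3 e20 _) _ _ => //.
  rewrite /= i2 i1 /upd /=.
  by rewrite /encode_list; case: (flatten _).
by move=> s' [pl'' [h1 h2 h3]]; exists pl''; rewrite -cat_rcons mulnS addnA.
Qed.

Definition rule_head : prog :=
  CSeq (CRead 18) (CSeq read_literal (CSeq new_rule (CSeq (add_schema common_schema)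
    (CSeq (CConst 21 1) (CSeq (CIf (TEq 19 21) (add_schema strict_schema) CSkip)
    (CSeq (CConst 21 3) (CIf (TLt 19 21) (add_schema supportive_schema) CSkip))))))).

(** 48 is 35 for the consequent, 5 for the nodes of the rule, 4 for [common_schema] and 2 for each
    of the two optional schemas. *)
Lemma rule_head_correct fs rs hs k q pl W s w :
  size hs = size rs ->
  built pl hs (base (Theory fs rs [::])) (edge pl (Theory fs rs [::])) W s ->
  reg s 19 = kind_code k -> input s = encode_literal q ++ w ->
  let s' := run rule_head s in
  let D := Theory fs (rcons rs (Rule k [::] q)) [::] in
  exists pl',
    [/\ built pl' (rcons hs (k, q)) (base D) (edge pl' D) (W + 48) s',
        pl' =i q.2 :: pl, reg s' 20 = node s' (10, (true, size rs))
      & input s' = w].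
Proof.
move=> sh hb r19 ei; cbv zeta; rewrite /rule_head 7!run_seq.
have hb0 : built pl hs (base (Theory fs rs [::])) (edge pl (Theory fs rs [::])) W (run (CRead 18) s).
  exact: built_run hb.
have i0 : input (run (CRead 18) s) = q.2 :: w by rewrite /= ei.
have r18 : reg (run (CRead 18) s) 18 = sign_code q by rewrite /= ei.
have r19' : reg (run (CRead 18) s) 19 = kind_code k by rewrite -r19.
move: (run _ s) hb0 i0 r18 r19' => s0 hb0 i0 r18 {}r19.
have [pl' [hb1 hp1 r16 r17 i1]] := built_read_literal hb0 i0 r18.
have k19 : reg (run read_literal s0) 19 = kind_code k.
  by rewrite (frame_reg (run_frame _ _)).
move: (run _ s0) hb1 r16 r17 i1 k19 => s1 hb1 r16 r17 i1 k19.
have qp : q.2 \in pl' by rewrite hp1 inE eqxx.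
have [hb2 f20 nn] := built_new_rule hb1 k19 qp r16 r17.
have [g16 g17 g19] : [/\ reg (run new_rule s1) 16 = node (run new_rule s1) (0, q),
    reg (run new_rule s1) 17 = node (run new_rule s1) (0, compl q)
  & reg (run new_rule s1) 19 = kind_code k].
  by split; rewrite ?nn // (frame_reg (run_frame _ _)).
have i2 : input (run new_rule s1) = w by rewrite (frame_input (run_frame _ _)).
move: (run _ s1) hb2 f20 g16 g17 g19 i2 {nn} => s2 hb2 f20 g16 g17 g19 i2.
have lr : size hs < size (rcons hs (k, q)) by rewrite size_rcons.
have rr s' : reg s' 20 = node s' (10, (true, size hs)) ->
  forall L, ruleless L \/ size hs < size (rcons hs (k, q)) /\
            reg s' 20 = node s' (10, (true, size hs)) by right.
have [hb3 [fr fa i3]] := built_schema (L := common_schema) hb2 isT qp g16 g17 (rr _ f20 _).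
have nn : node (run (add_schema common_schema) s2) =1 node s2.
  by apply: node_eq; apply: fa.
have [m16 m17 m19 m20] : [/\ reg (run (add_schema common_schema) s2) 16 =
    node (run (add_schema common_schema) s2) (0, q),
    reg (run (add_schema common_schema) s2) 17 =
    node (run (add_schema common_schema) s2) (0, compl q),
    reg (run (add_schema common_schema) s2) 19 = kind_code k
  & reg (run (add_schema common_schema) s2) 20 =
    node (run (add_schema common_schema) s2) (10, (true, size hs))].
  by split; rewrite fr // nn.
move: (run _ s2) hb3 i3 m16 m17 m19 m20 {fr fa nn} => s3 hb3 i3 m16 m17 m19 m20.
(* Shared by the strict and the supportive schema. The size bound is charged whether or not the
   schema is written. *)
have step (b : bool) pl0 hs0 B R W0 L t v s4 : eval_test t (run (CConst 21 v) s4) = b ->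
    built pl0 hs0 B R W0 s4 -> well_placed_schema L -> q.2 \in pl0 ->
    reg s4 16 = node s4 (0, q) -> reg s4 17 = node s4 (0, compl q) ->
    size hs < size hs0 -> reg s4 20 = node s4 (10, (true, size hs)) ->
    let s' := run (CIf t (add_schema L) CSkip) (run (CConst 21 v) s4) in
    built pl0 hs0 B
      (fun x y => R x y \/ (x, y) \in instances (if b then L else [::]) q (size hs))
      (W0 + size L) s' /\
    [/\ forall z, 10 <= z -> z != 21 -> reg s' z = reg s4 z,
        forall a, 10 <= a -> arr s' a = arr s4 a
      & input s' = input s4].
  move=> et hb' wL qp' e16 e17 lh e20 s'; rewrite /s' run_if et.
  have {}hb' : built pl0 hs0 B R W0 (run (CConst 21 v) s4) by apply: built_run hb'.
  case: b {et}; last first.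
    split; last by split=> // z lz; rewrite /= /upd => /negbTE->.
    apply: built_weaken hb' => //; last exact: leq_addr.
    by move=> x y; split=> [|[]//]; left.
  have e20' : ruleless L \/ size hs < size hs0 /\ reg (run (CConst 21 v) s4) 20 =
    node (run (CConst 21 v) s4) (10, (true, size hs)) by right.
  have [hb'' [fr fa ii]] := built_schema hb' wL qp' e16 e17 e20'.
  split=> //; split=> // z lz nz.
  by rewrite fr //= /upd (negbTE nz).
have [|hb4 [fr fa i4]] := @step (if k is Strict then true else false)
  _ _ _ _ _ strict_schema (TEq 19 21) 1 _ _ hb3 isT qp m16 m17 lr m20.
  by rewrite /= /upd /= m19; case: (k).
set s4 := run (CIf _ _ _) _ in hb4 fr fa i4 *.
have nn : node s4 =1 node s3 by apply: node_eq; apply: fa.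
have [n16 n17 n19 n20] : [/\ reg s4 16 = node s4 (0, q), reg s4 17 = node s4 (0, compl q),
    reg s4 19 = kind_code k & reg s4 20 = node s4 (10, (true, size hs))].
  by split; rewrite fr // ?nn.
clearbody s4; have [|hb5 [fr' fa' i5]] := @step (supportive k)
  _ _ _ _ _ supportive_schema (TLt 19 21) 3 _ _ hb4 isT qp n16 n17 lr n20.
  by rewrite /= /upd /= n19; case: (k).
set s5 := run (CIf _ _ _) _ in hb5 fr' fa' i5 *; clearbody s5.
exists pl'; split=> //.
- apply: built_weaken hb5 => //; last by rewrite /=; lia.
  move=> x y; rewrite edge_new_rule -sh /rule_schema !instances_cat !mem_cat.
  have -> : (if k is Strict then strict_schema else [::]) =
            (if (if k is Strict then true else false) then strict_schema else [::]) by case: (k).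
  by rewrite -!(rwP orP); tauto.
- by rewrite fr' // n20 -sh /node /= fa'.
- by rewrite i5 i4 i3.
Qed.

Definition heads (rs : seq rule) : seq (rule_kind * literal) :=
  [seq (kind r, conseq r) | r <- rs].

Definition rule_step : prog :=
  CSeq rule_head (CSeq (CRead 18) (CSeq body_loop (CRead 19))).

Definition rules_loop : prog := CWhile (TLt 10 19) rule_step.

Lemma read_next x s : input s <> [::] ->
  reg (run (CRead x) s) x :: input (run (CRead x) s) = input s.
Proof. by rewrite /= /upd eqxx; case: (input s). Qed.

Lemma encode_list_cat_neq0 T (enc : T -> seq nat) l w : encode_list enc l ++ w <> [::].
Proof. by rewrite /encode_list; case: (flatten _). Qed.

Lemma encode_list_cons T (enc : T -> seq nat) a l w :
  encode_list enc (a :: l) ++ w = enc a ++ (encode_list enc l ++ w).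
Proof. by rewrite /encode_list /= -!catA. Qed.

Lemma rules_loop_correct ch c l fs rs pl W s w :
  cost rule_head <= ch -> cost body_step <= c ->
  built pl (heads rs) (base (Theory fs rs [::])) (edge pl (Theory fs rs [::])) W s ->
  pl =i props (Theory fs rs [::]) ->
  reg s 19 :: input s = encode_list encode_rule l ++ w ->
  ends_within rules_loop s (sumn [seq ch + 4 + c.+1 * size (body r) | r <- l] + 1)
    (fun s' => exists pl', let D := Theory fs (rs ++ l) [::] in
    [/\ built pl' (heads (rs ++ l)) (base D) (edge pl' D)
          (W + sumn [seq 48 + 40 * size (body r) | r <- l]) s',
        pl' =i props D & input s' = w]).
Proof.
move=> lch lc; elim: l rs pl W s => [|[k bd q] l IH] rs pl W s hb hp.
  case=> e19 ei; apply: ends_while_false; first by rewrite /= e19 (built_zero hb).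
  by exists pl; rewrite cats0 /= addn0.
rewrite encode_list_cons => -[e19 ei].
have {}ei : input s = encode_literal q ++
    (encode_list encode_literal bd ++ (encode_list encode_rule l ++ w)).
  by rewrite ei /= /encode_list -?catA.
apply: (@ends_weaken _ _ ((ch + (1 + (c.+1 * size bd + 1 + 1)))
   + (sumn [seq ch + 4 + c.+1 * size (body r) | r <- l] + 1)).+1 _ _ _ _ _ (fun _ => id));
  last by rewrite /=; lia.
apply: ends_while_true; first by rewrite /= e19 (built_zero hb); case: (k).
apply: ends_seq; apply: (ends_run _ lch) => //.
have [|pl' [hb1 hp1 r20 i1]] := rule_head_correct _ hb e19 ei; first by rewrite size_map.
move: (run rule_head s) hb1 r20 i1 => s1 hb1 r20 i1.
apply: ends_seq; apply: ends_run => //.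
have e18 : reg (run (CRead 18) s1) 18 :: input (run (CRead 18) s1) =
    encode_list encode_literal bd ++ (encode_list encode_rule l ++ w).
  by rewrite read_next i1 //; apply: encode_list_cat_neq0.
have r20' : reg (run (CRead 18) s1) 20 = node (run (CRead 18) s1) (10, (true, size rs)).
  by rewrite /= /upd /= r20.
have hb2 := @built_run (CRead 18) _ _ _ _ _ _ isT isT hb1.
move: (run _ s1) hb2 e18 r20' => s2 hb2 e18 r20'.
apply: ends_seq.
have hp2 : pl' =i props (Theory fs (rcons rs (Rule k [::] q)) [::]).
  by move=> z; rewrite hp1 inE hp props_rcons.
have sh : size (rcons (heads rs) (k, q)) = (size rs).+1 by rewrite size_rcons size_map.
apply: ends_weaken (body_loop_correct lc sh hb2 hp2 r20' e18) (leqnn _) _.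
move=> s3 [pl3 [hb3 hp3 i3]]; apply: ends_run => //.
have e19' : reg (run (CRead 19) s3) 19 :: input (run (CRead 19) s3) =
    encode_list encode_rule l ++ w.
  by rewrite read_next i3 //; apply: encode_list_cat_neq0.
have hb4 := @built_run (CRead 19) _ _ _ _ _ _ isT isT hb3.
move: (run _ s3) hb4 e19' => s4 hb4 e19'.
have eh : rcons (heads rs) (k, q) = heads (rcons rs (Rule k bd q)) by rewrite /heads map_rcons.
rewrite eh in hb4.
apply: ends_weaken (IH _ _ _ _ hb4 hp3 e19') (leqnn _) _.
move=> s' [pl'' [h1 h2 h3]]; exists pl''; rewrite -cat_rcons; split=> //.
by apply: built_weaken h1 => //; rewrite /=; lia.
Qed.

(** Defeaters, of code 3, are discarded first. Complementary consequents are then recognised by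
    comparing node numbers, so a statement costs constant time however many rules have the same
    consequent. *)
Definition sup_test : prog := 
  CIf (TLt 23 24) (CSeq (seqs [:: CLoad 23 14 21; CLoad 24 15 22])
    (CIf (TEq 23 24) (CSeq (seqs [:: CLoad 20 12 21; CLoad 25 12 22])
       (add_edge false 20 3 25 4)) CSkip)) CSkip.

Definition sup_step : prog :=
  CSeq (seqs [:: CRead 21; CRead 22; CLoad 23 13 21; CConst 24 3])
    (CSeq sup_test (CRead 18)).

Definition sups_loop : prog := CWhile (TLt 10 18) sup_step.

Lemma nth_heads D r : r < size (rules D) ->
  nth (Strict, (true, 0)) (heads (rules D)) r = (kind (rule_at D r), conseq (rule_at D r)).
Proof. by move=> lr; rewrite (nth_map (Rule Strict [::] (true, 0))). Qed.

Lemma built_sup_test pl fs rs sp W s t u :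
  let D sp := Theory fs rs sp in
  built pl (heads rs) (base (D sp)) (edge pl (D sp)) W s ->
  t < size rs -> u < size rs -> reg s 21 = t -> reg s 22 = u ->
  reg s 23 = arr s 13 t -> reg s 24 = 3 ->
  built pl (heads rs) (base (D (rcons sp (t, u)))) (edge pl (D (rcons sp (t, u))))
    W.+1 (run sup_test s) /\ input (run sup_test s) = input s.
Proof.
move=> D hb lt lu e21 e22 e23 e24.
have [E [O [stk h]]] := hb.
have sh : size (heads rs) = size rs by rewrite size_map.
have ru r : r < size rs -> let rho := rule_at (D sp) r in
    [/\ arr s 13 r = kind_code (kind rho), arr s 14 r = node s (0, conseq rho),
        arr s 15 r = node s (0, compl (conseq rho)) & (conseq rho).2 \in pl].
  move=> lr; have := bu_rules h (r := r); rewrite sh => /(_ lr).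
  by rewrite (nth_heads (D := D sp)).
have [g1 g2 _ g3] := ru t lt; have [_ _ k2 k3] := ru u lu.
(* Equal node numbers mean equal literals, by injectivity of [node] on valid atoms. *)
have eqv : (arr s 14 t == arr s 15 u) =
    (conseq (rule_at (D sp) t) == compl (conseq (rule_at (D sp) u))).
  rewrite g2 k2; apply/eqP/eqP => [e|-> //].
  have vt : valid pl (size (heads rs)) (0, conseq (rule_at (D sp) t)).
    by rewrite /valid /= g3.
  have vu : valid pl (size (heads rs)) (0, compl (conseq (rule_at (D sp) u))).
    by rewrite /valid /= k3.
  by case: (bu_inj h vt vu e).
have hE := edge_new_sup pl fs sp (rs := rs) (t := t) (s := u).
rewrite /sup_test run_if /eval_test e23 e24 g1.
have -> : kind_code (kind (rule_at (D sp) t)) < 3 = supportive (kind (rule_at (D sp) t)).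
  by case: kind.
case: ifP => kt; last first.
  split=> //; apply: built_weaken hb => // x y; rewrite hE // kt.
  by split=> [|[|[]]]; [left|..].
rewrite run_seq; set s1 := run _ s.
have hb1 : built pl (heads rs) (base (D sp)) (edge pl (D sp)) W s1 by apply: built_run hb.
have -> : run (CIf (TEq 23 24) (CSeq (seqs [:: CLoad 20 12 21; CLoad 25 12 22])
       (add_edge false 20 3 25 4)) CSkip) s1 =
    run (if conseq (rule_at (D sp) t) == compl (conseq (rule_at (D sp) u)) then
      (CSeq (seqs [:: CLoad 20 12 21; CLoad 25 12 22]) (add_edge false 20 3 25 4)) else CSkip) s1.
  by rewrite run_if -eqv /s1 /= /upd /= e21 e22.
case: eqP => ct; last first.
  split=> //; apply: built_weaken hb1 => // x y; rewrite hE //.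
  by split=> [|[|[]]]; [left|..].
rewrite run_seq; set s2 := run _ s1.
have hb2 : built pl (heads rs) (base (D sp)) (edge pl (D sp)) W s2 by apply: built_run hb1.
have n13 : node s2 (13, (true, t)) = reg s2 20 + 3.
  by rewrite /node /s2 /= /upd /= e21.
have n14 : node s2 (14, (true, u)) = reg s2 25 + 4.
  by rewrite /node /s2 /= /upd /= e22.
have i2 : input s2 = input s by [].
clearbody s2.
have v13 : valid pl (size (heads rs)) (13, (true, t)) by rewrite /valid /= sh lt.
have v14 : valid pl (size (heads rs)) (14, (true, u)) by rewrite /valid /= sh lu.
have [hb3 [_ _ i3]] := @built_add_edge _ _ _ _ _ _ 20 3 25 4 _ _ hb2 v13 v14 isT isT n13 n14.
split; last by rewrite i3.
apply: built_weaken hb3 => // x y; rewrite hE //; split=> -[h'|]; try by left.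
  by right.
by case=> _ _; right.
Qed.

Lemma sups_loop_correct c l fs rs sp pl W s w :
  cost sup_step <= c ->
  (forall t u, (t, u) \in l -> t < size rs /\ u < size rs) ->
  built pl (heads rs) (base (Theory fs rs sp)) (edge pl (Theory fs rs sp)) W s ->
  reg s 18 :: input s = encode_list (fun ts => [:: 1; ts.1; ts.2]) l ++ w ->
  ends_within sups_loop s (c.+1 * size l + 1)
    (fun s' => let D := Theory fs rs (sp ++ l) in
    built pl (heads rs) (base D) (edge pl D) (W + size l) s' /\ input s' = w).
Proof.
move=> lc; elim: l sp W s => [|[t u] l IH] sp W s wf hb.
  case=> e18 ei; rewrite muln0 add0n; apply: ends_while_false.
    by rewrite /= e18 (built_zero hb).
  by rewrite cats0 /= addn0.
rewrite encode_list_cons => -[e18 ei].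
apply: (@ends_weaken _ _ (c + (c.+1 * size l + 1)).+1 _ _ _ _ _ (fun _ => id));
  last by rewrite /= mulnS; lia.
apply: ends_while_true; first by rewrite /= e18 (built_zero hb).
apply: (ends_run _ lc) => //; rewrite /sup_step 2!run_seq.
set s1 := run _ s.
have hb1 : built pl (heads rs) (base (Theory fs rs sp)) (edge pl (Theory fs rs sp)) W s1.
  exact: built_run hb.
have [lt lu] := wf t u (mem_head _ _).
have [e21 e22 i1] : [/\ reg s1 21 = t, reg s1 22 = u & input s1 =
    encode_list (fun ts => [:: 1; ts.1; ts.2]) l ++ w] by rewrite /s1 /= /upd /= ei.
have [e23 e24] : reg s1 23 = arr s1 13 t /\ reg s1 24 = 3 by rewrite /s1 /= /upd /= ei.
clearbody s1; have [hb2 i2] := built_sup_test hb1 lt lu e21 e22 e23 e24.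
move: (run sup_test s1) hb2 i2 => s2 hb2 i2.
have e18' : reg (run (CRead 18) s2) 18 :: input (run (CRead 18) s2) =
    encode_list (fun ts => [:: 1; ts.1; ts.2]) l ++ w.
  by rewrite read_next i2 i1 //; apply: encode_list_cat_neq0.
have hb3 := @built_run (CRead 18) _ _ _ _ _ _ isT isT hb2.
have wf' t' u' : (t', u') \in l -> t' < size rs /\ u' < size rs.
  by move=> h; apply: wf; rewrite inE h orbT.
apply: ends_weaken (IH _ _ _ wf' hb3 e18') (leqnn _) _.
by move=> s'; rewrite -cat_rcons /= addSnnS.
Qed.

(** * Solving the graph *)

(** The part of [built_with] that stays true while the graph is being solved; [N] freezes the number
    of nodes. *)
Record laid_out (pl : seq nat) (nr : nat) (R : atom -> atom -> Prop)
    (E : graph) (O : nat -> bool) (N : nat) (s : state) : Prop := LaidOut {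
  lo_alloc : forall p, (0 < arr s 10 p) = (p \in pl);
  lo_np : reg s 12 = size pl;
  lo_list : forall k, k < size pl -> arr s 11 k = nth 0 pl k;
  lo_bound : forall x, valid pl nr x -> node s x < N;
  lo_inj : forall x y, valid pl nr x -> valid pl nr y -> node s x = node s y -> x = y;
  lo_valid : forall x y, R x y -> valid pl nr x /\ valid pl nr y;
  lo_edges : forall e, e \in E <-> exists x y, R x y /\ e = (node s x, node s y);
  lo_or : forall x, valid pl nr x -> O (node s x) = disjunctive x
}.

Lemma laid_out_same pl nr R E O N s s' :
  reg s' 12 = reg s 12 -> (forall a, 10 <= a -> arr s' a = arr s a) ->
  laid_out pl nr R E O N s -> laid_out pl nr R E O N s'.
Proof.
move=> h12 ha [h1 h2 h3 h4 h5 h6 h7 h8].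
have hn : node s' =1 node s by apply: node_eq; apply: ha.
split; rewrite ?h12 //.
- by move=> p; rewrite ha.
- by move=> k; rewrite ha; auto.
- by move=> x; rewrite hn; auto.
- by move=> x y; rewrite !hn; auto.
- by move=> e; rewrite h7; split=> -[x [y [? ->]]]; exists x, y; rewrite !hn.
- by move=> x; rewrite hn; auto.
Qed.

Definition marks (s : state) (T : atom -> Prop) (reached : seq nat) : Prop :=
  forall n, n \in reached <-> exists2 x, T x & n = node s x.

Lemma marks_same s s' (T T' : atom -> Prop) reached : node s' =1 node s ->
  (forall x, T x <-> T' x) -> marks s T reached -> marks s' T' reached.
Proof.
move=> hn hT h n; rewrite h; split=> -[x /hT Tx ->]; by exists x => //; rewrite hn.
Qed.

Section Solving.
Variables (pl : seq nat) (nr : nat) (R : atom -> atom -> Prop).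
Variables (E : graph) (O : nat -> bool) (N : nat).

Lemma marks_mem s (T : atom -> Prop) reached x :
  laid_out pl nr R E O N s -> (forall y, T y -> valid pl nr y) ->
  marks s T reached -> valid pl nr x -> node s x \in reached <-> T x.
Proof.
move=> lo vT h vx; rewrite h; split=> [[y Ty e]|Tx]; last by exists x.
by rewrite (lo_inj lo vx (vT y Ty) e).
Qed.

Let nat_edge (x y : nat) : Prop := (x, y) \in E.

Lemma closure_valid (G : atom -> Prop) s x : laid_out pl nr R E O N s ->
  (forall y, G y -> valid pl nr y) ->
  and_or_closure R disjunctive G x -> valid pl nr x.
Proof. by move=> lo hG [y /hG//|y z _ /(lo_valid lo)[]|y z _ /(lo_valid lo)[]]. Qed.

(** [node s] is injective on valid atoms, and all edges and fired atoms are valid, so the symbolic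
    and the numeric closure correspond. *)
Lemma closure_node (G : atom -> Prop) s n : laid_out pl nr R E O N s ->
  (forall y, G y -> valid pl nr y) ->
  and_or_closure nat_edge O (fun n => exists2 x, G x & n = node s x) n <->
  exists2 x, and_or_closure R disjunctive G x & n = node s x.
Proof.
move=> lo hG; have vC x := closure_valid lo hG (x := x); split.
- elim=> {n} [n [x Gx ->]|n m On /(lo_edges lo)[u [v [uv [em en]]]] _ [x Cx e]
             |n m On /(lo_edges lo)[u [v [uv [em en]]]] _ IH].
  + by exists x => //; apply: closure_base.
  + have [vu vv] := lo_valid lo uv; rewrite em in e.
    have eux := lo_inj lo vu (vC _ Cx) e; subst x.
    by exists v => //; apply: closure_or uv Cx; rewrite -(lo_or lo vv) -en.
  + have [vu vv] := lo_valid lo uv; exists v => //; apply: (closure_and _ uv).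
      by rewrite -(lo_or lo vv) -en.
    move=> z zv; have [x Cx e] : exists2 x, and_or_closure R disjunctive G x & node s z = node s x.
      by apply: IH; apply/(lo_edges lo); exists z, v; rewrite en.
    have [vz _] := lo_valid lo zv; by rewrite (lo_inj lo vz (vC _ Cx) e).
- case=> x Cx ->; elim: Cx => {n x} [x Gx|x y dx xy _ IH|x y dx xy _ IH].
  + by apply: closure_base; exists x.
  + have [_ vx] := lo_valid lo xy; apply: closure_or IH; first by rewrite (lo_or lo).
    by apply/(lo_edges lo); exists y, x.
  + have [_ vx] := lo_valid lo xy; apply: (@closure_and _ _ _ _ _ (node s y)).
    * by rewrite (lo_or lo).
    * by apply/(lo_edges lo); exists y, x.
    * move=> z /(lo_edges lo)[u [v [uv [-> e]]]]; apply: IH.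
      have [_ vv] := lo_valid lo uv; by rewrite (lo_inj lo vx vv e).
Qed.

Definition guard (src dst : nat) : prog :=
  CSeq (set_sum 22 16 src) (CSeq (CLoad 23 4 22) (CIf (TEq 23 10) (fire 16 dst) CSkip)).

Definition guard_step (src dst : nat) : prog :=
  CSeq (seqs [:: CLoad 14 11 21; CLoad 16 10 14]) (CSeq (guard src dst)
    (CSeq (addk 16 10) (CSeq (guard src dst) (CSucc 21)))).

Definition guards_loop (src dst : nat) : prog := CWhile (TLt 21 12) (guard_step src dst).

Definition guards (src dst : nat) : prog := CSeq (CConst 21 0) (guards_loop src dst).

Definition staged (T : atom -> Prop) (stk done : seq nat) (s : state) : Prop :=
  [/\ laid_out pl nr R E O N s, represents E stk done (remaining O done E) s,
      (forall x, T x -> valid pl nr x) & marks s T (stk ++ done)].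

Lemma staged_same T stk done s s' :
  (forall x, x \in [:: 0; 1; 10; 12] -> reg s' x = reg s x) ->
  (forall a, arr s' a = arr s a) -> staged T stk done s -> staged T stk done s'.
Proof.
move=> hr ha [lo rp vT mk]; split=> //.
- by apply: laid_out_same lo => //; apply: hr.
- by apply: represents_frame rp => //; split; apply: hr.
- by apply: marks_same mk => //; apply: node_eq; apply: ha.
Qed.

Lemma staged_guard (T : atom -> Prop) stk done s src dst q :
  src < 10 -> dst < 10 -> staged T stk done s -> q.2 \in pl -> reg s 16 = node s (0, q) ->
  let s' := run (guard src dst) s in
  (exists stk', staged (fun x => T x \/ ~ T (src, q) /\ x = (dst, q)) stk' done s') /\
  [/\ forall z, 10 <= z -> z != 22 -> z != 23 -> reg s' z = reg s z
    & forall a, 10 <= a -> arr s' a = arr s a].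
Proof.
move=> ls ld st qp e16; cbv zeta; rewrite /guard 2!run_seq.
have [h1 h2 _ _] := run_set_sum 22 16 src s; move: (run _ s) h1 h2 => s1 h1 h2.
set s2 := run _ s1.
have r2 z : z != 22 -> z != 23 -> reg s2 z = reg s z.
  by move=> n2 n3; rewrite /s2 /= /upd (negbTE n3) h1 (negbTE n2).
have a2 : arr s2 = arr s by [].
have n2 : node s2 =1 node s by apply: node_eq; rewrite a2.
have e23 : reg s2 23 = arr s 4 (node s (src, q)).
  by rewrite /s2 /= /upd /= h1 /= h2 e16 -node_literal.
have st2 : staged T stk done s2.
  by apply: staged_same st => [x|a]; rewrite ?a2 // !inE => /or4P[] /eqP->; rewrite r2.
clearbody s2; have [lo rp vT mk] := st2.
have vs : valid pl nr (src, q) by rewrite /valid /= ls qp.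
have vd : valid pl nr (dst, q) by rewrite /valid /= ld qp.
have mT : node s2 (src, q) \in stk ++ done <-> T (src, q) by apply: marks_mem lo vT mk vs.
rewrite -a2 -n2 (rep_reached rp) in e23.
rewrite run_if /eval_test (rep_zero rp) e23 eqb0.
case: ifPn => [/negP nT|/negPn/mT Ts]; last first.
  split; last by split=> [z lz n3 n4|a la]; rewrite ?r2 ?a2.
  exists stk; split=> //; first by move=> x [/vT//|[]].
  by apply: marks_same mk => // x; split=> [|[]//[]//]; left.
have nTs : ~ T (src, q) by move/mT.
have f := run_frame (fire 16 dst) s2.
have wr z : 10 <= z -> z \notin written_regs (fire 16 dst).
  move=> lz; have k c n : c < 10 -> (z \in written_regs (addk c n)) = false.
    by move=> lc; apply/negP => /written_regs_addk; lia.
  by rewrite /= !(inE, mem_cat) !k //=; lia.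
have wa a : 10 <= a -> a \notin written_arrs (fire 16 dst).
  have wk z k : written_arrs (addk z k) = [::] by elim: k.
  by move=> lz; rewrite /= !wk /= !inE; lia.
have fr z : 10 <= z -> reg (run (fire 16 dst) s2) z = reg s2 z.
  by move=> lz; apply: (frame_reg f); apply: wr.
have fa a : 10 <= a -> arr (run (fire 16 dst) s2) a = arr s2 a.
  by move=> lz; apply: (frame_arr f); apply: wa.
have rp' := run_fire 16 dst rp.
have nn : node (run (fire 16 dst) s2) =1 node s2 by apply: node_eq; apply: fa.
move: (run (fire 16 dst) s2) fr fa rp' nn {f} => s3 fr fa rp' nn.
split; last by split=> [z lz n3 n4|a la]; rewrite ?fr ?fa ?r2 ?a2.
exists (push (reg s2 16 + dst) stk done); split=> //.
- by apply: laid_out_same lo; [rewrite fr | ].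
- by move=> x [/vT//|[_ ->]].
- move=> n; rewrite mem_push inE r2 // e16 -node_literal // -n2 -nn.
  split=> [/orP[/eqP->|/mk[x Tx ->]]|[x [Tx|[_ ->]] ->]].
  + by exists (dst, q) => //; right.
  + by exists x; [left | rewrite nn].
  + by apply/orP; right; apply/mk; exists x; rewrite ?nn.
  + by rewrite eqxx.
Qed.

(** [l1] has been treated, [l2] is to come. As [src] and [dst] differ, firing guards never changes
    what is reached with tag [src], and each test still concerns the original [T]. *)
Lemma guards_loop_correct c (T : atom -> Prop) src dst done l1 l2 stk s :
  cost (guard_step src dst) <= c -> loopfree (guard_step src dst) ->
  src < 10 -> dst < 10 -> src != dst -> pl = l1 ++ l2 ->
  staged (fun x => T x \/ exists2 q, q.2 \in l1 & ~ T (src, q) /\ x = (dst, q)) stk done s ->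
  reg s 21 = size l1 ->
  ends_within (guards_loop src dst) s (c.+1 * size l2 + 1)
    (fun s' => exists stk', staged (extend pl src dst T T) stk' done s').
Proof.
move=> lc lf ls ld ne; elim: l2 l1 stk s => [|p l2 IH] l1 stk s epl st e21.
  rewrite muln0 add0n; have [lo _ _ _] := st.
  apply: ends_while_false; first by rewrite /= e21 (lo_np lo) epl cats0 ltnn.
  by exists stk; rewrite epl cats0 in st *.
apply: (@ends_weaken _ _ (c + (c.+1 * size l2 + 1)).+1 _ _ _ _ _ (fun _ => id));
  last by rewrite /= mulnS; lia.
have [lo _ _ _] := st.
have lt : size l1 < size pl by rewrite epl size_cat /=; lia.
apply: ends_while_true; first by rewrite /= e21 (lo_np lo).
apply: (ends_run _ lc) => //; rewrite /guard_step 4!run_seq.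
set s1 := run _ s.
have np : nth 0 pl (size l1) = p by rewrite epl nth_cat ltnn subnn.
have pp : p \in pl by rewrite epl mem_cat inE eqxx orbT.
have e16 : reg s1 16 = node s1 (0, (true, p)).
  by rewrite /node /s1 /= /upd /= e21 (lo_list lo) // np !addn0.
have st1 : staged (fun x => T x \/ exists2 q, q.2 \in l1 & ~ T (src, q) /\ x = (dst, q)) stk done s1.
  by apply: staged_same st => // x; rewrite !inE => /or4P[] /eqP->.
have e21' : reg s1 21 = size l1 by [].
clearbody s1.
have [[stk2 st2] [r2 a2]] := @staged_guard _ _ _ _ src dst (true, p) ls ld st1 pp e16.
move: (run _ s1) st2 r2 a2 => s2 st2 r2 a2.
have [h1 h2 _ _] := run_addk 16 10 s2; move: (run _ s2) h1 h2 => s3 h1 h2.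
have e16' : reg s3 16 = node s3 (0, (false, p)).
  by rewrite h1 /= r2 // e16 /node /= h2 a2 // !addn0.
have st3 T' : staged T' stk2 done s2 -> staged T' stk2 done s3.
  by apply: staged_same => [x|a]; rewrite ?h2 // !inE h1 => /or4P[] /eqP->.
have [[stk4 st4] [r4 a4]] := @staged_guard _ _ _ _ src dst (false, p) ls ld (st3 _ st2) pp e16'.
move: (run _ s3) st4 r4 a4 => s4 st4 r4 a4.
apply: (IH (rcons l1 p) stk4); first by rewrite cat_rcons.
- have st5 T' : staged T' stk4 done s4 -> staged T' stk4 done (run (CSucc 21) s4).
    by apply: staged_same => // x; rewrite !inE => /or4P[] /eqP->.
  have [lo4 rp4 v4 m4] := st5 _ st4.
  (* The left side is what two successive guards produce literally, each testing against the set
     enlarged so far; the spurious equations between tags [src] and [dst] are refuted. *)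
  have hT x : ((T x \/ (exists2 q, q.2 \in l1 & ~ T (src, q) /\ x = (dst, q))) \/
      ~ (T (src, (true, p)) \/ (exists2 q, q.2 \in l1 & ~ T (src, q) /\ (src, (true, p)) = (dst, q))) /\
      x = (dst, (true, p))) \/
      ~ ((T (src, (false, p)) \/ (exists2 q, q.2 \in l1 & ~ T (src, q) /\ (src, (false, p)) = (dst, q))) \/
        ~ (T (src, (true, p)) \/ (exists2 q, q.2 \in l1 & ~ T (src, q) /\ (src, (true, p)) = (dst, q))) /\
        (src, (false, p)) = (dst, (true, p))) /\ x = (dst, (false, p)) <->
      T x \/ exists2 q, q.2 \in rcons l1 p & ~ T (src, q) /\ x = (dst, q).
    have nd (b : bool) q : (src, (b, p)) = (dst, q) -> False by case=> e; rewrite e eqxx in ne.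
    split.
    + case=> [[[|[q hq [nT ->]]]|[nT ->]]|[nT ->]].
      * by left.
      * by right; exists q; rewrite ?mem_rcons ?inE ?hq ?orbT.
      * right; exists (true, p); rewrite ?mem_rcons ?inE ?eqxx //.
        by split=> // h; apply: nT; left.
      * right; exists (false, p); rewrite ?mem_rcons ?inE ?eqxx //.
        by split=> // h; apply: nT; left; left.
    + case=> [|[[b p'] /=]]; first by left; left; left.
      rewrite mem_rcons inE => /orP[/eqP->|hq] [nT ->]; last first.
        by left; left; right; exists (b, p').
      case: b nT => nT; [left; right | right]; split=> //.
        by case=> [//|[q _ [_ e]]]; apply: nd e.
      by case=> [[//|[q _ [_ e]]]|[_ e]]; apply: nd e.
  split=> //; first by move=> x /hT; apply: v4.
  by apply: marks_same m4.
- by rewrite /= /upd /= r4 // h1 /= r2 // e21' size_rcons.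
Qed.
(** Hands the counters over from one round to the next, which continues from them instead of
    starting afresh. *)
Lemma closed_saturated (G : nat -> Prop) done :
  (forall n, n \in done <-> and_or_closure nat_edge O G n) ->
  saturated E (remaining O done E) done.
Proof.
move=> h x y xy; rewrite /remaining; case Oy: (O y) => e; apply/h.
- move/eqP: e; rewrite eqb0 negbK => /hasP[[u v] uv /= /andP[/eqP ev hu]]; subst v.
  by apply: closure_or Oy uv _; apply/h.
- apply: (closure_and _ xy); first by rewrite Oy.
  move=> z zy; apply/h; move/eqP: e; rewrite eqn0Ngt -has_count.
  by move=> /hasPn/(_ _ zy) /=; rewrite eqxx /= negbK.
Qed.

Definition stage (src dst : nat) : prog := CSeq (guards src dst) propagate.

(** The 2 pays for setting the loop index and for the last test of the guard loop; the bracket is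
    the bound of [propagate_correct]. *)
Definition stage_time (c : nat) := 2 + c.+1 * size pl + (6 * N + follow_cost * size E + 1).

Lemma stage_correct c (T G : atom -> Prop) src dst stk done s :
  cost (guard_step src dst) <= c -> loopfree (guard_step src dst) ->
  src < 10 -> dst < 10 -> src != dst ->
  staged T stk done s -> (forall x, G x -> T x) ->
  (forall x, T x -> and_or_closure R disjunctive G x) ->
  saturated E (remaining O done E) (stk ++ done) ->
  let G' := extend pl src dst T G in
  ends_within (stage src dst) s (stage_time c)
    (fun s' => exists done',
      staged (and_or_closure R disjunctive G') [::] done' s' /\
      saturated E (remaining O done' E) done').
Proof.
move=> lc lf ls ld ne st GT TG sat G'; rewrite /stage_time.
rewrite (_ : 2 + c.+1 * size pl = 1 + (c.+1 * size pl + 1)); last by lia.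
apply: ends_seq; apply: ends_seq; apply: ends_run => //.
set s1 := run _ s.
have [lo0 rp0 vT mk0] := st.
have st1 : staged (fun x => T x \/ exists2 q, q.2 \in [::] & ~ T (src, q) /\ x = (dst, q)) stk done s1.
  have [lo1 rp1 v1 m1] : staged T stk done s1.
    by apply: staged_same st => // x; rewrite !inE => /or4P[] /eqP->.
  by split=> // [x [/v1//|[]//]|]; apply: marks_same m1 => // x; split=> [|[//|[]//]]; left.
have wa a : 10 <= a -> a \notin written_arrs (guards_loop src dst).
  have wk z k : written_arrs (addk z k) = [::] by elim: k.
  by move=> la; rewrite /= !wk /= !inE; lia.
apply: ends_weaken (ends_frame (guards_loop_correct (l1 := [::]) lc lf ls ld ne
  erefl st1 erefl)) (leqnn _) _.
move=> s2 [[stk1 {}st1] f] {st}.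
have nn0 : node s2 =1 node s by apply: node_eq; rewrite (frame_arr f) ?wa.
move: s2 st1 nn0 {f} => {}s1 st1 nn0.
have [lo rp vT' mk] := st1.
have vG x : G x -> valid pl nr x by move/GT/vT.
have vG' x : G' x -> valid pl nr x.
  by case=> [/vG//|[q hq [_ ->]]]; rewrite /valid /= ld hq.
have TG' x : extend pl src dst T T x -> and_or_closure R disjunctive G' x.
  case=> [/TG|[q hq [nT ->]]]; last by apply: closure_base; right; exists q.
  elim=> {x} [x Gx|x y dx xy _ IH|x y dx xy _ IH].
  - by apply: closure_base; left.
  - exact: closure_or dx xy IH.
  - exact: closure_and dx xy IH.
pose GN n := exists2 x, G' x & n = node s1 x.
(* Guards enlarge the reached set but expand nothing; the counters are unchanged, so saturation
   survives. *)
have sub : {subset stk ++ done <= stk1 ++ done}.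
  by move=> n /mk0[x Tx ->]; apply/mk; exists x; [left | rewrite nn0].
have eb x y : nat_edge x y -> x < N /\ y < N.
  move=> /(lo_edges lo)[u [v [uv [-> ->]]]]; have [vu vv] := lo_valid lo uv.
  by split; apply: (lo_bound lo).
have := @propagate_correct E O GN N eb stk1 done s1.
case.
- by move=> n [x /vG' vx ->]; apply: (lo_bound lo).
- move=> n [x [/GT Tx|hx] ->]; apply/mk; exists x => //; first by left.
  by right.
- exact: rp.
- move=> n /mk[x /TG' Cx ->]; apply/(closure_node _ lo vG'); by exists x.
- by move=> x y xy e; apply: sub; apply: sat xy e.
move=> n [s' [ex le [done' [rp' hd]]]]; exists n, s'; split=> //.
have f := exec_frame ex; exists done'; split; last exact: closed_saturated hd.
have fa a : 10 <= a -> arr s' a = arr s1 a.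
  by move=> la; apply: (frame_arr f); rewrite /= !inE; lia.
have nn : node s' =1 node s1 by apply: node_eq; apply: fa.
split=> //.
- by apply: laid_out_same lo => //; apply: (frame_reg f).
- by move=> x; apply: closure_valid lo vG'.
- move=> m; rewrite /= hd (closure_node _ lo vG').
  by split=> -[x Cx ->]; exists x => //; rewrite nn.
Qed.
End Solving.

(** * Assembling the program and its time bound *)

Definition setup : prog := CSeq (CConst 11 1) (fire 10 0).

(** The graph of the empty theory has the single node [start]: the node counter begins at 1, and
    number 0 is fired through the zero register. *)
Lemma built_setup w :
  let D := Theory [::] [::] [::] in let s := run setup (initial w) in
  built [::] (heads [::]) (base D) (edge [::] D) 1 s /\ input s = w.
Proof.
split; last by [].
have v x : valid [::] 0 x -> x = start by rewrite /valid andbF ltn0 andbF => /eqP.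
have hb : built [::] (heads [::]) (fun=> False) (fun _ _ => False) 1
    (run (CConst 11 1) (initial w)).
  exists [::], (fun=> false), [::]; split=> //=.
  - by move=> x /v->.
  - by move=> x y /v-> /v->.
  - by move=> e; split=> // -[x [y []]].
  - by move=> x /v->.
  - by move=> n; split=> // -[].
have vs : valid [::] (size (heads [::])) start by [].
have := @built_fire _ _ _ _ _ _ 10 0 start hb vs erefl.
apply: built_weaken => // [x|x y].
- by rewrite /base; split=> [[//|->]|[->|[]]]; [left|right|].
- by split=> // -[].
Qed.

Definition build : prog :=
  CSeq setup (CSeq (CSeq (CRead 18) facts_loop) (CSeq (CSeq (CRead 19) rules_loop)
    (CSeq (CRead 18) sups_loop))).

Definition solve : prog := CSeq (stage 0 1) (CSeq (stage 2 4) (stage 5 6)).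

Definition main : prog := CSeq build solve.

Lemma literals_size (l : seq literal) : size l <= sumn [seq lit_size a | a <- l].
Proof.
by elim: l => //= a l IH; rewrite -add1n; apply: leq_add IH; rewrite /lit_size; case: a.1.
Qed.

Lemma rule_size_body r : 1 + size (body r) <= rule_size r.
Proof.
rewrite /rule_size addnC; apply: leq_trans (leq_addr _ _); rewrite leq_add2r.
exact: literals_size.
Qed.

(** A symbol outside the body pays for the constant part of a rule, and each antecedent for its own
    share. *)
Lemma rules_sum a b (rs : seq rule) :
  sumn [seq a + b * size (body r) | r <- rs] <= (a + b) * sumn [seq rule_size r | r <- rs].
Proof.
elim: rs => [|r rs IH]; first by rewrite muln0.
rewrite /= mulnDr; apply: leq_add IH; have := rule_size_body r.
move: (size _) (rule_size r) => m k h; apply: (@leq_trans ((a + b) * (1 + m))); first by lia.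
by rewrite leq_mul2l h orbT.
Qed.

(** 88 is the 48 + 40 obtained from [rules_sum]; it also dominates 35 per fact and 1 per superiority
    statement, and the successor absorbs the node [start]. *)
Lemma build_correct c0 c1 ch c2 c3 D w : well_formed D -> cost setup <= c0 ->
  cost fact_step <= c1 -> cost rule_head <= ch -> cost body_step <= c2 ->
  cost sup_step <= c3 ->
  ends_within build (initial (encode_theory D ++ w))
    ((c0 + 6 + c1.+1 + (ch + 4 + c2.+1) + c3.+1) * (theory_size D).+1)
    (fun s => exists pl,
      [/\ built pl (heads (rules D)) (base D) (edge pl D) (88 * (theory_size D).+1) s,
          pl =i props D & input s = w]).
Proof.
case: D => fs rs sp [wf _] l0 l1 lh l2 l3.
pose n1 := sumn [seq lit_size q | q <- fs]; pose n2 := sumn [seq rule_size r | r <- rs].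
have f1 := literals_size fs; rewrite -/n1 in f1.
have f2 := rules_sum (ch + 4) c2.+1 rs; rewrite -/n2 in f2.
have f3 := rules_sum 48 40 rs; rewrite -/n2 in f3.
have en : theory_size (Theory fs rs sp) = n1 + n2 + 3 * size sp by [].
rewrite en; set rt := sumn _ in f2; set rw := sumn _ in f3.
apply: (@ends_weaken _ _ (c0 + ((1 + (c1.+1 * size fs + 1)) + ((1 + (rt + 1)) +
  (1 + (c3.+1 * size sp + 1))))) _ _ _ _ _ (fun _ => id)); last first.
  have g1 : c1.+1 * size fs <= c1.+1 * n1 by rewrite leq_mul2l f1 orbT.
  move: (ch + 4) f2 => k f2; nia.
apply: ends_seq; apply: (ends_run _ l0) => //.
have [hb0 i0] := built_setup (encode_theory (Theory fs rs sp) ++ w).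
move: (run setup _) hb0 i0 => s0 hb0 i0.
have {}i0 : input s0 = encode_list encode_literal fs ++ (encode_list encode_rule rs ++
    (encode_list (fun ts => [:: 1; ts.1; ts.2]) sp ++ w)) by rewrite i0 /encode_theory -!catA.
apply: ends_seq; apply: ends_seq; apply: ends_run => //.
have e1 := @read_next 18 s0; rewrite i0 in e1; have {}e1 := e1 (@encode_list_cat_neq0 _ _ _ _).
have hb1 := @built_run (CRead 18) _ _ _ _ _ _ isT isT hb0.
move: (run _ s0) hb1 e1 => s1 hb1 e1.
have hp1 : [::] =i props (Theory [::] [::] [::]) by [].
apply: ends_weaken (facts_loop_correct l1 hb1 hp1 e1) (leqnn _) _.
move=> s2 [pl2 [hb2 hp2 i2]].
apply: ends_seq; apply: ends_seq; apply: ends_run => //.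
have e3 := @read_next 19 s2; rewrite i2 in e3; have {}e3 := e3 (@encode_list_cat_neq0 _ _ _ _).
have hb3 := @built_run (CRead 19) _ _ _ _ _ _ isT isT hb2.
move: (run _ s2) hb3 e3 => s3 hb3 e3.
apply: ends_weaken (rules_loop_correct (rs := [::]) lh l2 hb3 hp2 e3) (leqnn _) _.
move=> s4 [pl4 [hb4 hp4 i4]].
apply: ends_seq; apply: ends_run => //.
have e5 := @read_next 18 s4; rewrite i4 in e5; have {}e5 := e5 (@encode_list_cat_neq0 _ _ _ _).
have hb5 := @built_run (CRead 18) _ _ _ _ _ _ isT isT hb4.
move: (run _ s4) hb5 e5 => s5 hb5 e5.
have wf' t u : (t, u) \in sp -> t < size ([::] ++ rs) /\ u < size ([::] ++ rs) by apply: wf.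
apply: ends_weaken (sups_loop_correct l3 wf' hb5 e5) (leqnn _) _.
move=> s6 [hb6 i6]; exists pl4; split=> //.
have arith a b m1 m2 z : a <= m1 -> b <= (48 + 40) * m2 ->
  1 + 35 * a + b + z <= 88 * (m1 + m2 + 3 * z).+1 by lia.
by apply: built_weaken hb6 => //; apply: arith f1 f3.
Qed.

Lemma laid_out_built pl hs B R W E O stk s : built_with pl hs B R W E O stk s ->
  laid_out pl (size hs) R E O (reg s 11) s.
Proof. by case. Qed.

(** Holds vacuously: before any expansion every node with an incoming edge has a positive
    counter. *)
Lemma fresh_saturated E O reached : saturated E (remaining O [::] E) reached.
Proof.
move=> x y xy; rewrite /remaining; case: (O y) => e.
  by move/eqP: e; rewrite eqb0 negbK => /hasP[e' _ /=]; rewrite andbF.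
move/eqP: e; rewrite eqn0Ngt -has_count => /hasPn/(_ _ xy) /=.
by rewrite eqxx.
Qed.

Definition conclusions_reached (pl : seq nat) (D : theory) : atom -> Prop :=
  and_or_closure (edge pl D) disjunctive (base3 D pl).

Definition solved (pl : seq nat) (D : theory) (s : state) : Prop :=
  exists E O N done,
    staged pl (size (rules D)) (edge pl D) E O N (conclusions_reached pl D) [::] done s.

Lemma solve_correct c pl D W s :
  cost (guard_step 0 1) <= c -> cost (guard_step 2 4) <= c -> cost (guard_step 5 6) <= c ->
  built pl (heads (rules D)) (base D) (edge pl D) W s ->
  ends_within solve s ((3 * (c.+1 + 6 + follow_cost + 3)) * W.+1) (solved pl D).
Proof.
move=> l1 l2 l3 [E [O [stk hb]]].
have lo := laid_out_built hb; have sz := bu_size hb.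
have sh : size (heads (rules D)) = size (rules D) by rewrite size_map.
rewrite sh in lo.
have st : staged pl (size (rules D)) (edge pl D) E O (reg s 11) (base D) stk [::] s.
  split=> //; first exact: (bu_rep hb).
    by rewrite -sh; exact: (bu_base hb).
  by move=> n; rewrite cats0; exact: (bu_stk hb).
move: (reg s 11) sz lo st => N sz lo st.
have bt : stage_time pl E N c <= (c.+1 + 6 + follow_cost + 3) * W.+1.
  rewrite /stage_time; move: follow_cost (size pl) (size E) sz => f a b sz; nia.
apply: (@ends_weaken _ _ (stage_time pl E N c + (stage_time pl E N c + stage_time pl E N c))
  _ _ _ _ _ (fun _ => id)); last by lia.
apply: ends_seq.
apply: ends_weaken (stage_correct l1 isT isT isT isT st (fun _ => id) _ _) (leqnn _) _.
- by move=> x; apply: closure_base.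
- exact: fresh_saturated.
move=> s1 [done1 [st1 sat1]]; apply: ends_seq.
apply: ends_weaken (stage_correct l2 isT isT isT isT st1 _ (fun _ => id) sat1) (leqnn _) _.
- by move=> x; apply: closure_base.
move=> s2 [done2 [st2 sat2]].
apply: ends_weaken (stage_correct l3 isT isT isT isT st2 _ (fun _ => id) sat2) (leqnn _) _.
- by move=> x; apply: closure_base.
by move=> s3 [done3 [st3 _]]; exists E, O, N, done3.
Qed.

(** [w] is the query that may follow the theory on the tape and has to be left unread. *)
Lemma main_correct : exists k, forall D w, well_formed D ->
  ends_within main (initial (encode_theory D ++ w)) (k * (theory_size D).+1)
    (fun s => exists pl, [/\ solved pl D s, pl =i props D, input s = w, output s = [::]
       & size pl <= 88 * (theory_size D).+1]).
Proof.
pose c := maxn (cost (guard_step 0 1)) (maxn (cost (guard_step 2 4)) (cost (guard_step 5 6))).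
pose k1 := cost setup + 6 + (cost fact_step).+1
  + (cost rule_head + 4 + (cost body_step).+1) + (cost sup_step).+1.
pose k2 := 3 * (c.+1 + 6 + follow_cost + 3).
(* The time of [solve] is linear in one more than the size of the graph, and 88(n+1) + 1 is at most
   89(n+1). *)
exists (k1 + k2 * 89) => D w wf.
apply: (@ends_weaken _ _ (k1 * (theory_size D).+1 + k2 * (88 * (theory_size D).+1).+1)
  _ _ _ _ _ (fun _ => id)); last first.
  by move: k1 k2 (theory_size D) => a b n; nia.
have m1 : cost (guard_step 0 1) <= c by apply: leq_maxl.
have m2 : cost (guard_step 2 4) <= c by rewrite /c leq_max leq_maxl orbT.
have m3 : cost (guard_step 5 6) <= c by rewrite /c !leq_max leqnn !orbT.
clearbody c.
(* That the output is still empty follows from the text of [main], which contains no write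
   instruction. *)
suff H : ends_within main (initial (encode_theory D ++ w))
    (k1 * (theory_size D).+1 + k2 * (88 * (theory_size D).+1).+1)
    (fun s => exists pl, [/\ solved pl D s, pl =i props D, input s = w
       & size pl <= 88 * (theory_size D).+1]).
  apply: ends_weaken (ends_frame H) (leqnn _) _ => s [[pl [h1 h2 h3 h4]] f].
  by exists pl; split=> //; rewrite (frame_output f).
apply: ends_seq; apply: ends_weaken (build_correct w wf (leqnn _) (leqnn _) (leqnn _) (leqnn _)
  (leqnn _)) (leqnn _) _.
move=> s [pl [hb hp hi]].
have sp : size pl <= 88 * (theory_size D).+1.
  by have [E [O [stk h]]] := hb; have := bu_size h; lia.
apply: ends_weaken (ends_frame (solve_correct m1 m2 m3 hb)) (leqnn _) _ => s' [h f].
by exists pl; split=> //; rewrite (frame_input f).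
Qed.

(** * Output *)

Definition reached (s : state) (c : conclusion) : bool :=
  0 < arr s 4 (node s (tag_node c.1, c.2)).

Lemma solved_reached pl D s c : solved pl D s -> {subset props D <= pl} ->
  reached s c /\ c.2.2 \in pl <-> consequence D c /\ c.2.2 \in pl.
Proof.
move=> [E [O [N [done [lo rp vT mk]]]]] hp; rewrite -(reach_base3 hp).
rewrite /reached (rep_reached rp) lt0b.
have hv : c.2.2 \in pl -> valid pl (size (rules D)) (tag_node c.1, c.2).
  by rewrite /valid /= => ->; case: c.1.
split=> -[h hq]; split=> //; have := marks_mem lo vT mk (hv hq) => -[h1 h2].
  exact: h1.
exact: h2.
Qed.

Definition emit (x : signed_tag * bool) : prog :=
  CSeq (set_sum 22 15 ((if x.2 then 0 else 10) + tag_node x.1)) (CSeq (CLoad 23 4 22)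
    (CIf (TEq 23 10) CSkip
      (seqs [:: CConst 24 (signed_tag_code x.1); CWrite 24;
                CConst 24 (if x.2 then 1 else 2); CWrite 24; CWrite 14]))).

Definition emits (l : seq (signed_tag * bool)) : prog :=
  foldr (fun x p => CSeq (emit x) p) CSkip l.

Definition encode_conclusion (c : conclusion) : seq nat :=
  signed_tag_code c.1 :: encode_literal c.2.

Definition about (p : nat) (l : seq (signed_tag * bool)) : seq conclusion :=
  [seq (x.1, (x.2, p)) | x <- l].

(** The bound 22 separates the scratch registers of [emit] from the loop index in 21 and from
    everything the loop relies on. *)
Lemma run_emits l s p :
  reg s 10 = 0 -> reg s 14 = p -> reg s 15 = arr s 10 p ->
  let s' := run (emits l) s in
  [/\ output s' = output s ++
        flatten [seq encode_conclusion c | c <- about p l & reached s c],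
      arr s' = arr s & forall z, z < 22 -> reg s' z = reg s z].
Proof.
elim: l s => [|x l IH] s e10 e14 e15; first by rewrite /= cats0.
cbv zeta; rewrite [emits _]/= -/(emits l) run_seq.
have [o1 a1 r1] : [/\ output (run (emit x) s) = output s ++
      (if reached s (x.1, (x.2, p)) then encode_conclusion (x.1, (x.2, p)) else [::]),
    arr (run (emit x) s) = arr s & forall z, z < 22 -> reg (run (emit x) s) z = reg s z].
  rewrite /emit 2!run_seq.
  have [h1 h2 _ h3] := run_set_sum 22 15 ((if x.2 then 0 else 10) + tag_node x.1) s.
  move: (run _ s) h1 h2 h3 => s1 h1 h2 h3.
  have e : (reg (run (CLoad 23 4 22) s1) 23 == reg (run (CLoad 23 4 22) s1) 10) =
      ~~ reached s (x.1, (x.2, p)).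
    rewrite /= /upd /= h1 /= h1 /= e10 h2 e15 /reached /node /= -eqn0Ngt.
    by rewrite addnA (_ : tag_node x.1 < 10) //; case: x.1.
  rewrite run_if /eval_test e; case: (reached _ _) => /=.
    rewrite /upd /= h1 /= e14 h3 -!cats1 -!catA h2; split=> // z lz.
    by rewrite !ifF ?h1 ?ifF //; lia.
  rewrite h3 h2 cats0 /upd; split=> // z lz.
  by rewrite ifF ?h1 ?ifF //; lia.
move: (run (emit x) s) o1 a1 r1 => s1 o1 a1 r1.
have [||| o2 a2 r2] := IH s1; rewrite ?r1 ?a1 //.
have er c : reached s1 c = reached s c by rewrite /reached /node a1.
split; [|by rewrite a2|by move=> z lz; rewrite r2 // r1].
rewrite o2 o1 -catA /=; congr (_ ++ _).
under eq_filter do rewrite er.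
by case: (reached _ _).
Qed.

Definition kinds : seq (signed_tag * bool) :=
  [seq (d, b) | d <- [:: PlusDelta; MinusDelta; PlusLambda; PlusPartial], b <- [:: true; false]].

Definition list_step : prog :=
  CSeq (seqs [:: CLoad 14 11 21; CLoad 15 10 14]) (CSeq (emits kinds) (CSucc 21)).

Definition list_loop : prog := CWhile (TLt 21 12) list_step.

Definition list_all : prog := CSeq (CConst 21 0) (CSeq list_loop (CWrite 10)).

Definition all_reached (s : state) (pl : seq nat) : seq conclusion :=
  flatten [seq [seq c <- about p kinds | reached s c] | p <- pl].

(** Printing changes no array, so what is reached can be evaluated in the fixed state [s0] in which
    printing began. *)
Lemma list_loop_correct c s0 l1 l2 s :
  cost list_step <= c -> arr s = arr s0 -> reg s 10 = 0 -> reg s 21 = size l1 ->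
  reg s 12 = size (l1 ++ l2) ->
  (forall k, k < size (l1 ++ l2) -> arr s0 11 k = nth 0 (l1 ++ l2) k) ->
  ends_within list_loop s (c.+1 * size l2 + 1)
    (fun s' => output s' = output s ++ flatten [seq encode_conclusion c | c <- all_reached s0 l2]
       /\ reg s' 10 = 0).
Proof.
move=> lc; elim: l2 l1 s => [|p l2 IH] l1 s ea e10 e21 e12 hl.
  rewrite muln0 add0n; apply: ends_while_false; last by rewrite cats0.
  by rewrite /= e21 e12 cats0 ltnn.
apply: (@ends_weaken _ _ (c + (c.+1 * size l2 + 1)).+1 _ _ _ _ _ (fun _ => id));
  last by rewrite /= mulnS; lia.
have lt : size l1 < size (l1 ++ p :: l2) by rewrite size_cat /=; lia.
apply: ends_while_true; first by rewrite /= e21 e12.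
apply: (ends_run _ lc) => //; rewrite /list_step 2!run_seq; set s1 := run _ s.
have ep : arr s 11 (size l1) = p by rewrite ea hl // nth_cat ltnn subnn.
have [||| o2 a2 r2] := @run_emits kinds s1 p.
- by [].
- by rewrite /s1 /= /upd /= e21.
- by rewrite /s1 /= /upd /= e21 ep.
have o1 : output s1 = output s by [].
have a1 : arr s1 = arr s0 by [].
have [r10 r12 r21] : [/\ reg s1 10 = 0, reg s1 12 = size (l1 ++ p :: l2) & reg s1 21 = size l1] by [].
clearbody s1; move: (run (emits kinds) s1) o2 a2 r2 => s2 o2 a2 r2.
have er d : reached s1 d = reached s0 d by rewrite /reached /node a1.
rewrite -cat_rcons in hl r12.
apply: ends_weaken (IH (rcons l1 p) _ _ _ _ _ hl) (leqnn _) _.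
- by rewrite /= a2.
- by rewrite /= /upd /= r2.
- by rewrite /= /upd /= r2 // r21 size_rcons.
- by rewrite /= /upd /= r2.
move=> s' [-> ->]; split=> //.
have -> : all_reached s0 (p :: l2) =
  [seq d <- about p kinds | reached s0 d] ++ all_reached s0 l2 by [].
by rewrite [output (run _ _)]/= o2 o1 -catA map_cat flatten_cat (eq_filter er).
Qed.

Lemma list_all_correct c pl D s : cost list_step <= c -> solved pl D s ->
  output s = [::] ->
  ends_within list_all s (c.+1 * size pl + 3)
    (fun s' => output s' = encode_conclusions (all_reached s pl)).
Proof.
move=> lc [E [O [N [done [lo rp _ _]]]]] o0.
rewrite (_ : _ + 3 = 1 + ((c.+1 * size pl + 1) + 1)); last by lia.
apply: ends_seq; apply: ends_run => //; apply: ends_seq.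
apply: ends_weaken (@list_loop_correct c s [::] pl (run (CConst 21 0) s) lc _ _ _ _ _) (leqnn _) _.
- by [].
- exact: (rep_zero rp).
- by [].
- exact: (lo_np lo).
- exact: (lo_list lo).
move=> s' [o1 e10]; apply: ends_run => //.
by rewrite /= e10 o1 /= o0 -cats1.
Qed.

Lemma mem_all_reached s pl c :
  (c \in all_reached s pl) = reached s c && (c.2.2 \in pl).
Proof.
apply/flatten_mapP/andP => [[p pp]|[rc cp]].
- by rewrite mem_filter => /andP[rc /mapP[x _ e]]; rewrite e /= in rc *.
- exists c.2.2 => //; rewrite mem_filter rc /=; case: c {rc cp} => d [b p].
  by case: d; case: b; rewrite /= !inE ?eqxx ?orbT.
Qed.

(** * Answering a query *)

Definition answer (k : nat) : prog := CSeq (addk 15 k) (seqs [:: CLoad 23 4 15; CWrite 23]).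

(** A proposition with entry 0 does not occur in the theory, and the answer is 0; otherwise the cell
    of array 4 is itself the answer bit. *)
Definition query : prog :=
  CSeq (seqs [:: CRead 19; CRead 18; CRead 14; CLoad 15 10 14; CConst 21 2])
    (CIf (TEq 15 10) (CWrite 10)
      (CSeq (CIf (TEq 18 21) (addk 15 10) CSkip)
        (CSeq (CConst 21 1) (CIf (TEq 19 21) (answer 2)
          (CSeq (CConst 21 2) (CIf (TEq 19 21) (answer 5) (answer 7))))))).

Lemma run_answer k s :
  output (run (answer k) s) = rcons (output s) (arr s 4 (reg s 15 + k)).
Proof.
rewrite /answer run_seq; have [h1 h2 _ h3] := run_addk 15 k s.
by move: (run _ s) h1 h2 h3 => s1 h1 h2 h3; rewrite /= /upd /= h3 h2 h1.
Qed.

Lemma query_correct pl D s d q : solved pl D s -> output s = [::] ->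
  input s = tag_code d :: encode_literal q ->
  output (run query s) = [:: nat_of_bool ((q.2 \in pl) && reached s (plus_tag d, q))].
Proof.
move=> [E [O [N [done [lo rp _ _]]]]] o0 i0; have z10 := rep_zero rp.
rewrite /query run_seq; set s1 := run _ s.
have [e18 e19 e15] : [/\ reg s1 18 = sign_code q, reg s1 19 = tag_code d
    & reg s1 15 = arr s 10 q.2] by rewrite /s1 /= /upd /= i0.
have [r10 r21 a1 o1] : [/\ reg s1 10 = 0, reg s1 21 = 2, arr s1 = arr s & output s1 = [::]].
  by split.
clearbody s1; rewrite run_if /eval_test e15 r10 -(lo_alloc lo) lt0n.
case: eqP => [_|_]; first by rewrite /= o1 r10.
rewrite andTb 2!run_seq; set s2 := run (CIf _ _ _) s1.
have [b15 b19 ab ob] : [/\ reg s2 15 = arr s 10 q.2 + (if q.1 then 0 else 10),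
    reg s2 19 = tag_code d, arr s2 = arr s & output s2 = [::]].
  rewrite /s2 run_if /eval_test e18 r21 /sign_code; have [h1 h2 _ h3] := run_addk 15 10 s1.
  by case: q.1; rewrite ?addn0 // h1 h1 h2 h3 /= e15.
clearbody s2; rewrite /reached.
have fin t k : k = tag_node (plus_tag d) -> reg t 15 = reg s2 15 -> arr t = arr s ->
    output t = [::] -> output (run (answer k) t) =
    [:: nat_of_bool (0 < arr s 4 (node s (tag_node (plus_tag d), q)))].
  move=> -> t1 t2 t3; rewrite run_answer t3 t2 t1 b15.
  rewrite {1}(_ : _ + _ = node s (tag_node (plus_tag d), q)); last by rewrite /node; case: (d).
  by rewrite (rep_reached rp); case: (_ \in _).
have cmp v p1 p2 t : run (CIf (TEq 19 21) p1 p2) (run (CConst 21 v) t) =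
    run (if reg t 19 == v then p1 else p2) (run (CConst 21 v) t) by rewrite run_if.
rewrite cmp b19; case: d fin {i0 e19 b19} (b19) => fin b19; rewrite [_ == _]/=.
- exact: fin.
- by rewrite run_seq cmp [reg _ _]b19 [_ == _]/=; apply: fin.
- by rewrite run_seq cmp [reg _ _]b19 [_ == _]/=; apply: fin.
Qed.

Theorem theorem1 :
  (exists (p : prog) (k : nat), forall D : theory, well_formed D ->
     exists cs : seq conclusion, lists_consequences D cs /\
       computes_within p (encode_theory D) (k * (theory_size D).+1)
         (encode_conclusions cs))
  /\
  (exists (p : prog) (k : nat), forall D : theory, well_formed D ->
     forall (d : dtag) (q : literal), exists b : bool,
       (b <-> consequence D (plus_tag d, q)) /\
       computes_within p (encode_query D d q) (k * (theory_size D).+1)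
         [:: nat_of_bool b]).
Proof.
have [k hk] := main_correct; split.
(* Replacing the cost by an unspecified bound keeps the arithmetic below from evaluating it. *)
- have [c lc] : exists c, cost list_step <= c by exists (cost list_step).
  exists (CSeq main list_all), (k + (c.+1 * 88 + 3)) => D wf.
  have := ends_seq (t2 := c.+1 * (88 * (theory_size D).+1) + 3)
    (p2 := list_all) (Q := fun s' => exists2 cs, lists_consequences D cs &
       output s' = encode_conclusions cs) (ends_weaken (hk D [::] wf) (leqnn _) _).
  case=> [s [pl [sv hp _ o0 sz]]|n [s [ex le [cs lcs oc]]]].
    apply: ends_weaken (list_all_correct lc sv o0) _ _ => [|s' os].
      by rewrite leq_add2r leq_mul2l sz orbT.
    exists (all_reached s pl) => // x; rewrite mem_all_reached.
    have hs : {subset props D <= pl} by move=> z; rewrite hp.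
    by rewrite -hp -(solved_reached _ sv hs); split=> /andP.
  exists cs; split=> //; exists n, s; split=> //; first by rewrite cats0 in ex.
  by apply: leq_trans le _; nia.
- exists (CSeq main query), (k + cost query) => D wf d q.
  have := ends_seq (t2 := cost query)
    (p2 := query) (Q := fun s' => exists2 b : bool, b <-> consequence D (plus_tag d, q) &
       output s' = [:: nat_of_bool b])
    (ends_weaken (hk D (tag_code d :: encode_literal q) wf) (leqnn _) _).
  case=> [s [pl [sv hp i0 o0 _]]|n [s [ex le [b hb ob]]]].
    apply: ends_run => //; exists ((q.2 \in pl) && reached s (plus_tag d, q));
      last exact: query_correct sv o0 i0.
    have hs : {subset props D <= pl} by move=> z; rewrite hp.
    have h := solved_reached (plus_tag d, q) sv hs; split.
      by move=> /andP[qp rq]; have [] := h.1 (conj rq qp).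
    (* A positive consequence concerns an occurring proposition, so the early answer 0 is never
       wrong. *)
    move=> hc; have qp := plus_consequence_prop hs hc.
    by rewrite qp; have [] := h.2 (conj hc qp).
  exists b; split=> //; exists n, s; split=> //.
  by apply: leq_trans le _; move: (cost query) => c; nia.
Qed.
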